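(* Let $(M^{n+2},g_+)$ be a Poincaré--Einstein manifold with boundary $\Sigma^{n+1}=\partial M$, and let $Y^{n+1}$ be an asymptotically minimal hypersurface of $M$. Then $\hat\eta-n\overline B_{00}$ is a conformal invariant of $\partial Y$ of weight $-1$: if $\hat g$ and $\tilde g=e^{2w}\hat g$ are two metrics in the conformal infinity of $(M,g_+)$, with corresponding special defining functions $r$ and $\rho$, and $\tilde\eta,\tilde{\overline B}_{00}$ are the quantities corresponding to $\rho^2g_+$ (as $\hat\eta,\overline B_{00}$ correspond to $r^2g_+$), then on $\partial Y$ $$\hat\eta-n\overline B_{00}=e^{w}\left(\tilde\eta-n\tilde{\overline B}_{00}\right).$$ Moreover, $\hat\eta-n\overline B_{00}$ vanishes (on $\partial Y$) if and only if $H^Y=O(r^2)$.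
   Context: Let $\overline M^{n+2}$ be a compact smooth manifold with nonempty boundary $\Sigma^{n+1}$ and interior $M$. A defining function for $\Sigma$ is a function $r$ with $r>0$ in $M$, $r^{-1}(0)=\Sigma$, $dr\neq0$ on $\Sigma$. A complete metric $g_+$ on $M$ is conformally compact if $r^2g_+$ extends to a metric on $\overline M$ of class $C^{m,\alpha}$ (throughout $m\ge3$, $\alpha\in(0,1)$; submanifolds have the same regularity up to the boundary), and Poincaré--Einstein if moreover $\mathrm{Ric}_{g_+}=-(n+1)g_+$. The conformal infinity is $(\Sigma,[(r^2g_+)|_{T\Sigma}])$. For each $\hat g$ in the conformal infinity there is a special defining function $r$, unique near $\Sigma$, with $|dr|^2_{r^2g_+}\equiv1$ in a collar and $(r^2g_+)|_{T\Sigma}=\hat g$; put $\overline g=r^2g_+$ and let $\partial_r=\nabla_{\overline g}r$. An asymptotically minimal hypersurface $Y^{n+1}$ is an immersed hypersurface which is conformally compact, meets $\Sigma$ transversely at $\partial Y^n\subset\Sigma$, and whose mean curvature vector $H$ with respect to $g_+$ satisfies $g_+(H,H)=O(r)$ with limit zero in the sense of regularity up to the boundary, i.e. its scalar mean curvature $H^Y$ satisfies $H^Y=O(r)$ (equivalently, $Y$ meets $\Sigma$ at right angles). Mean curvatures are traces of second fundamental forms. $N$ and $\overline N$ denote unit normals of $Y$ with respect to $g_+$ and $\overline g$ pointing in the same direction ($N=r\overline N$); $H^Y$ is the scalar mean curvature with respect to $N$. $\overline B(X,Z)=\overline g(\nabla^{\overline g}_XZ,\overline N)$ is the second fundamental form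 of $\overline Y$ in $(\overline M,\overline g)$, and $\overline B_{00}=\overline B(\partial_r,\partial_r)$ at points of $\partial Y$ (where $\partial_r$ is tangent to $\overline Y$). $\hat\eta$ is the scalar mean curvature (trace of the second fundamental form) of $\partial Y$ as a hypersurface of $(\Sigma,\hat g)$ with respect to the unit normal $\overline N|_{\partial Y}$. *)

(* Defs.v *)
From HB Require Import structures.
From mathcomp Require Import all_boot all_order all_algebra.
From mathcomp Require Import all_classical all_reals all_analysis.
Set Implicit Arguments.
Unset Strict Implicit.
Unset Printing Implicit Defensive.
Import Order.TTheory GRing.Theory Num.Theory.
Import numFieldNormedType.Exports.
Local Open Scope classical_set_scope.
Local Open Scope ring_scope.

Definition halfspace (R : realType) (d : nat) : set 'rV[R]_d.+1 :=
  [set x | 0 <= x 0 ord0].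
Arguments halfspace : clear implicits.

Definition diffquot (R : realType) (d : nat) (f : 'rV[R]_d -> R) (a : 'I_d)
    (x : 'rV[R]_d) (h : R) : R :=
  h^-1 * (f (x + h *: delta_mx 0 a) - f x).

(* Only increments staying in D are allowed: for D = halfspace this is the
   two-sided derivative at interior points, and the one-sided normal derivative
   at boundary points. *)
Definition increments (R : realType) (d : nat) (D : set 'rV[R]_d) (a : 'I_d)
    (x : 'rV[R]_d) : set_system R :=
  within [set h | D (x + h *: delta_mx 0 a)] 0^'.

Definition pderivable (R : realType) (d : nat) (D : set 'rV[R]_d)
    (f : 'rV[R]_d -> R) (a : 'I_d) (x : 'rV[R]_d) : Prop :=
  cvg (diffquot f a x @ increments D a x).

Definition pder (R : realType) (d : nat) (D : set 'rV[R]_d)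
    (f : 'rV[R]_d -> R) (a : 'I_d) (x : 'rV[R]_d) : R :=
  lim (diffquot f a x @ increments D a x).

Inductive regularity (R : Type) :=
  | Cfin of nat
  | CHolder of nat & R
  | Cinfty.
Arguments Cfin {R} _.
Arguments CHolder {R} _ _.
Arguments Cinfty {R}.

Definition locally_holder (R : realType) (d : nat) (alpha : R)
    (U : set 'rV[R]_d.+1) (f : 'rV[R]_d.+1 -> R) : Prop :=
  forall x, U x -> exists C : R, exists2 V, nbhs x V &
    forall y z, U y -> V y -> U z -> V z ->
      `|f y - f z| <= C * `|y - z| `^ alpha.

(* U is relatively open in the half-space; the partial derivatives of order
   <= k exist, are continuous on U, including at the boundary points of U, and
   those of order k satisfy P. *)
Fixpoint Ck_with (R : realType) (d : nat)
    (P : set 'rV[R]_d.+1 -> ('rV[R]_d.+1 -> R) -> Prop) (k : nat)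
    (U : set 'rV[R]_d.+1) (f : 'rV[R]_d.+1 -> R) : Prop :=
  {within U, continuous f} /\
  if k is k'.+1 then
    forall a : 'I_d.+1,
      (forall x, U x -> pderivable (halfspace R d) f a x) /\
      Ck_with P k' U (pder (halfspace R d) f a)
  else P U f.

Definition of_class (R : realType) (d : nat) (c : regularity R)
    (U : set 'rV[R]_d.+1) (f : 'rV[R]_d.+1 -> R) : Prop :=
  match c with
  | Cfin k => Ck_with (fun _ _ => True) k U f
  | CHolder k alpha => Ck_with (locally_holder alpha) k U f
  | Cinfty => forall k, Ck_with (fun _ _ => True) k U f
  end.

Definition map_of_class (R : realType) (p q : nat) (c : regularity R)
    (U : set 'rV[R]_p.+1) (F : 'rV[R]_p.+1 -> 'rV[R]_q) : Prop :=
  forall k : 'I_q, of_class c U (fun x => F x 0 k).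

(* Row-vector convention: the differential is v |-> v *m jac D F x. *)
Definition jac (R : realType) (p q : nat) (D : set 'rV[R]_p)
    (F : 'rV[R]_p -> 'rV[R]_q) (x : 'rV[R]_p) : 'M[R]_(p, q) :=
  \matrix_(a, k) pder D (fun y => F y 0 k) a x.

Definition inner (R : realType) (q : nat) (G : 'M[R]_q) (u v : 'rV[R]_q) : R :=
  (u *m G *m v^T) 0 0.

(* Throughout, G is the matrix of a metric in coordinates. *)
Definition gradient (R : realType) (q : nat) (D : set 'rV[R]_q)
    (G : 'rV[R]_q -> 'M[R]_q) (r : 'rV[R]_q -> R) (x : 'rV[R]_q) : 'rV[R]_q :=
  (\row_l pder D r l x) *m invmx (G x).

Definition christoffel (R : realType) (q : nat) (D : set 'rV[R]_q)
    (G : 'rV[R]_q -> 'M[R]_q) (k i j : 'I_q) (x : 'rV[R]_q) : R :=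
  2^-1 * \sum_(l < q) invmx (G x) k l *
    (pder D (fun y => G y j l) i x + pder D (fun y => G y i l) j x
     - pder D (fun y => G y i j) l x).

Definition ricci (R : realType) (q : nat) (D : set 'rV[R]_q)
    (G : 'rV[R]_q -> 'M[R]_q) (x : 'rV[R]_q) : 'M[R]_q :=
  \matrix_(j, k) \sum_(i < q)
    (pder D (christoffel D G i j k) i x - pder D (christoffel D G i j i) k x
     + \sum_(p < q)
         (christoffel D G i i p x * christoffel D G p j k x
          - christoffel D G i k p x * christoffel D G p i j x)).

Definition unit_normal (R : realType) (p q : nat) (G : 'M[R]_q)
    (J : 'M[R]_(p, q)) (nu : 'rV[R]_q) : Prop :=
  inner G nu nu = 1 /\ forall v : 'rV[R]_p, inner G (v *m J) nu = 0.

(* The vector nabla_a (d_b F) along the parametrized submanifold F. *)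
Definition cov_hessian (R : realType) (p q : nat)
    (D : set 'rV[R]_p) (E : set 'rV[R]_q) (G : 'rV[R]_q -> 'M[R]_q)
    (F : 'rV[R]_p -> 'rV[R]_q) (a b : 'I_p) (x : 'rV[R]_p) : 'rV[R]_q :=
  \row_k (pder D (pder D (fun y => F y 0 k) b) a x
          + \sum_(i < q) \sum_(j < q)
              christoffel E G k i j (F x) * jac D F x a i * jac D F x b j).

(* B(X, Z) = g(nabla_X Z, nu), in the basis (d_a F); only the value of nu at
   the point is involved. *)
Definition second_ff (R : realType) (p q : nat)
    (D : set 'rV[R]_p) (E : set 'rV[R]_q) (G : 'rV[R]_q -> 'M[R]_q)
    (F : 'rV[R]_p -> 'rV[R]_q) (x : 'rV[R]_p) (nu : 'rV[R]_q) : 'M[R]_p :=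
  \matrix_(a, b) inner (G (F x)) (cov_hessian D E G F a b x) nu.

Definition mean_curvature (R : realType) (p q : nat)
    (D : set 'rV[R]_p) (E : set 'rV[R]_q) (G : 'rV[R]_q -> 'M[R]_q)
    (F : 'rV[R]_p -> 'rV[R]_q) (x : 'rV[R]_p) (nu : 'rV[R]_q) : R :=
  let J := jac D F x in
  \tr (invmx (J *m G (F x) *m J^T) *m second_ff D E G F x nu).

(* Charts of a (d+1)-dimensional manifold with boundary, with values in the
   half-space; [par i] is the inverse of [coord i]. *)
Record atlas (R : realType) (T : topologicalType) (d : nat) := Atlas {
  chart : Type;
  dom : chart -> set T;
  coord : chart -> T -> 'rV[R]_d.+1;
  par : chart -> 'rV[R]_d.+1 -> T }.

Definition img (R : realType) (T : topologicalType) (d : nat)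
    (A : atlas R T d) (i : chart A) : set 'rV[R]_d.+1 :=
  coord i @` dom i.

Definition bdry (R : realType) (T : topologicalType) (d : nat)
    (A : atlas R T d) : set T :=
  [set p | exists i : chart A, dom i p /\ coord i p 0 ord0 = 0].

Definition inter (R : realType) (T : topologicalType) (d : nat)
    (A : atlas R T d) : set T := ~` bdry A.

Definition coord_map (R : realType) (T1 T2 : topologicalType) (d1 d2 : nat)
    (A1 : atlas R T1 d1) (A2 : atlas R T2 d2) (f : T1 -> T2)
    (i : chart A1) (j : chart A2) : 'rV[R]_d1.+1 -> 'rV[R]_d2.+1 :=
  fun x => coord j (f (par i x)).

Definition map_class (R : realType) (T1 T2 : topologicalType) (d1 d2 : nat)
    (c : regularity R) (A1 : atlas R T1 d1) (A2 : atlas R T2 d2)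
    (f : T1 -> T2) : Prop :=
  continuous f /\
  forall (i : chart A1) (j : chart A2),
    map_of_class c [set x | img i x /\ dom j (f (par i x))] (coord_map f i j).

(* Second countability follows from compactness. *)
Definition compact_manifold (R : realType) (T : topologicalType) (d : nat)
    (c : regularity R) (A : atlas R T d) : Prop :=
  hausdorff_space T /\ compact [set: T] /\
      (forall p : T, exists i : chart A, dom i p) /\
      (forall i : chart A,
        open (dom i) /\
        (exists2 O, open O & img i = O `&` halfspace R d) /\
        (forall p, dom i p -> par i (coord i p) = p) /\
        {within dom i, continuous (coord i)} /\
        {within img i, continuous (par i)}) /\
      map_class c A A id /\
      bdry A !=set0.

Definition bemb (R : realType) (d : nat) (y : 'rV[R]_d) : 'rV[R]_d.+1 :=
  row_mx (0 : 'rV_1) y.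

Definition btail (R : realType) (d : nat) (x : 'rV[R]_d.+1) : 'rV[R]_d :=
  \row_a x 0 (lift ord0 a).

(* Covariant 2-tensors on the manifold, resp. on its boundary, by their
   matrices in each chart; values outside the image of the chart are junk. *)
Definition tensor2 (R : realType) (T : topologicalType) (d : nat)
    (A : atlas R T d) : Type :=
  chart A -> 'rV[R]_d.+1 -> 'M[R]_d.+1.

Definition btensor2 (R : realType) (T : topologicalType) (d : nat)
    (A : atlas R T d) : Type :=
  chart A -> 'rV[R]_d -> 'M[R]_d.

Definition metric_on (R : realType) (T : topologicalType) (d : nat)
    (A : atlas R T d) (c : regularity R) (S : set T) (g : tensor2 A) : Prop :=
  (forall (i : chart A) a b,
      of_class c [set x | img i x /\ S (par i x)] (fun x => g i x a b)) /\
  (forall (i : chart A) p, S p -> dom i p ->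
      (g i (coord i p))^T = g i (coord i p) /\
      forall v, v != 0 -> 0 < inner (g i (coord i p)) v v) /\
  (forall (i j : chart A) p, S p -> dom i p -> dom j p ->
      let J := jac (halfspace R d) (coord_map id i j) (coord i p) in
      g i (coord i p) = J *m g j (coord j p) *m J^T).

Definition brestrict (R : realType) (T : topologicalType) (d : nat)
    (A : atlas R T d) (g : tensor2 A) : btensor2 A :=
  fun i z => \matrix_(a, b) g i (bemb z) (lift ord0 a) (lift ord0 b).

Definition bconformal (R : realType) (T : topologicalType) (d : nat)
    (A : atlas R T d) (w : T -> R) (h h' : btensor2 A) : Prop :=
  forall (i : chart A) z, img i (bemb z) ->
    h' i z = expR (2 * w (par i (bemb z))) *: h i z.

Definition defining_function (R : realType) (T : topologicalType) (d : nat)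
    (A : atlas R T d) (c : regularity R) (r : T -> R) : Prop :=
  (forall i : chart A, of_class c (img i) (r \o par i)) /\
  (forall p, inter A p -> 0 < r p) /\
  (forall p, r p = 0 <-> bdry A p) /\
  (forall (i : chart A) p, dom i p -> bdry A p ->
     exists a, pder (halfspace R d) (r \o par i) a (coord i p) != 0).

(* r is a defining function of class cr, and gbar is an extension of r^2 g_+
   to a metric of class cg up to the boundary. *)
Definition compactification (R : realType) (T : topologicalType) (d : nat)
    (A : atlas R T d) (cr cg : regularity R) (gp : tensor2 A)
    (r : T -> R) (gbar : tensor2 A) : Prop :=
  defining_function A cr r /\ metric_on cg setT gbar /\
  forall (i : chart A) p, inter A p -> dom i p ->
    gbar i (coord i p) = r p ^+ 2 *: gp i (coord i p).

Definition velocity (R : realType) (T : topologicalType) (d : nat)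
    (A : atlas R T d) (i : chart A) (c : R -> T) (t : R) : 'rV[R]_d.+1 :=
  \row_a derive1 (fun u => coord i (c u) 0 a) t.

(* There is a C^1 curve in the interior from p to q, with length < e for g;
   s is its speed. *)
Definition joined_within (R : realType) (T : topologicalType) (d : nat)
    (A : atlas R T d) (g : tensor2 A) (p q : T) (e : R) : Prop :=
  exists (c : R -> T) (s : R -> R),
    c 0 = p /\ c 1 = q /\
    (forall t, 0 <= t <= 1 ->
       inter A (c t) /\ {for t, continuous c} /\
       forall i : chart A, dom i (c t) ->
         (forall a, derivable (fun u => coord i (c u) 0 a) t 1 /\
            {for t, continuous (derive1 (fun u => coord i (c u) 0 a))}) /\
         s t = Num.sqrt (inner (g i (coord i (c t)))
                               (velocity i c t) (velocity i c t))) /\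
    \int[lebesgue_measure]_(t in `[0, 1]) s t < e.

(* Completeness of the Riemannian distance on the interior. *)
Definition complete_metric (R : realType) (T : topologicalType) (d : nat)
    (A : atlas R T d) (g : tensor2 A) : Prop :=
  forall u : nat -> T, (forall k, inter A (u k)) ->
    (forall e : R, 0 < e -> exists N : nat, forall k l : nat,
        (N <= k)%N -> (N <= l)%N -> joined_within g (u k) (u l) e) ->
    exists2 p, inter A p & u @ \oo --> p.

Definition conformally_compact (R : realType) (T : topologicalType) (d : nat)
    (A : atlas R T d) (c : regularity R) (gp : tensor2 A) : Prop :=
  metric_on c (inter A) gp /\ complete_metric gp /\
  exists (r : T -> R) (gbar : tensor2 A), compactification Cinfty c gp r gbar.

(* The dimension is d + 1, so Einstein reads Ric = - d g_+. *)
Definition poincare_einstein (R : realType) (T : topologicalType) (d : nat)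
    (A : atlas R T d) (c : regularity R) (gp : tensor2 A) : Prop :=
  conformally_compact c gp /\
  forall (i : chart A) p, inter A p -> dom i p ->
    ricci (halfspace R d) (gp i) (coord i p) = - d%:R *: gp i (coord i p).

Definition in_conformal_infinity (R : realType) (T : topologicalType)
    (d : nat) (A : atlas R T d) (c : regularity R) (gp : tensor2 A)
    (h : btensor2 A) : Prop :=
  exists (r : T -> R) (gbar : tensor2 A) (psi : T -> R),
    compactification Cinfty c gp r gbar /\ bconformal psi (brestrict gbar) h.

(* The solution r of |dr|^2 = 1 is in general less regular than r^2 g_+ is for a
   smooth r (one derivative is lost), so only C^1 is required here. *)
Definition special_defining_function (R : realType) (T : topologicalType)
    (d : nat) (A : atlas R T d) (gp : tensor2 A) (h : btensor2 A)
    (r : T -> R) (gbar : tensor2 A) : Prop :=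
  compactification (Cfin 1) (Cfin 1) gp r gbar /\
  (exists V : set T, open V /\ bdry A `<=` V /\
     forall (i : chart A) p, V p -> dom i p ->
       let dr := gradient (halfspace R d) (gbar i) (r \o par i) (coord i p) in
       inner (gbar i (coord i p)) dr dr = 1) /\
  (forall (i : chart A) z, img i (bemb z) -> brestrict gbar i z = h i z).

Definition cc_hypersurface (R : realType) (M Y : topologicalType) (d : nat)
    (AM : atlas R M d.+1) (AY : atlas R Y d) (c : regularity R)
    (f : Y -> M) : Prop :=
  compact_manifold c AY /\ map_class c AY AM f /\
      (forall (i : chart AY) (j : chart AM) y, dom i y -> dom j (f y) ->
         row_free (jac (halfspace R d) (coord_map f i j) (coord i y))) /\
      (forall y, bdry AM (f y) <-> bdry AY y) /\
      (* transversality at the boundary: df(T Y) + T Sigma = T M *)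
      (forall (i : chart AY) (j : chart AM) y, bdry AY y -> dom i y ->
         dom j (f y) ->
         forall u : 'rV[R]_d.+2, exists (v : 'rV[R]_d.+1) (z : 'rV[R]_d.+1),
           u = v *m jac (halfspace R d) (coord_map f i j) (coord i y)
               + bemb z).

Definition hyp_unit_normal (R : realType) (M Y : topologicalType) (d : nat)
    (AM : atlas R M d.+1) (AY : atlas R Y d) (f : Y -> M) (g : tensor2 AM)
    (i : chart AY) (j : chart AM) (y : Y) (nu : 'rV[R]_d.+2) : Prop :=
  unit_normal (g j (coord j (f y)))
    (jac (halfspace R d) (coord_map f i j) (coord i y)) nu.

Definition hyp_mean_curvature (R : realType) (M Y : topologicalType) (d : nat)
    (AM : atlas R M d.+1) (AY : atlas R Y d) (f : Y -> M) (g : tensor2 AM)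
    (i : chart AY) (j : chart AM) (y : Y) (nu : 'rV[R]_d.+2) : R :=
  mean_curvature (halfspace R d) (halfspace R d.+1) (g j) (coord_map f i j)
    (coord i y) nu.

(* H^Y = O(r^k) as r -> 0. H^Y is defined up to the choice of the unit normal,
   which only affects its sign; hence the quantification over all unit normals,
   which also covers one-sided hypersurfaces. *)
Definition mean_curvature_bigO (R : realType) (M Y : topologicalType)
    (d : nat) (AM : atlas R M d.+1) (AY : atlas R Y d) (f : Y -> M)
    (gp : tensor2 AM) (r : M -> R) (k : nat) : Prop :=
  exists (C e : R), 0 < e /\
    forall y, inter AY y -> r (f y) < e ->
    forall (i : chart AY) (j : chart AM) N, dom i y -> dom j (f y) ->
      hyp_unit_normal f gp i j y N ->
      `|hyp_mean_curvature f gp i j y N| <= C * r (f y) ^+ k.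

Definition asymptotically_minimal (R : realType) (M Y : topologicalType)
    (d : nat) (AM : atlas R M d.+1) (AY : atlas R Y d) (c : regularity R)
    (f : Y -> M) (gp : tensor2 AM) (r : M -> R) : Prop :=
  cc_hypersurface AM AY c f /\ mean_curvature_bigO AY f gp r 1.

(* The coordinates at y of the vector d_r, which is tangent to the hypersurface
   there: the solution v of v *m J = d_r, J being row-free; the tangency is a
   consequence of asymptotic minimality. *)
Definition dr_tangent (R : realType) (M Y : topologicalType) (d : nat)
    (AM : atlas R M d.+1) (AY : atlas R Y d) (f : Y -> M) (r : M -> R)
    (gbar : tensor2 AM) (i : chart AY) (j : chart AM) (y : Y) : 'rV[R]_d.+1 :=
  gradient (halfspace R d.+1) (gbar j) (r \o par j) (coord j (f y))
    *m pinvmx (jac (halfspace R d) (coord_map f i j) (coord i y)).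

Definition B00 (R : realType) (M Y : topologicalType) (d : nat)
    (AM : atlas R M d.+1) (AY : atlas R Y d) (f : Y -> M) (r : M -> R)
    (gbar : tensor2 AM) (i : chart AY) (j : chart AM) (y : Y)
    (nu : 'rV[R]_d.+2) : R :=
  let v := dr_tangent f r gbar i j y in
  inner (second_ff (halfspace R d) (halfspace R d.+1) (gbar j)
           (coord_map f i j) (coord i y) nu) v v.

(* Mean curvature in (Sigma, h) of the restriction of f to the boundaries; at
   y, nu is tangent to Sigma and [btail nu] is its coordinates there. *)
Definition eta (R : realType) (M Y : topologicalType) (d : nat)
    (AM : atlas R M d.+1) (AY : atlas R Y d) (f : Y -> M) (h : btensor2 AM)
    (i : chart AY) (j : chart AM) (y : Y) (nu : 'rV[R]_d.+2) : R :=
  mean_curvature setT setT (h j) (fun z => btail (coord_map f i j (bemb z)))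
    (btail (coord i y)) (btail nu).

Definition eta_nB00 (R : realType) (M Y : topologicalType) (d : nat)
    (AM : atlas R M d.+1) (AY : atlas R Y d) (f : Y -> M) (h : btensor2 AM)
    (r : M -> R) (gbar : tensor2 AM) (i : chart AY) (j : chart AM) (y : Y)
    (nu : 'rV[R]_d.+2) : R :=
  eta f h i j y nu - d%:R * B00 f r gbar i j y nu.

(* Main.v *)
Require Import Defs.
From mathcomp Require Import all_boot all_order all_algebra.
From mathcomp Require Import all_classical all_reals all_analysis.
From mathcomp Require Import ring lra.
Import Defs.
Set Implicit Arguments.
Unset Strict Implicit.
Unset Printing Implicit Defensive.
Import Order.TTheory GRing.Theory Num.Theory.
Import numFieldNormedType.Exports.
Local Open Scope classical_set_scope.
Local Open Scope ring_scope.

(** The mean curvature of Y for g_+ is studied along a field W of normals which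
    is continuous up to the boundary, instead of the unit normal, which
    degenerates there. The trace K(W) of the second fundamental form for g_+ with
    respect to W is linear in W, and for each compactification gbar = r^2 g_+ the
    conformal change of the mean curvature reads, in the interior,
    K(W) = Hbar(W) + (n + 1) dr(W) / r ([mean_curvature_conformal]).

    Multiplying by r shows that H^Y = O(r) forces dr(W) = 0 on the boundary:
    Y meets it at right angles ([tangency_of_bounded_mean_curvature]). The
    quotient dr(W) / r then has a limit at the boundary points. Since W stays
    orthogonal to Y while the gradient of r is tangent to Y and has norm 1 along
    the boundary, this limit is - B00 when W = nu at the point ([ell_normal]);
    hence K(W) tends to Hbar(nu) - (n + 1) B00 ([mean_curvature_limit]).
    Splitting the trace Hbar along d_r and the tangent space of the boundary of Y
    gives Hbar = eta + B00 ([mean_curvature_split]), so the limit is eta - n B00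
    ([boundary_limit_eta]). The quantity K(W) only depends on g_+ and W: the limit
    is thus the same for all special compactifications, and the weight comes from
    the factor e^{-w} between the two unit normals.

    A special defining function r is only of class C^1 here, as is its metric.
    Two devices replace the missing derivatives. First, r = u r0 with r0 smooth
    and u of class C^1 ([conformal_factor]); as r0 vanishes on the boundary, dr
    is differentiable at the boundary points ([weak_hessian]). Secondly, W is
    never differentiated: dr(W) = (dr - <v J, _>)(W) for any tangent vector v J,
    and for v J = grad r the covector in brackets vanishes at the point
    ([diff_normal_quotient]).

    For the vanishing order, the unit normal of g_+ is (r / |W|) W, whence
    |H^Y| = r |K(W)| / |W|. If H^Y = O(r^2), then K(W) tends to zero, and so the
    invariant vanishes ([boundary_limit_eq0]). Conversely, the compactification
    by a smooth r0 presents K(W) as A + (n + 1) B / r0 with A of class C^1, and B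
    and r0 of class C^2 and zero on the boundary; for such a quotient, tending to
    zero on transverse lines implies being O(r0) ([quotient_bound]). The bound
    is local; it becomes uniform by the invariance of the mean curvature under
    changes of charts and by the compactness of Y ([mean_curvature_bigO2]). *)

(** * Partial derivatives along admissible increments *)

(** A relation rather than the total operator [pder], so that existence and value
    of a derivative are established together. *)
Definition is_pder (R : realType) (d : nat) (D : set 'rV[R]_d)
    (f : 'rV[R]_d -> R) (a : 'I_d) (x : 'rV[R]_d) (l : R) : Prop :=
  diffquot f a x @ increments D a x --> l.

Lemma near_cvg (T : Type) (V : topologicalType) (F : set_system T)
    (FF : Filter F) (f g : T -> V) (l m : V) :
  f @ F --> l -> (\forall h \near F, f h = g h) -> l = m -> g @ F --> m.
Proof.
move=> fl fg <-; apply: cvg_trans fl; apply: near_eq_cvg.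
by apply: filterS fg => h ->.
Qed.

Section PartialDerivatives.
Variables (R : realType) (d : nat).
Implicit Types (D : set 'rV[R]_d) (f g : 'rV[R]_d -> R) (a : 'I_d)
  (x : 'rV[R]_d).

#[global] Instance increments_filter D a x : Filter (increments D a x).
Proof. by rewrite /increments; apply: within_filter. Qed.

Lemma increments_dnbhs D a x : increments D a x --> (0 : R)^'.
Proof. exact: cvg_within. Qed.

Lemma increments_nbhs0 D a x : (fun h => h) @ increments D a x --> (0 : R).
Proof.
by move=> A A0; apply: increments_dnbhs; exact: nbhs_dnbhs A0.
Qed.

Lemma increments_neq0 D a x : \forall h \near increments D a x, h != 0.
Proof. by have := @increments_dnbhs D a x [set h | h != 0]; apply; exact: withinT. Qed.

Lemma increments_in D a x :
  \forall h \near increments D a x, D (x + h *: delta_mx 0 a).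
Proof. exact: withinT. Qed.

Lemma increments_pt D a x :
  (fun h => x + h *: delta_mx 0 a) @ increments D a x --> within D (nbhs x).
Proof.
have c : (fun h : R => x + h *: delta_mx 0 a) @ increments D a x --> x.
  rewrite -[X in _ --> X]addr0 -[X in x + X](scale0r (delta_mx 0 a)).
  by apply: cvgD; [exact: cvg_cst|apply: cvgZr_tmp; exact: increments_nbhs0].
move=> A Aw; have A0 := c [set y | D y -> A y] Aw.
by apply: filterS2 A0 (increments_in D a x) => h; exact.
Qed.

Lemma is_pder_cvg D f a x l : is_pder D f a x l ->
  (fun h => f (x + h *: delta_mx 0 a)) @ increments D a x --> f x.
Proof.
move=> fl.
have c : (fun h => f x + h * diffquot f a x h) @ increments D a x --> f x.
  rewrite -[X in _ --> X]addr0 -[X in f x + X](mul0r l).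
  apply: cvgD; first exact: cvg_cst.
  exact: cvgM (increments_nbhs0 _ _ _) fl.
apply: cvg_trans c; apply: near_eq_cvg.
apply: filterS (increments_neq0 D a x) => h h0.
by rewrite /diffquot mulVKf// addrC subrK.
Qed.

Lemma is_pder_cst D (c : R) a x : is_pder D (fun=> c) a x 0.
Proof.
rewrite /is_pder (_ : diffquot _ a x = fun=> 0); first exact: cvg_cst.
by apply/funext => h; rewrite /diffquot subrr mulr0.
Qed.

Lemma is_pderD D f g a x l m : is_pder D f a x l -> is_pder D g a x m ->
  is_pder D (fun y => f y + g y) a x (l + m).
Proof.
move=> fl gm; apply: (near_cvg _ (cvgD fl gm)) => //.
by apply: nearW => h; rewrite !fctE /diffquot /=; ring.
Qed.

Lemma is_pderM D f g a x l m : is_pder D f a x l -> is_pder D g a x m ->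
  is_pder D (fun y => f y * g y) a x (l * g x + f x * m).
Proof.
move=> fl gm.
apply: (near_cvg _ (cvgD (cvgM fl (is_pder_cvg gm)) (cvgM (cvg_cst (f x)) gm))) => //.
by apply: nearW => h; rewrite !fctE /diffquot /=; ring.
Qed.

Lemma is_pderZ D f a x c l : is_pder D f a x l ->
  is_pder D (fun y => c * f y) a x (c * l).
Proof.
by move=> fl; have := is_pderM (is_pder_cst D c a x) fl; rewrite mul0r add0r.
Qed.

Lemma is_pderN D f a x l : is_pder D f a x l ->
  is_pder D (fun y => - f y) a x (- l).
Proof.
move=> /(is_pderZ (c := -1)); rewrite mulN1r.
by rewrite (_ : (fun y => -1 * f y) = (fun y => - f y))//; apply/funext => y; rewrite mulN1r.
Qed.

Lemma is_pderB D f g a x l m : is_pder D f a x l -> is_pder D g a x m ->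
  is_pder D (fun y => f y - g y) a x (l - m).
Proof. by move=> fl gm; apply: is_pderD => //; exact: is_pderN. Qed.

Lemma is_pder_sum D (I : Type) (s : seq I) (P : pred I)
    (f : I -> 'rV[R]_d -> R) a x (l : I -> R) :
  (forall i, P i -> is_pder D (f i) a x (l i)) ->
  is_pder D (fun y => \sum_(i <- s | P i) f i y) a x (\sum_(i <- s | P i) l i).
Proof.
move=> fl; elim: s => [|i s IH].
  rewrite big_nil (_ : (fun y => _) = fun=> 0); first exact: is_pder_cst.
  by apply/funext => y; rewrite big_nil.
rewrite big_cons (_ : (fun y => _) = fun y =>
  if P i then f i y + \sum_(j <- s | P j) f j y else \sum_(j <- s | P j) f j y).
  2: by apply/funext => y; rewrite big_cons.
by case: ifP => // Pi; apply: is_pderD => //; exact: fl.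
Qed.

Lemma is_pderV D f a x l : f x != 0 -> is_pder D f a x l ->
  is_pder D (fun y => (f y)^-1) a x (- l / f x ^+ 2).
Proof.
move=> fx0 fl; have fc := is_pder_cvg fl.
have fh0 : \forall h \near increments D a x, f (x + h *: delta_mx 0 a) != 0.
  exact: (cvgr_neq0 _ fc).
apply: (near_cvg _ (cvgM (cvgN fl)
  (cvgV (mulf_neq0 fx0 fx0) (cvgM fc (cvg_cst (f x)))))) => //.
apply: filterS fh0 => h fxh.
by rewrite !fctE /diffquot /=; set k := h^-1; field; rewrite fx0 fxh.
Qed.

Lemma is_pder_sqrt D f a x l : 0 < f x -> is_pder D f a x l ->
  (\forall y \near within D (nbhs x), 0 <= f y) ->
  is_pder D (fun y => Num.sqrt (f y)) a x (l / (2 * Num.sqrt (f x))).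
Proof.
move=> fx0 fl f0; have fc := is_pder_cvg fl.
have fh0 : \forall h \near increments D a x, 0 <= f (x + h *: delta_mx 0 a).
  exact: (increments_pt a f0).
have sx : Num.sqrt (f x) != 0 by rewrite gt_eqF// sqrtr_gt0.
have sc : (fun h => Num.sqrt (f (x + h *: delta_mx 0 a)))
    @ increments D a x --> Num.sqrt (f x).
  exact: (cvg_comp _ _ fc (@sqrt_continuous _ (f x))).
have s2 : Num.sqrt (f x) + Num.sqrt (f x) != 0.
  by rewrite -mulr2n mulrn_eq0.
apply: (near_cvg _ (cvgM fl (cvgV s2 (cvgD sc (cvg_cst (Num.sqrt (f x))))))).
  apply: filterS fh0 => h fh; rewrite !fctE /diffquot /=.
  rewrite -{1}(sqr_sqrtr fh) -{1}(sqr_sqrtr (ltW fx0)).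
  have : Num.sqrt (f (x + h *: delta_mx 0 a)) + Num.sqrt (f x) != 0.
    by rewrite gt_eqF// ltr_wpDl ?sqrtr_ge0 ?sqrtr_gt0.
  by move=> s0; set k := h^-1; field.
by rewrite [in RHS]mulrDl mul1r.
Qed.

Lemma diffquot_eq_near D f g a x : f x = g x ->
  (\forall y \near within D (nbhs x), f y = g y) ->
  \forall h \near increments D a x, diffquot f a x h = diffquot g a x h.
Proof.
move=> fgx fg.
have : \forall h \near increments D a x,
  f (x + h *: delta_mx 0 a) = g (x + h *: delta_mx 0 a) by exact: (increments_pt a fg).
by apply: filterS => h e; rewrite /diffquot e fgx.
Qed.

Lemma is_pder_eq_near D f g a x l : f x = g x ->
  (\forall y \near within D (nbhs x), f y = g y) ->
  is_pder D f a x l -> is_pder D g a x l.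
Proof.
move=> fgx fg fl; apply: (near_cvg _ fl) => //.
exact: diffquot_eq_near.
Qed.

Lemma pder_eq_near D f g a x : f x = g x ->
  (\forall y \near within D (nbhs x), f y = g y) ->
  pder D f a x = pder D g a x.
Proof.
move=> fgx /(diffquot_eq_near a fgx) e; rewrite /pder; congr lim.
rewrite eqEsubset; split; apply: near_eq_cvg => //.
by apply: filterS e => h ->.
Qed.

End PartialDerivatives.

Section HalfspacePartials.
Variables (R : realType) (d : nat).
Local Notation H := (halfspace R d).
Implicit Types (f g : 'rV[R]_d.+1 -> R) (a : 'I_d.+1) (x : 'rV[R]_d.+1).

Lemma deltaE a (k : 'I_d.+1) (h : R) x :
  (x + h *: delta_mx 0 a) 0 k = x 0 k + h * (k == a)%:R.
Proof. by rewrite !mxE eqxx. Qed.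

Lemma increments_proper a x : H x -> ProperFilter (increments H a x).
Proof.
move=> Hx; apply: Build_ProperFilter_ex => A; rewrite /increments /within /= => -[e /= e0 eA].
exists (e / 2); apply: eA => /=.
- by rewrite sub0r normrN gtr0_norm ?divr_gt0// ltr_pdivrMr// ltr_pMr// ltr1n.
- by rewrite gt_eqF// divr_gt0.
- rewrite /halfspace /= deltaE; apply: addr_ge0 => //.
  by rewrite mulr_ge0// divr_ge0// ltW.
Qed.

Lemma is_pderP f a x l : H x -> is_pder H f a x l ->
  pderivable H f a x /\ pder H f a x = l.
Proof.
move=> /(increments_proper a) PF fl; split; first by apply/cvg_ex; exists l.
exact: (cvg_lim _ fl).
Qed.

Lemma is_pder_pder f a x l : H x -> is_pder H f a x l -> pder H f a x = l.
Proof. by move=> Hx /is_pderP []. Qed.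

Lemma pderivableP f a x : pderivable H f a x -> is_pder H f a x (pder H f a x).
Proof. by []. Qed.

End HalfspacePartials.

(** * Differential calculus on relatively open subsets of a half-space *)

Section MeanValue.
Variables (R : realType) (d : nat).
Local Notation H := (halfspace R d).
Implicit Types (f g : 'rV[R]_d.+1 -> R) (a b : 'I_d.+1) (x : 'rV[R]_d.+1).

Lemma dnbhs_increments (D : set 'rV[R]_d.+1) a x :
  (\forall h \near 0^', D (x + h *: delta_mx 0 a)) ->
  (0 : R)^' --> increments D a x.
Proof.
move=> D0 A Ai.
have A0 : (0 : R)^' [set h | D (x + h *: delta_mx 0 a) -> A h] by exact: Ai.
by apply: filterS2 D0 A0 => h Dh; exact.
Qed.

Lemma mean_value_line f a x (delta : R) (l : R -> R) : 0 < delta ->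
  (forall s, 0 <= s <= delta -> H (x + s *: delta_mx 0 a)) ->
  (forall s, 0 <= s <= delta -> is_pder H f a (x + s *: delta_mx 0 a) (l s)) ->
  exists2 s, 0 < s < delta & f (x + delta *: delta_mx 0 a) - f x = l s * delta.
Proof.
move=> d0 Hs fs.
pose phi s := f (x + s *: delta_mx 0 a).
have addA s h : x + s *: delta_mx 0 a + h *: delta_mx 0 a
    = x + (s + h) *: delta_mx 0 a :> 'rV[R]_d.+1 by rewrite -addrA -scalerDl.
have der s : s \in `]0, delta[ -> is_derive s (1 : R) phi (l s).
  rewrite in_itv /= => /andP[s0 sd].
  have s01 : 0 <= s <= delta by rewrite !ltW.
  have inc : (0 : R)^' --> increments H a (x + s *: delta_mx 0 a).
    apply: dnbhs_increments; apply: nbhs_dnbhs.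
    have m0 : 0 < Num.min s (delta - s) by rewrite lt_min s0 subr_gt0.
    apply: filterS (nbhs0_lt m0) => h; rewrite lt_min => /andP[h1 h2].
    rewrite addA; apply: Hs; move: h1 h2; rewrite !ltr_norml => /andP[h1 _] /andP[_ h2].
    by apply/andP; split; lra.
  have c : (fun h : R => h^-1 *: (phi (h *: 1 + s) - phi s)) @ 0^' --> l s.
    have L := cvg_trans (cvg_app (diffquot f a (x + s *: delta_mx 0 a)) inc) (fs s s01).
    apply: (near_cvg _ L) => //; apply: nearW => h.
    by rewrite /diffquot addA /phi [h *: 1]mulr1 (addrC h).
  apply: DeriveDef; first by apply/cvg_ex; exists (l s).
  exact: (cvg_lim _ c).
have cont : {within `[0, delta], continuous phi}.
  apply/subspace_continuousP => s; rewrite /= in_itv /= => s01 A As.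
  have := is_pder_cvg (fs s s01) As.
  rewrite /increments /within /= => -[e /= e0 eA].
  exists e => // t /= te; rewrite in_itv /= => t01.
  have [->|ts] := eqVneq t s; first exact: nbhs_singleton.
  have := eA (t - s); rewrite /= addA (addrC s) subrK; apply.
  - by rewrite sub0r normrN distrC.
  - by rewrite subr_eq0.
  - exact: Hs.
have [s sd E] := MVT d0 der cont; exists s; first by move: sd; rewrite in_itv.
by move: E; rewrite /phi scale0r addr0 subr0.
Qed.

(** The increment may have either sign: this serves to join any two points of
    the half-space by segments parallel to the axes. *)
Lemma mean_value f (F : 'rV[R]_d.+1 -> R) a x (delta : R) :
  (forall s, `|s| <= `|delta| -> 0 <= s * delta -> H (x + s *: delta_mx 0 a)) ->
  (forall s, `|s| <= `|delta| -> 0 <= s * delta ->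
    is_pder H f a (x + s *: delta_mx 0 a) (F (x + s *: delta_mx 0 a))) ->
  exists2 s, `|s| <= `|delta| /\ 0 <= s * delta &
    f (x + delta *: delta_mx 0 a) - f x = F (x + s *: delta_mx 0 a) * delta.
Proof.
case: (ltrgtP delta 0) => d0 Hs fs.
- pose y := x + delta *: delta_mx 0 a.
  have yE s : y + s *: delta_mx 0 a = x + (delta + s) *: delta_mx 0 a.
    by rewrite /y -addrA -scalerDl.
  have adm s : 0 <= s <= - delta ->
      `|delta + s| <= `|delta| /\ 0 <= (delta + s) * delta.
    move=> /andP[s0 sd]; rewrite !ler0_norm; [|lra|lra]; split; first lra.
    by rewrite mulr_le0//; lra.
  have nd : 0 < - delta by lra.
  have [s| s|s sd E] := @mean_value_line f a y (- delta) (fun s => F (y + s *: delta_mx 0 a)) nd.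
  - by move=> /adm[? ?]; rewrite yE; exact: Hs.
  - by move=> /adm[? ?]; rewrite yE; exact: fs.
  exists (delta + s); first by apply: adm; case/andP: sd => ? ?; rewrite !ltW.
  move: E; rewrite !yE subrr scale0r addr0 -/y => E.
  by rewrite /y in E; lra.
- have adm s : 0 <= s <= delta -> `|s| <= `|delta| /\ 0 <= s * delta.
    by move=> /andP[s0 sd]; rewrite !ger0_norm ?mulr_ge0//; lra.
  have [s| s|s sd E] := @mean_value_line f a x delta (fun s => F (x + s *: delta_mx 0 a)) d0.
  - by move=> /adm[? ?]; exact: Hs.
  - by move=> /adm[? ?]; exact: fs.
  by exists s => //; apply: adm; case/andP: sd => ? ?; rewrite !ltW.
- exists 0; first by rewrite normr0 mul0r.
  by rewrite d0 mulr0 scale0r addr0 subrr.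
Qed.

End MeanValue.

Section RowNorm.
Variables (R : realType) (m : nat).

Lemma ler_norm_row (x : 'rV[R]_m) c : 0 <= c ->
  (forall k, `|x 0 k| <= c) -> `|x| <= c.
Proof.
move=> c0 xc; rewrite [leLHS]mx_normrE; apply/bigmax_leP; split=> //= -[i k] _.
by rewrite (ord1 i).
Qed.

Lemma ler_coord_norm (x : 'rV[R]_m) k : `|x 0 k| <= `|x|.
Proof.
rewrite [leRHS]mx_normrE; apply/bigmax_geP; right; exists (0, k) => //.
Qed.

Lemma cvg_row (T : Type) (F : set_system T) (FF : Filter F)
    (f : T -> 'rV[R]_m) (l : 'rV[R]_m) :
  (forall k, (fun t => f t 0 k) @ F --> l 0 k) -> f @ F --> l.
Proof.
move=> fl; apply/cvgrPdist_le => e e0.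
have : \forall t \near F, forall k, `|l 0 k - f t 0 k| <= e.
  by apply: filter_forall => k; exact: (cvgr_dist_le _ _ (fl k) _ e0).
apply: filterS => t ft; apply: ler_norm_row => [|k]; first exact: ltW.
by rewrite !mxE.
Qed.

End RowNorm.

Definition relopen (R : realType) (d : nat) (U : set 'rV[R]_d.+1) : Prop :=
  forall x, U x -> halfspace R d x /\
    \forall y \near within (halfspace R d) (nbhs x), U y.

Notation Ck := (Ck_with (fun _ _ => True)).

Section Regularity.
Variables (R : realType) (d : nat).
Local Notation H := (halfspace R d).
Implicit Types (U : set 'rV[R]_d.+1) (f g : 'rV[R]_d.+1 -> R) (a b : 'I_d.+1)
  (x : 'rV[R]_d.+1).

Lemma Ck_with_Ck P k U f : Ck_with P k U f -> Ck k U f.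
Proof.
elim: k f => [|k IH] f [cf fP]; split=> // a.
by have [pf cpf] := fP a; split=> //; exact: IH.
Qed.

Lemma CkS k U f : Ck k.+1 U f -> Ck k U f.
Proof.
elim: k f => [|k IH] f [cf fP]; split=> // a.
by have [pf cpf] := fP a; split=> //; exact: IH.
Qed.

Lemma Ck_le k l U f : (k <= l)%N -> Ck l U f -> Ck k U f.
Proof.
elim: l => [|l IH]; first by rewrite leqn0 => /eqP ->.
by rewrite leq_eqVlt => /predU1P[->//|/IH h /CkS]; exact: h.
Qed.

Lemma of_class_Ck c k U f : of_class c U f ->
  match c with Cfin m | CHolder m _ => (k <= m)%N | Cinfty => true end ->
  Ck k U f.
Proof.
case: c => [m|m alpha|] /=; last by move=> /(_ k).
- by move=> Cf km; exact: Ck_le km _.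
- by move=> /Ck_with_Ck Cf km; exact: Ck_le km _.
Qed.

Lemma Ck_pderivable k U f a x : Ck k.+1 U f -> U x -> pderivable H f a x.
Proof. by move=> [_ /(_ a)[pf _]]; exact: pf. Qed.

Lemma Ck_is_pder k U f a x : Ck k.+1 U f -> U x ->
  is_pder H f a x (pder H f a x).
Proof. by move=> Cf Ux; apply: pderivableP; exact: Ck_pderivable Cf Ux. Qed.

Lemma Ck_pder k U f a : Ck k.+1 U f -> Ck k U (pder H f a).
Proof. by move=> [_ /(_ a)[]]. Qed.

Lemma Ck_sub k U V f : V `<=` U -> Ck k U f -> Ck k V f.
Proof.
move=> VU; elim: k f => [|k IH] f [cf fP]; split=> //; try exact: continuous_subspaceW cf.
move=> a; have [pf cpf] := fP a; split; last exact: IH.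
by move=> x /VU; exact: pf.
Qed.

Lemma Ck_continuous k U f x : relopen U -> Ck k U f -> U x ->
  f @ within H (nbhs x) --> f x.
Proof.
move=> oU Cf Ux; have cf : {within U, continuous f} by case: k Cf => [|k] [].
move/subspace_continuousP : cf => /(_ x Ux) cf A /cf.
have [_ UU] := oU x Ux.
move=> fA; have UA : nbhs x [set y | U y -> A (f y)] by exact: fA.
have HU : nbhs x [set y | H y -> U y] by exact: UU.
suff : nbhs x [set y | H y -> A (f y)] by [].
by apply: filterS2 HU UA => y HUy UAy /HUy.
Qed.

Lemma continuous_Ck0 U f : relopen U ->
  (forall x, U x -> f @ within H (nbhs x) --> f x) -> Ck 0 U f.
Proof.
move=> oU cf; split=> //; apply/subspace_continuousP => x Ux A fA.
have HA : nbhs x [set y | H y -> A (f y)] by exact: (cf x Ux A fA).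
suff : nbhs x [set y | U y -> A (f y)] by [].
by apply: filterS HA => y yA /oU[Hy _]; exact: yA.
Qed.

(** The increment is split along the coordinate axes, which keeps the
    intermediate points in the half-space, and the mean value theorem applies to
    each of the pieces. *)
Lemma Ck_differentiable U f p : relopen U -> Ck 1 U f -> U p ->
  forall e, 0 < e -> \forall y \near within H (nbhs p),
  `|f y - f p - \sum_k (y 0 k - p 0 k) * pder H f k p| <= e * `|y - p|.
Proof.
move=> oU Cf Up e e0; have [Hp pU] := oU p Up.
pose e' := e / d.+1%:R; have e'0 : 0 < e' by rewrite divr_gt0.
have good : \forall y \near within H (nbhs p),
    U y /\ forall k, `|pder H f k p - pder H f k y| <= e'.
  have good2 : \forall y \near within H (nbhs p),
      forall k, `|pder H f k p - pder H f k y| <= e'.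
    apply: filter_forall => k.
    exact: (cvgr_dist_le _ _ (Ck_continuous oU (Ck_pder k Cf) Up) _ e'0).
  exact: (filterI pU good2).
move: good => /= /nbhs_ballP[delta /= delta0 good].
apply/nbhs_ballP; exists delta => // y; rewrite -ball_normE /= distrC => yp Hy.
have {}good (z : 'rV[R]_d.+1) : (forall k, `|z 0 k - p 0 k| <= `|y - p|) -> H z ->
    U z /\ forall k, `|pder H f k p - pder H f k z| <= e'.
  move=> zy Hz; apply: good => //; rewrite -ball_normE /= distrC.
  apply: le_lt_trans yp; apply: ler_norm_row => // k; rewrite !mxE; exact: zy.
pose z m : 'rV[R]_d.+1 := \row_k (if (k < m)%N then y 0 k else p 0 k).
have z0 : z 0 = p by apply/rowP => k; rewrite mxE.
have zd : z d.+1 = y by apply/rowP => k; rewrite mxE ltn_ord.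
have zS (m : 'I_d.+1) : z m.+1 = z m + (y 0 m - p 0 m) *: delta_mx 0 m.
  apply/rowP => k; rewrite deltaE !mxE ltnS.
  have [->|km] := eqVneq k m; first by rewrite leqnn ltnn mulr1 addrC subrK.
  by rewrite mulr0 addr0 leq_eqVlt (negbTE km : (k == m :> nat) = false).
have near_z (m : 'I_d.+1) s : `|s| <= `|y 0 m - p 0 m| ->
    0 <= s * (y 0 m - p 0 m) ->
    let w := z m + s *: delta_mx 0 m in
    (forall k, `|w 0 k - p 0 k| <= `|y - p|) /\ H w.
  move=> s1 s2 w; split=> [k|].
    rewrite /w deltaE mxE; have [->|km] := eqVneq k m.
      rewrite ltnn mulr1 addrAC subrr add0r (le_trans s1)//.
      by have := ler_coord_norm (y - p) m; rewrite !mxE.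
    rewrite mulr0 addr0; case: ifP => _; last by rewrite subrr normr0.
    by have := ler_coord_norm (y - p) k; rewrite !mxE.
  rewrite /H /w /halfspace /= deltaE mxE; have [e0m|km] := eqVneq ord0 m.
    rewrite -e0m ltn0 mulr1; rewrite -e0m in s1 s2.
    have Hy0 : 0 <= y 0 ord0 by exact: Hy.
    have [yp0|yp0] := lerP 0 (y 0 ord0 - p 0 ord0).
      have [s0|s0] := lerP 0 s; first by rewrite addr_ge0.
      have [E|E] := eqVneq (y 0 ord0 - p 0 ord0) 0.
        by move: s1; rewrite E normr0 normr_le0 => /eqP ->; rewrite addr0.
      have : s * (y 0 ord0 - p 0 ord0) < 0 by rewrite nmulr_rlt0// lt_neqAle eq_sym E.
      by rewrite ltNge s2.
    by move: s1; rewrite (ltr0_norm yp0) ler_norml => /andP[? _]; lra.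
  rewrite mulr0 addr0; case: ifP => _; [exact: Hy|exact: Hp].
have step (m : 'I_d.+1) :
    `|f (z m.+1) - f (z m) - (y 0 m - p 0 m) * pder H f m p| <= e' * `|y - p|.
  have [s s1 s2|s s1 s2|s [s1 s2] E] := @mean_value R d f (pder H f m) m (z m) (y 0 m - p 0 m).
  - by have [] := near_z m s s1 s2.
  - have [w1 w2] := near_z m s s1 s2.
    by apply: Ck_is_pder Cf _; have [] := good _ w1 w2.
  have [w1 w2] := near_z m s s1 s2.
  rewrite zS E mulrC -mulrBr normrM mulrC; apply: ler_pM => //.
    by rewrite distrC; have [_] := good _ w1 w2; exact.
  by have := ler_coord_norm (y - p) m; rewrite !mxE.
have -> : f y - f p = \sum_(m < d.+1) (f (z m.+1) - f (z m)).
  by rewrite -(big_mkord xpredT (fun m => f (z m.+1) - f (z m))) telescope_sumr// zd z0.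
rewrite -sumrB (le_trans (ler_norm_sum _ _ _))//.
rewrite (le_trans (ler_sum _ (fun m _ => step m)))//.
rewrite sumr_const card_ord -mulr_natr mulrAC /e' divfK//.
Qed.

End Regularity.

Section ChainRule.
Variables (R : realType) (q : nat).
Local Notation H := (halfspace R q).

Lemma cvg_fsum (T : Type) (F : set_system T) (FF : Filter F) (I : Type)
    (s : seq I) (f : I -> T -> R) (l : I -> R) :
  (forall i, f i @ F --> l i) ->
  (fun t => \sum_(i <- s) f i t) @ F --> \sum_(i <- s) l i.
Proof.
move=> fl; elim: s => [|i s IH].
  by rewrite big_nil (_ : (fun t => _) = fun=> 0);
    [exact: cvg_cst|apply/funext => t; rewrite big_nil].
rewrite big_cons; apply: (near_cvg _ (cvgD (fl i) IH)) => //.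
by apply: nearW => t; rewrite big_cons.
Qed.

Section Path.
Variables (p : 'rV[R]_q.+1) (F : set_system R) (FF : Filter F).
Variables (gam : R -> 'rV[R]_q.+1) (v : 'rV[R]_q.+1).
Hypothesis h0 : (fun h => h) @ F --> (0 : R).
Hypothesis hn : \forall h \near F, h != 0.
Hypothesis Hg : \forall h \near F, H (gam h).
Hypothesis gv : forall k, (fun h => h^-1 * (gam h 0 k - p 0 k)) @ F --> v 0 k.

Let quo h : 'rV[R]_q.+1 := h^-1 *: (gam h - p).

Let quo_v : quo @ F --> v.
Proof.
apply: cvg_row => k; apply: (near_cvg _ (@gv k)) => //.
by apply: nearW => h; rewrite !mxE.
Qed.

Lemma cvg_path_within : gam @ F --> within H (nbhs p).
Proof.
have c : gam @ F --> p.
  apply: (near_cvg _ (cvgD (cvg_cst p) (cvgZ h0 quo_v))); last by rewrite scale0r addr0.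
  by apply: filterS hn => h hn'; rewrite !fctE /quo scalerA divff// scale1r addrC subrK.
move=> A Aw; have A0 := c [set y | H y -> A y] Aw.
by apply: filterS2 A0 Hg => h; exact.
Qed.

(** The chain rule at one point, for a path which may be one-sided (when F is a
    filter of [increments]) and has a velocity at p only. *)
Lemma cvg_diffquot_path (U : set 'rV[R]_q.+1) g :
  relopen U -> Ck 1 U g -> U p ->
  (fun h => h^-1 * (g (gam h) - g p)) @ F --> \sum_k v 0 k * pder H g k p.
Proof.
move=> oU Cg Up; have gam_p := cvg_path_within.
have lin : (fun h => \sum_k (h^-1 * (gam h 0 k - p 0 k)) * pder H g k p) @ F
    --> \sum_k v 0 k * pder H g k p.
  apply: cvg_fsum => k.
  exact: cvgM (@gv k) (cvg_cst (pder H g k p)).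
have rem : (fun h => h^-1 * (g (gam h) - g p
     - \sum_k (gam h 0 k - p 0 k) * pder H g k p)) @ F --> (0 : R).
  apply/cvgrPdist_le => e e0.
  have e1 : 0 < e / (`|v| + 1) by rewrite divr_gt0.
  have D : \forall h \near F, `|g (gam h) - g p
     - \sum_k (gam h 0 k - p 0 k) * pder H g k p| <= e / (`|v| + 1) * `|gam h - p|.
    exact: (gam_p _ (Ck_differentiable oU Cg Up e1)).
  have B : \forall h \near F, `|v - quo h| <= 1 by exact: (cvgr_dist_le _ _ quo_v _ ltr01).
  apply: filterS2 D B => h Dh Bh.
  rewrite sub0r normrN normrM.
  apply: (@le_trans _ _ (`|h^-1| * (e / (`|v| + 1) * `|gam h - p|))).
    by rewrite ler_wpM2l.
  rewrite mulrCA -normrZ -/(quo h) -mulrA (ler_piMr (ltW e0))//.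
  rewrite ler_pdivrMl// mulr1.
  have -> : quo h = v - (v - quo h) by rewrite subKr.
  by rewrite (le_trans (ler_normB _ _))// lerD2l.
apply: (near_cvg _ (cvgD lin rem)); last by rewrite addr0.
apply: nearW => h; rewrite !fctE mulrBr addrC mulr_sumr.
under [X in _ - X]eq_bigr do rewrite mulrA.
by rewrite subrK.
Qed.

End Path.

Lemma is_pder_comp (d : nat) (D : set 'rV[R]_d) (U : set 'rV[R]_q.+1)
    (F : 'rV[R]_d -> 'rV[R]_q.+1) g a x (l : 'I_q.+1 -> R) :
  relopen U -> Ck 1 U g -> U (F x) ->
  (\forall y \near within D (nbhs x), H (F y)) ->
  (forall k, is_pder D (fun y => F y 0 k) a x (l k)) ->
  is_pder D (fun y => g (F y)) a x (\sum_k l k * pder H g k (F x)).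
Proof.
move=> oU Cg UF HF Fl.
have := @cvg_diffquot_path (F x) (increments D a x) _
  (fun h => F (x + h *: delta_mx 0 a)) (\row_k l k)
  (@increments_nbhs0 _ _ _ _ _) (increments_neq0 _ _ _)
  (increments_pt a HF) _ U g oU Cg UF.
rewrite /is_pder /diffquot.
under eq_bigr do rewrite mxE.
by apply => k; rewrite mxE; exact: Fl.
Qed.

End ChainRule.

Section Schwarz.
Variables (R : realType) (d : nat).
Local Notation H := (halfspace R d).
Implicit Types (U : set 'rV[R]_d.+1) (f g : 'rV[R]_d.+1 -> R) (a b : 'I_d.+1)
  (p x y : 'rV[R]_d.+1).

Lemma halfspaceD x b h : 0 <= h -> H x -> H (x + h *: delta_mx 0 b).
Proof.
by move=> h0 Hx; rewrite /halfspace /= deltaE addr_ge0// mulr_ge0.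
Qed.

Lemma is_pder_shift f a b x h l : 0 <= h ->
  is_pder H f a (x + h *: delta_mx 0 b) l ->
  is_pder H (fun y => f (y + h *: delta_mx 0 b)) a x l.
Proof.
move=> h0 fl.
have sub : increments H a x --> increments H a (x + h *: delta_mx 0 b).
  move=> A iA.
  have A0 : (0 : R)^' [set t | H (x + h *: delta_mx 0 b + t *: delta_mx 0 a) -> A t] by exact: iA.
  suff : (0 : R)^' [set t | H (x + t *: delta_mx 0 a) -> A t] by [].
  apply: filterS A0 => t At Ht; apply: At.
  by rewrite addrAC; exact: halfspaceD.
have L := cvg_trans (cvg_app (diffquot f a (x + h *: delta_mx 0 b)) sub) fl.
apply: (near_cvg _ L) => //; apply: nearW => t.
by rewrite /diffquot [x + _ + _]addrAC.
Qed.

Lemma double_difference U f a b p h : Ck 2 U f -> 0 < h -> H p ->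
  (forall s t, 0 <= s <= h -> 0 <= t <= h ->
     U (p + s *: delta_mx 0 a + t *: delta_mx 0 b)) ->
  exists s t, [/\ 0 <= s <= h, 0 <= t <= h &
    f (p + h *: delta_mx 0 a + h *: delta_mx 0 b) - f (p + h *: delta_mx 0 a)
    - (f (p + h *: delta_mx 0 b) - f p) =
    pder H (pder H f a) b (p + s *: delta_mx 0 a + t *: delta_mx 0 b) * h ^+ 2].
Proof.
move=> Cf h0 Hp US; pose g y := f (y + h *: delta_mx 0 b) - f y.
have C1 : Ck 1 U f by exact: CkS.
have h01 : 0 <= h <= h by rewrite lexx ltW.
have h00 : 0 <= (0 : R) <= h by rewrite lexx ltW.
have [s sh|s sh|s sh E] := @mean_value_line R d g a p h
  (fun s => pder H f a (p + s *: delta_mx 0 a + h *: delta_mx 0 b)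
            - pder H f a (p + s *: delta_mx 0 a)) h0.
- by apply: halfspaceD => //; case/andP: sh.
- apply: is_pderB.
    by apply: is_pder_shift; [exact: ltW|apply: Ck_is_pder C1 _; exact: US].
  apply: Ck_is_pder C1 _.
  by have := US s 0 sh h00; rewrite scale0r addr0.
have sh' : 0 <= s <= h by case/andP: sh => ? ?; rewrite !ltW.
have Hs : H (p + s *: delta_mx 0 a) by apply: halfspaceD => //; case/andP: sh'.
have [t th|t th|t th E'] := @mean_value_line R d (pder H f a) b (p + s *: delta_mx 0 a) h
  (fun t => pder H (pder H f a) b (p + s *: delta_mx 0 a + t *: delta_mx 0 b)) h0.
- by apply: halfspaceD => //; case/andP: th.
- by apply: Ck_is_pder (Ck_pder a Cf) _; exact: US.
exists s, t; split=> //; first by case/andP: th => ? ?; rewrite !ltW.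
by rewrite E' /g in E; rewrite expr2 mulrA -E; ring.
Qed.

(** The classical proof by double differences also applies at the boundary
    points, as it only uses nonnegative increments. *)
Lemma pder_comm U f a b p : relopen U -> Ck 2 U f -> U p ->
  pder H (pder H f a) b p = pder H (pder H f b) a p.
Proof.
move=> oU Cf Up; have [Hp pU] := oU p Up.
have cont c c' := Ck_continuous oU (Ck_pder c' (Ck_pder c Cf)) Up.
apply/eqP; rewrite -subr_eq0 -normr_le0; apply/ler_addgt0Pl => e e0; rewrite addr0.
have e20 : 0 < e / 2 by rewrite divr_gt0.
have c1 : \forall y \near within H (nbhs p),
    `|pder H (pder H f a) b p - pder H (pder H f a) b y| <= e / 2.
  exact: (cvgr_dist_le _ _ (cont a b) _ e20).
have c2 : \forall y \near within H (nbhs p),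
    `|pder H (pder H f b) a p - pder H (pder H f b) a y| <= e / 2.
  exact: (cvgr_dist_le _ _ (cont b a) _ e20).
have good : \forall y \near within H (nbhs p), U y /\
    (`|pder H (pder H f a) b p - pder H (pder H f a) b y| <= e / 2 /\
     `|pder H (pder H f b) a p - pder H (pder H f b) a y| <= e / 2).
  exact: (filterI pU (filterI c1 c2)).
move: good => /= /nbhs_ballP[delta /= delta0 good].
pose h := delta / 4; have h0 : 0 < h by rewrite divr_gt0.
have {}good s t c c' : 0 <= s <= h -> 0 <= t <= h ->
    let y := p + s *: delta_mx 0 c + t *: delta_mx 0 c' in
    [/\ U y, `|pder H (pder H f a) b p - pder H (pder H f a) b y| <= e / 2 &
    `|pder H (pder H f b) a p - pder H (pder H f b) a y| <= e / 2].
  move=> /andP[s0 sh] /andP[t0 th] y.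
  have Hy : H y by apply: halfspaceD => //; exact: halfspaceD.
  have [] := good y _ Hy; last by move=> ? [].
  rewrite -ball_normE /= distrC (_ : y - p = s *: delta_mx 0 c + t *: delta_mx 0 c'); last first.
    by rewrite /y addrC !addrA addNr add0r.
  apply: (@le_lt_trans _ _ (delta / 2)).
    apply: ler_norm_row => [|k]; first by rewrite divr_ge0 ?ltW.
    rewrite !mxE eqxx (le_trans (ler_normD _ _))// !normrM !normr_nat !ger0_norm//.
    have cs (c0 : 'I_d.+1) : (k == c0)%:R <= (1 : R) by case: eqP; rewrite ?lexx ?ler01.
    have -> : delta / 2 = h + h by rewrite /h; lra.
    apply: lerD.
      by rewrite (le_trans (ler_piMr _ (cs c))).
    by rewrite (le_trans (ler_piMr _ (cs c'))).
  by rewrite ltr_pdivrMr// ltr_pMr// ltr1n.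
have [s [t [sh th E]]] := @double_difference U f a b p h Cf h0 Hp
  (fun s t sh th => let: And3 A _ _ := good s t a b sh th in A).
have [s' [t' [sh' th' E']]] := @double_difference U f b a p h Cf h0 Hp
  (fun s t sh th => let: And3 A _ _ := good s t b a sh th in A).
have [_ G1 _] := good s t a b sh th; have [_ _ G2] := good s' t' b a sh' th'.
have h2 : h ^+ 2 != 0 by rewrite expf_neq0// gt_eqF.
have EE (A B C D u v : R) : A - B - (C - D) = u * h ^+ 2 ->
    A - C - (B - D) = v * h ^+ 2 -> u = v.
  by move=> Eu Ev; apply: (mulIf h2); rewrite -Eu -Ev; ring.
have tri (u v w : R) : `|u - w| <= e / 2 -> `|v - w| <= e / 2 -> `|u - v| <= e.
  move=> uw vw; rewrite [leRHS]splitr -(subrKA w).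
  by rewrite (le_trans (ler_normD _ _))// lerD// distrC.
rewrite [X in f X - _ - _]addrAC in E'; rewrite (EE _ _ _ _ _ _ E E') in G1.
exact: tri G1 G2.
Qed.

End Schwarz.

(** * Closure properties of the classes C^k *)

Section Closure.
Variables (R : realType) (d : nat) (U : set 'rV[R]_d.+1).
Hypothesis oU : relopen U.
Local Notation H := (halfspace R d).
Implicit Types (f g : 'rV[R]_d.+1 -> R) (a b : 'I_d.+1) (x : 'rV[R]_d.+1).

Lemma relopen_eq_near (T : Type) (f g : 'rV[R]_d.+1 -> T) x :
  (forall y, U y -> f y = g y) -> U x ->
  \forall y \near within H (nbhs x), f y = g y.
Proof. by move=> fg /oU[_]; apply: filterS => y; exact: fg. Qed.

Lemma Ck_eq k f g : (forall x, U x -> f x = g x) -> Ck k U f -> Ck k U g.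
Proof.
elim: k f g => [|k IH] f g fg Cf.
  apply: (continuous_Ck0 oU) => x Ux.
  by apply: (near_cvg _ (Ck_continuous oU Cf Ux)); [exact: relopen_eq_near|exact: fg].
split.
  apply/subspace_continuousP => x Ux.
  have [/subspace_continuousP/(_ x Ux) cf _] := Cf.
  apply: (near_cvg _ cf); last exact: fg.
  by apply: filterS (withinT _ _) => y; exact: fg.
move=> a; split=> [x Ux|].
  have [Hx _] := oU Ux.
  have := is_pder_eq_near (fg _ Ux) (relopen_eq_near fg Ux) (Ck_is_pder (a := a) Cf Ux).
  by move=> /(is_pderP Hx)[].
apply: IH (Ck_pder a Cf) => x Ux.
exact: pder_eq_near (fg _ Ux) (relopen_eq_near fg Ux).
Qed.

Lemma CkI k f (l : 'I_d.+1 -> 'rV[R]_d.+1 -> R) : Ck 0 U f ->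
  (forall a x, U x -> is_pder H f a x (l a x)) -> (forall a, Ck k U (l a)) ->
  Ck k.+1 U f.
Proof.
move=> Cf fl Cl; split=> [|a]; first by case: Cf.
split=> [x Ux|]; first by have [Hx _] := oU Ux; have [] := is_pderP Hx (fl a x Ux).
apply: Ck_eq (Cl a) => x Ux.
by have [Hx _] := oU Ux; rewrite (is_pder_pder Hx (fl a x Ux)).
Qed.

Lemma Ck_cst k (c : R) : Ck k U (fun=> c).
Proof.
have C0 c' : Ck 0 U (fun=> c') by apply: (continuous_Ck0 oU) => x Ux; exact: cvg_cst.
elim: k c => [//|k IH] c; apply: (CkI (l := fun _ _ => 0)) => // a x _.
exact: is_pder_cst.
Qed.

Lemma CkD k f g : Ck k U f -> Ck k U g -> Ck k U (fun x => f x + g x).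
Proof.
elim: k f g => [|k IH] f g Cf Cg.
  apply: (continuous_Ck0 oU) => x Ux.
  exact: cvgD (Ck_continuous oU Cf Ux) (Ck_continuous oU Cg Ux).
apply: (CkI (l := fun a x => pder H f a x + pder H g a x)) => [|a x Ux|a].
- apply: (continuous_Ck0 oU) => x Ux.
  exact: cvgD (Ck_continuous oU Cf Ux) (Ck_continuous oU Cg Ux).
- by apply: is_pderD; [exact: Ck_is_pder Cf Ux|exact: Ck_is_pder Cg Ux].
- by apply: IH; exact: Ck_pder.
Qed.

Lemma CkM k f g : Ck k U f -> Ck k U g -> Ck k U (fun x => f x * g x).
Proof.
elim: k f g => [|k IH] f g Cf Cg.
  apply: (continuous_Ck0 oU) => x Ux.
  exact: cvgM (Ck_continuous oU Cf Ux) (Ck_continuous oU Cg Ux).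
apply: (CkI (l := fun a x => pder H f a x * g x + f x * pder H g a x)) => [|a x Ux|a].
- apply: (continuous_Ck0 oU) => x Ux.
  exact: cvgM (Ck_continuous oU Cf Ux) (Ck_continuous oU Cg Ux).
- by apply: is_pderM; [exact: Ck_is_pder Cf Ux|exact: Ck_is_pder Cg Ux].
- by apply: CkD; apply: IH => //; try exact: Ck_pder; exact: CkS.
Qed.

Lemma CkZ k c f : Ck k U f -> Ck k U (fun x => c * f x).
Proof. by move=> Cf; apply: CkM => //; exact: Ck_cst. Qed.

Lemma CkN k f : Ck k U f -> Ck k U (fun x => - f x).
Proof. by move=> /(CkZ (-1)); apply: Ck_eq => x _; rewrite mulN1r. Qed.

Lemma CkB k f g : Ck k U f -> Ck k U g -> Ck k U (fun x => f x - g x).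
Proof. by move=> Cf Cg; apply: CkD => //; exact: CkN. Qed.

Lemma Ck_sum k (I : Type) (s : seq I) (P : pred I) (f : I -> 'rV[R]_d.+1 -> R) :
  (forall i, Ck k U (f i)) -> Ck k U (fun x => \sum_(i <- s | P i) f i x).
Proof.
move=> Cf; elim: s => [|i s IH].
  by apply: Ck_eq (Ck_cst k 0) => x _; rewrite big_nil.
case Pi: (P i).
  by apply: Ck_eq (CkD (Cf i) IH) => x _; rewrite big_cons Pi.
by apply: Ck_eq IH => x _; rewrite big_cons Pi.
Qed.

Lemma Ck_prod k (I : Type) (s : seq I) (P : pred I) (f : I -> 'rV[R]_d.+1 -> R) :
  (forall i, Ck k U (f i)) -> Ck k U (fun x => \prod_(i <- s | P i) f i x).
Proof.
move=> Cf; elim: s => [|i s IH].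
  by apply: Ck_eq (Ck_cst k 1) => x _; rewrite big_nil.
case Pi: (P i).
  by apply: Ck_eq (CkM (Cf i) IH) => x _; rewrite big_cons Pi.
by apply: Ck_eq IH => x _; rewrite big_cons Pi.
Qed.

Lemma CkV k f : (forall x, U x -> f x != 0) -> Ck k U f ->
  Ck k U (fun x => (f x)^-1).
Proof.
move=> f0; have C0 l : Ck l U f -> Ck 0 U (fun x => (f x)^-1).
  move=> Cf; apply: (continuous_Ck0 oU) => x Ux.
  exact: cvgV (f0 x Ux) (Ck_continuous oU Cf Ux).
elim: k => [|k IH] Cf; first exact: C0 Cf.
apply: (CkI (l := fun a x => - pder H f a x * ((f x)^-1 * (f x)^-1))) => [|a x Ux|a].
- exact: C0 Cf.
- rewrite -invfM; apply: is_pderV; [exact: f0|exact: Ck_is_pder Cf Ux].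
- by apply: CkM; [apply/CkN; exact: Ck_pder|apply: CkM; apply/IH/CkS].
Qed.

Lemma Ck_sqrt k f : (forall x, U x -> 0 < f x) -> Ck k U f ->
  Ck k U (fun x => Num.sqrt (f x)).
Proof.
move=> f0; have C0 l : Ck l U f -> Ck 0 U (fun x => Num.sqrt (f x)).
  move=> Cf; apply: (continuous_Ck0 oU) => x Ux.
  exact: (cvg_comp _ _ (Ck_continuous oU Cf Ux) (@sqrt_continuous _ (f x))).
elim: k => [|k IH] Cf; first exact: C0 Cf.
apply: (CkI (l := fun a x => pder H f a x * (2 * Num.sqrt (f x))^-1)) => [|a x Ux|a].
- exact: C0 Cf.
- apply: is_pder_sqrt; [exact: f0|exact: Ck_is_pder Cf Ux|].
  by have [_] := oU Ux; apply: filterS => y /f0 /ltW.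
- apply: CkM; first exact: Ck_pder.
  apply: CkV => [x Ux|]; last by apply: CkZ; apply: IH; exact: CkS.
  by rewrite mulf_neq0// gt_eqF// sqrtr_gt0; exact: f0.
Qed.

End Closure.

Section Composition.
Variables (R : realType) (d q : nat).
Variables (U : set 'rV[R]_d.+1) (V : set 'rV[R]_q.+1).
Hypotheses (oU : relopen U) (oV : relopen V).
Variable F : 'rV[R]_d.+1 -> 'rV[R]_q.+1.
Hypothesis UV : forall x, U x -> V (F x).
Local Notation H := (halfspace R d).
Local Notation Hq := (halfspace R q).

Lemma relopen_map_near x : U x -> \forall y \near within H (nbhs x), Hq (F y).
Proof. by move=> /oU[_]; apply: filterS => y /UV /oV[]. Qed.

Lemma pder_comp k l g a x : (forall i, Ck k.+1 U (fun x => F x 0 i)) ->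
  Ck l.+1 V g -> U x ->
  is_pder H (fun y => g (F y)) a x
    (\sum_i pder H (fun y => F y 0 i) a x * pder Hq g i (F x)).
Proof.
move=> CF Cg Ux; apply: (is_pder_comp oV) => //.
- exact: Ck_le Cg.
- exact: UV.
- exact: relopen_map_near.
- by move=> i; exact: Ck_is_pder (CF i) Ux.
Qed.

Lemma Ck_comp k g : (forall i, Ck k U (fun x => F x 0 i)) -> Ck k V g ->
  Ck k U (fun x => g (F x)).
Proof.
have C0 l m g' : (forall i, Ck l U (fun x => F x 0 i)) -> Ck m V g' ->
    Ck 0 U (fun x => g' (F x)).
  move=> CF Cg; apply: (continuous_Ck0 oU) => x Ux.
  have c : F @ within H (nbhs x) --> F x.
    by apply: cvg_row => i; exact: Ck_continuous (CF i) Ux.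
  have c' : F @ within H (nbhs x) --> within Hq (nbhs (F x)).
    move=> A Aw; have A0 := c [set y | Hq y -> A y] Aw.
    by apply: filterS2 A0 (relopen_map_near Ux) => y; exact.
  apply: cvg_comp c' _; exact: Ck_continuous Cg (UV Ux).
elim: k g => [|k IH] g CF Cg; first exact: C0 CF Cg.
apply: (CkI oU (l := fun a x =>
  \sum_i pder H (fun y => F y 0 i) a x * pder Hq g i (F x))) => [|a x Ux|a].
- exact: C0 CF Cg.
- exact: pder_comp CF Cg Ux.
- apply: Ck_sum => // i; apply: CkM => //; first exact: Ck_pder (CF i).
  by apply: IH; [move=> j; exact: CkS|exact: Ck_pder Cg].
Qed.

End Composition.

Definition Ckmx (R : realType) (d m n k : nat) (U : set 'rV[R]_d.+1)
  (A : 'rV[R]_d.+1 -> 'M[R]_(m, n)) := forall i j, Ck k U (fun x => A x i j).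

Section MatrixClosure.
Variables (R : realType) (d : nat) (U : set 'rV[R]_d.+1).
Hypothesis oU : relopen U.

Lemma Ckmx_mul k m n p (A : 'rV[R]_d.+1 -> 'M[R]_(m, n)) (B : _ -> 'M[R]_(n, p)) :
  Ckmx k U A -> Ckmx k U B -> Ckmx k U (fun x => A x *m B x).
Proof.
move=> CA CB i j; apply: (Ck_eq oU (f := fun x => \sum_l A x i l * B x l j)).
  by move=> x _; rewrite mxE.
by apply: Ck_sum => // l; exact: CkM.
Qed.

Lemma Ckmx_tr k m n (A : 'rV[R]_d.+1 -> 'M[R]_(m, n)) :
  Ckmx k U A -> Ckmx k U (fun x => (A x)^T).
Proof. by move=> CA i j; apply: Ck_eq (CA j i) => // x _; rewrite mxE. Qed.

Lemma Ckmx_cst k m n (A : 'M[R]_(m, n)) : Ckmx k U (fun=> A).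
Proof. by move=> i j; exact: Ck_cst. Qed.

Lemma Ckmx_sub k m n (A B : 'rV[R]_d.+1 -> 'M[R]_(m, n)) :
  Ckmx k U A -> Ckmx k U B -> Ckmx k U (fun x => A x - B x).
Proof.
by move=> CA CB i j; apply: Ck_eq (CkB oU (CA i j) (CB i j)) => // x _; rewrite !mxE.
Qed.

Lemma Ck_trace k n (A : 'rV[R]_d.+1 -> 'M[R]_n) :
  Ckmx k U A -> Ck k U (fun x => \tr (A x)).
Proof. by move=> CA; apply: Ck_sum => // i; exact: CA. Qed.

Lemma Ck_det k n (A : 'rV[R]_d.+1 -> 'M[R]_n) :
  Ckmx k U A -> Ck k U (fun x => \det (A x)).
Proof.
move=> CA; apply: Ck_sum => // s; apply: CkZ => //.
by apply: Ck_prod => // i; exact: CA.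
Qed.

Lemma Ckmx_inv k n (A : 'rV[R]_d.+1 -> 'M[R]_n) :
  (forall x, U x -> A x \in unitmx) -> Ckmx k U A ->
  Ckmx k U (fun x => invmx (A x)).
Proof.
move=> uA CA i j.
pose B x := (\det (A x))^-1 * ((-1) ^+ (j + i) * \det (row' j (col' i (A x)))).
apply: (Ck_eq oU (f := B)).
  by move=> x /uA Ax; rewrite /invmx Ax !mxE.
apply: CkM => //.
  apply: CkV => //; last exact: Ck_det.
  by move=> x /uA; rewrite unitmxE unitfE.
apply: CkZ => //; apply: Ck_det => i' j'.
by apply: Ck_eq (CA (lift j i') (lift i j')) => // x _; rewrite !mxE.
Qed.

End MatrixClosure.

(** * Linear algebra of a metric and of a hyperplane *)

Section Inner.
Variables (R : realType) (q : nat).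
Implicit Types (G : 'M[R]_q) (u v w : 'rV[R]_q).

Lemma innerDl G u v w : inner G (u + v) w = inner G u w + inner G v w.
Proof. by rewrite /inner !mulmxDl mxE. Qed.

Lemma innerZl G c u w : inner G (c *: u) w = c * inner G u w.
Proof. by rewrite /inner -!scalemxAl mxE. Qed.

Lemma innerDr G u v w : inner G u (v + w) = inner G u v + inner G u w.
Proof. by rewrite /inner linearD mulmxDr mxE. Qed.

Lemma innerZr G c u w : inner G u (c *: w) = c * inner G u w.
Proof. by rewrite /inner linearZ -scalemxAr mxE. Qed.

Lemma innerBl G u v w : inner G (u - v) w = inner G u w - inner G v w.
Proof. by rewrite -scaleN1r innerDl innerZl mulN1r. Qed.

Lemma innerBr G u v w : inner G u (v - w) = inner G u v - inner G u w.
Proof. by rewrite -scaleN1r innerDr innerZr mulN1r. Qed.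

Lemma innerDm G G' u v : inner (G + G') u v = inner G u v + inner G' u v.
Proof. by rewrite /inner mulmxDr mulmxDl mxE. Qed.

Lemma innerZm c G u v : inner (c *: G) u v = c * inner G u v.
Proof. by rewrite /inner -scalemxAr -scalemxAl mxE. Qed.

Lemma inner_suml G (I : Type) (s : seq I) (u : I -> 'rV[R]_q) w :
  inner G (\sum_(i <- s) u i) w = \sum_(i <- s) inner G (u i) w.
Proof. by rewrite /inner !mulmx_suml summxE. Qed.

Lemma inner_sumr G (I : Type) (s : seq I) (u : I -> 'rV[R]_q) w :
  inner G w (\sum_(i <- s) u i) = \sum_(i <- s) inner G w (u i).
Proof. by rewrite /inner linear_sum mulmx_sumr summxE. Qed.

Lemma inner_summ (I : Type) (s : seq I) (G : I -> 'M[R]_q) u w :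
  inner (\sum_(i <- s) G i) u w = \sum_(i <- s) inner (G i) u w.
Proof. by rewrite /inner mulmx_sumr mulmx_suml summxE. Qed.

Lemma inner0l G w : inner G 0 w = 0.
Proof. by rewrite /inner !mul0mx mxE. Qed.

Lemma innerE G u w : inner G u w = \sum_i \sum_j u 0 i * G i j * w 0 j.
Proof.
rewrite /inner mxE exchange_big /=; apply: eq_bigr => j _.
by rewrite mxE [w^T j 0]mxE mulr_suml.
Qed.

Lemma innerC G u w : G^T = G -> inner G u w = inner G w u.
Proof.
move=> sG; rewrite /inner -[RHS]mulr1; rewrite -[in LHS]sG.
have -> : u *m G^T *m w^T = (w *m G *m u^T)^T.
  by rewrite !trmx_mul trmxK mulmxA.
by rewrite mxE mulr1.
Qed.

Lemma inner_mul (p : nat) (J : 'M[R]_(p, q)) G (u v : 'rV[R]_p) :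
  inner (J *m G *m J^T) u v = inner G (u *m J) (v *m J).
Proof. by rewrite /inner trmx_mul !mulmxA. Qed.

End Inner.

Lemma inner_row (R : realType) (p q : nat) (J : 'M[R]_(p, q)) G (a b : 'I_p) :
  inner G (row a J) (row b J) = (J *m G *m J^T) a b.
Proof.
rewrite !rowE -inner_mul /inner -rowE mxE (bigD1 b)//= big1 => [|i ib].
  by rewrite !mxE !eqxx mulr1 addr0.
by rewrite !mxE (negbTE ib) mulr0.
Qed.


Definition posdef (R : realType) (q : nat) (G : 'M[R]_q) : Prop :=
  G^T = G /\ forall v, v != 0 -> 0 < inner G v v.

(** Normals are not normalized: this relation is insensitive to a rescaling of G,
    so that g_+ and its compactifications have the same normals. *)
Definition normal (R : realType) (p q : nat) (G : 'M[R]_q) (J : 'M[R]_(p, q))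
  (nu : 'rV[R]_q) : Prop := J *m G *m nu^T = 0.

(** The orthogonal projection of nu to the normal space of the rows of J. *)
Definition normal_part (R : realType) (p q : nat) (G : 'M[R]_q)
    (J : 'M[R]_(p, q)) (nu : 'rV[R]_q) : 'rV[R]_q :=
  nu - nu *m G *m J^T *m invmx (J *m G *m J^T) *m J.

Section Posdef.
Variables (R : realType) (q : nat).
Implicit Types (G : 'M[R]_q).

Lemma posdef_sym G : posdef G -> G^T = G. Proof. by case. Qed.

Lemma posdef_unit G : posdef G -> G \in unitmx.
Proof.
move=> [_ G0]; rewrite -row_free_unit -kermx_eq0; apply/rowV0P => v /sub_kermxP vG.
apply: contraTeq isT => /G0; by rewrite /inner vG mul0mx mxE ltxx.
Qed.

Lemma posdef_inner_eq0 G v : posdef G -> inner G v v = 0 -> v = 0.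
Proof. by move=> [_ G0] v0; apply: contra_eq v0 => /G0; rewrite lt0r => /andP[]. Qed.

Lemma posdefZ c G : 0 < c -> posdef G -> posdef (c *: G).
Proof.
move=> c0 [sG G0]; split; first by rewrite linearZ /= sG.
by move=> v /G0 v0; rewrite innerZm mulr_gt0.
Qed.

End Posdef.

Section Normal.
Variables (R : realType) (p q : nat).
Implicit Types (G : 'M[R]_q) (J : 'M[R]_(p, q)) (nu : 'rV[R]_q).

Lemma posdef_gram G J : row_free J -> posdef G -> posdef (J *m G *m J^T).
Proof.
move=> fJ [sG G0]; split; first by rewrite !trmx_mul trmxK sG mulmxA.
by move=> v v0; rewrite inner_mul G0// mulmx_free_eq0.
Qed.

Lemma normal_inner G J nu v : normal G J nu -> inner G (v *m J) nu = 0.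
Proof. by rewrite /inner -!mulmxA => + ; rewrite /normal -mulmxA => ->; rewrite mulmx0 mxE. Qed.

Lemma normal_row G J nu a : normal G J nu -> inner G (row a J) nu = 0.
Proof. by rewrite rowE; exact: normal_inner. Qed.

Lemma normal_of_inner G J nu : (forall v : 'rV[R]_p, inner G (v *m J) nu = 0) -> normal G J nu.
Proof.
move=> n0; apply/matrixP => a b; rewrite (ord1 b) [RHS]mxE.
by have := n0 (delta_mx 0 a); rewrite /inner -!mulmxA -rowE mxE => ->.
Qed.

Lemma normalZ G J c nu : normal G J nu -> normal G J (c *: nu).
Proof. by rewrite /normal linearZ /= -scalemxAr => ->; rewrite scaler0. Qed.

Lemma normalZm c G J nu : normal G J nu -> normal (c *: G) J nu.
Proof. by rewrite /normal -scalemxAr -scalemxAl => ->; rewrite scaler0. Qed.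

Lemma normalZmV c G J nu : c != 0 -> normal (c *: G) J nu -> normal G J nu.
Proof. by move=> c0 /(normalZm c^-1); rewrite scalerA mulVf// scale1r. Qed.

Lemma unit_normalE G J nu :
  unit_normal G J nu <-> inner G nu nu = 1 /\ normal G J nu.
Proof.
split=> -[n1 n0]; split=> //; first exact: normal_of_inner.
by move=> v; exact: normal_inner.
Qed.

Lemma normal_part_normal G J nu : row_free J -> posdef G ->
  normal G J (normal_part G J nu).
Proof.
move=> fJ pG; have pJ := posdef_gram fJ pG.
have sG := posdef_sym pG; have sJ := posdef_sym pJ.
rewrite /normal /normal_part linearB /= mulmxBr; apply/eqP; rewrite subr_eq0; apply/eqP.
rewrite !trmx_mul trmx_inv sJ trmxK sG !mulmxA.
by rewrite mulmxV ?mul1mx// posdef_unit.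
Qed.

Lemma normal_part_id G J nu : G^T = G -> normal G J nu -> normal_part G J nu = nu.
Proof.
move=> sG n0; rewrite /normal_part.
have -> : nu *m G *m J^T = (J *m G *m nu^T)^T by rewrite !trmx_mul trmxK sG mulmxA.
by rewrite n0 trmx0 !mul0mx subr0.
Qed.

(** A vector orthogonal to all normals is tangent: its normal part is
    orthogonal to itself. *)
Lemma orthogonal_normal_tangent G J X : row_free J -> posdef G ->
  (forall nu, normal G J nu -> inner G X nu = 0) -> exists v, X = v *m J.
Proof.
move=> fJ pG X0; have nX := normal_part_normal X fJ pG.
have /eqP : normal_part G J X = 0.
  apply: (posdef_inner_eq0 pG).
  by rewrite {1}/normal_part innerBl X0// normal_inner// subrr.
by rewrite subr_eq0 => /eqP E; eexists; exact: E.
Qed.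

End Normal.

Section NormalLine.
Variables (R : realType) (p : nat).

Lemma normal_line (G : 'M[R]_p.+1) (J : 'M[R]_(p, p.+1)) N W : row_free J ->
  posdef G -> normal G J N -> normal G J W -> W != 0 -> exists c, N = c *: W.
Proof.
move=> fJ pG nN nW W0.
have K nu : normal G J nu -> (nu <= kermx (J *m G)^T)%MS.
  by move=> n0; apply/sub_kermxP; rewrite -[LHS]trmxK trmx_mul trmxK n0 trmx0.
have rK : \rank (kermx (J *m G)^T) = 1%N.
  rewrite mxrank_ker mxrank_tr mxrankMfree ?row_free_unit ?posdef_unit//.
  by move/eqP: fJ => ->; rewrite subSnn.
have WK : (kermx (J *m G)^T <= W)%MS.
  by rewrite -(geq_leqif (mxrank_leqif_sup (K _ nW))) rK rank_rV W0.
have /sub_rVP[c cW] : (N <= W)%MS := submx_trans (K _ nN) WK.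
by exists c.
Qed.

End NormalLine.

(** * The second fundamental form without inverse matrices *)

Definition mx_pder (R : realType) (q m n : nat) (E : set 'rV[R]_q)
    (G : 'rV[R]_q -> 'M[R]_(m, n)) (y : 'rV[R]_q) (xi : 'rV[R]_q) : 'M[R]_(m, n) :=
  \sum_k xi 0 k *: \matrix_(i, j) pder E (fun z => G z i j) k y.

Definition hess (R : realType) (p q : nat) (D : set 'rV[R]_p)
    (F : 'rV[R]_p -> 'rV[R]_q) (a b : 'I_p) (x : 'rV[R]_p) : 'rV[R]_q :=
  \row_k pder D (pder D (fun y => F y 0 k) b) a x.

(** The Christoffel symbols of the first kind, contracted with u, w and nu. *)
Definition koszul (R : realType) (q : nat) (E : set 'rV[R]_q)
    (G : 'rV[R]_q -> 'M[R]_q) (y nu u w : 'rV[R]_q) : R :=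
  let dG := mx_pder E G y in
  2^-1 * (inner (dG u) w nu + inner (dG w) u nu - inner (dG nu) u w).

(** Koszul's formula for the second fundamental form: the metric is not
    inverted. *)
Definition koszul_ff (R : realType) (p q : nat)
    (D : set 'rV[R]_p) (E : set 'rV[R]_q) (G : 'rV[R]_q -> 'M[R]_q)
    (F : 'rV[R]_p -> 'rV[R]_q) (x : 'rV[R]_p) (nu : 'rV[R]_q) : 'M[R]_p :=
  let J := jac D F x in
  \matrix_(a, b) (inner (G (F x)) (hess D F a b x) nu
    + koszul E G (F x) nu (row a J) (row b J)).

Section Koszul.
Variables (R : realType) (p q : nat) (D : set 'rV[R]_p) (E : set 'rV[R]_q).
Variables (G : 'rV[R]_q -> 'M[R]_q) (F : 'rV[R]_p -> 'rV[R]_q).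

Lemma inner_mx_pder y xi u w : inner (mx_pder E G y xi) u w =
  \sum_k \sum_i \sum_j xi 0 k * (u 0 i * pder E (fun z => G z i j) k y * w 0 j).
Proof.
rewrite /mx_pder inner_summ; apply: eq_bigr => k _.
rewrite innerZm innerE mulr_sumr; apply: eq_bigr => i _.
by rewrite mulr_sumr; apply: eq_bigr => j _; rewrite mxE.
Qed.

Lemma second_ffE x nu : (G (F x))^T = G (F x) -> G (F x) \in unitmx ->
  second_ff D E G F x nu = koszul_ff D E G F x nu.
Proof.
move=> sG uG; apply/matrixP => a b; rewrite !mxE /koszul.
set J := jac D F x.
pose c : 'rV[R]_q := \row_l \sum_i \sum_j
  (pder E (fun y => G y j l) i (F x) + pder E (fun y => G y i l) j (F x)
   - pder E (fun y => G y i j) l (F x)) * (J a i * J b j).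
have -> : cov_hessian D E G F a b x = hess D F a b x + 2^-1 *: (c *m invmx (G (F x))).
  apply/rowP => k; rewrite !mxE; congr (_ + _).
  rewrite mulr_sumr; under [RHS]eq_bigr do rewrite mxE mulr_suml mulr_sumr.
  rewrite [RHS]exchange_big /=; apply: eq_bigr => i _.
  under [RHS]eq_bigr do rewrite mulr_suml mulr_sumr.
  rewrite [RHS]exchange_big /=; apply: eq_bigr => j _.
  rewrite /christoffel mulr_sumr !mulr_suml; apply: eq_bigr => l _.
  have -> : invmx (G (F x)) k l = invmx (G (F x)) l k.
    by rewrite -[in LHS]sG -trmx_inv mxE.
  by rewrite /J; ring.
rewrite innerDl innerZl; congr (_ + _ * _).
rewrite {1}/inner mulmxKV// mxE !inner_mx_pder.
rewrite (eq_bigr (fun l => \sum_i \sum_j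
    (pder E (fun y => G y j l) i (F x) * J a i * J b j * nu 0 l +
     pder E (fun y => G y i l) j (F x) * J a i * J b j * nu 0 l -
     pder E (fun y => G y i j) l (F x) * J a i * J b j * nu 0 l))); last first.
  move=> l _; rewrite mxE [nu^T _ _]mxE mulr_suml; apply: eq_bigr => i _.
  by rewrite mulr_suml; apply: eq_bigr => j _; ring.
have -> (A B C : 'I_q -> 'I_q -> 'I_q -> R) :
  \sum_l \sum_i \sum_j (A l i j + B l i j - C l i j) =
  \sum_l \sum_i \sum_j A l i j + \sum_l \sum_i \sum_j B l i j
  - \sum_l \sum_i \sum_j C l i j.
  rewrite -big_split -sumrB; apply: eq_bigr => l _.
  rewrite -big_split -sumrB; apply: eq_bigr => i _.
  by rewrite -big_split -sumrB.
congr (_ + _ - _).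
- rewrite exchange_big /=; apply: eq_bigr => i _.
  rewrite exchange_big /=; apply: eq_bigr => j _; apply: eq_bigr => l _.
  by rewrite ![row _ _ _ _]mxE; ring.
- under eq_bigr do rewrite exchange_big /=.
  rewrite exchange_big /=; apply: eq_bigr => j _.
  rewrite exchange_big /=; apply: eq_bigr => i _; apply: eq_bigr => l _.
  by rewrite ![row _ _ _ _]mxE; ring.
- apply: eq_bigr => l _; apply: eq_bigr => i _; apply: eq_bigr => j _.
  by rewrite ![row _ _ _ _]mxE; ring.
Qed.

Lemma mean_curvatureE x nu : (G (F x))^T = G (F x) -> G (F x) \in unitmx ->
  mean_curvature D E G F x nu =
  \tr (invmx (jac D F x *m G (F x) *m (jac D F x)^T) *m koszul_ff D E G F x nu).
Proof. by move=> sG uG; rewrite /mean_curvature second_ffE. Qed.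

End Koszul.

Definition mx_is_pder (R : realType) (q m n : nat) (E : set 'rV[R]_q)
    (A : 'rV[R]_q -> 'M[R]_(m, n)) (k : 'I_q) (y : 'rV[R]_q)
    (L : 'M[R]_(m, n)) : Prop :=
  forall i j, is_pder E (fun z => A z i j) k y (L i j).

Section MatrixDerivative.
Variables (R : realType) (q : nat).
Local Notation H := (halfspace R q).

Lemma mx_is_pderM m n p (A : 'rV[R]_q.+1 -> 'M[R]_(m, n))
    (B : 'rV[R]_q.+1 -> 'M[R]_(n, p)) k y LA LB :
  mx_is_pder H A k y LA -> mx_is_pder H B k y LB ->
  mx_is_pder H (fun z => A z *m B z) k y (LA *m B y + A y *m LB).
Proof.
move=> hA hB i j.
rewrite (_ : (fun z => _) = fun z => \sum_l A z i l * B z l j); last first.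
  by apply/funext => z; rewrite mxE.
by rewrite !mxE -big_split; apply: is_pder_sum => l _; exact: is_pderM.
Qed.

Lemma mx_is_pder_tr m n (A : 'rV[R]_q.+1 -> 'M[R]_(m, n)) k y L :
  mx_is_pder H A k y L -> mx_is_pder H (fun z => (A z)^T) k y L^T.
Proof.
move=> hA i j; rewrite mxE (_ : (fun z => _) = fun z => A z j i)//.
by apply/funext => z; rewrite mxE.
Qed.

Lemma mx_is_pder_mx_pder m n (A : 'rV[R]_q.+1 -> 'M[R]_(m, n)) y L xi : H y ->
  (forall k, mx_is_pder H A k y (L k)) ->
  mx_pder H A y xi = \sum_k xi 0 k *: L k.
Proof.
move=> Hy hA; apply: eq_bigr => k _; congr (_ *: _).
by apply/matrixP => i j; rewrite mxE (is_pder_pder Hy (hA k i j)).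
Qed.

Lemma Ckmx_is_pder m n l (U : set 'rV[R]_q.+1) (A : 'rV[R]_q.+1 -> 'M[R]_(m, n)) k y :
  Ckmx l.+1 U A -> U y ->
  mx_is_pder H A k y (\matrix_(i, j) pder H (fun z => A z i j) k y).
Proof. by move=> CA Uy i j; rewrite mxE; exact: Ck_is_pder (CA i j) Uy. Qed.

Lemma mx_pderDr m n (E : set 'rV[R]_q.+1) (A : 'rV[R]_q.+1 -> 'M[R]_(m, n)) y xi eta :
  mx_pder E A y (xi + eta) = mx_pder E A y xi + mx_pder E A y eta.
Proof. by rewrite -big_split; apply: eq_bigr => k _; rewrite mxE scalerDl. Qed.

Lemma mx_pderZr m n (E : set 'rV[R]_q.+1) (A : 'rV[R]_q.+1 -> 'M[R]_(m, n)) y c xi :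
  mx_pder E A y (c *: xi) = c *: mx_pder E A y xi.
Proof. by rewrite scaler_sumr; apply: eq_bigr => k _; rewrite mxE scalerA. Qed.

Lemma mx_pder_eq_near m n (E : set 'rV[R]_q.+1) (A B : 'rV[R]_q.+1 -> 'M[R]_(m, n)) y xi :
  A y = B y -> (\forall z \near within E (nbhs y), A z = B z) ->
  mx_pder E A y xi = mx_pder E B y xi.
Proof.
move=> AB nAB; apply: eq_bigr => k _; congr (_ *: _).
apply/matrixP => i j; rewrite !mxE; apply: pder_eq_near; first by rewrite AB.
by apply: filterS nAB => z ->.
Qed.

End MatrixDerivative.

(** * Conformal change of the mean curvature *)

Definition diff1 (R : realType) (q : nat) (D : set 'rV[R]_q)
    (r : 'rV[R]_q -> R) (y xi : 'rV[R]_q) : R :=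
  \sum_k xi 0 k * pder D r k y.

Section ConformalChange.
Variables (R : realType) (p q : nat) (D : set 'rV[R]_p).
Local Notation H := (halfspace R q).
Variables (F : 'rV[R]_p -> 'rV[R]_q.+1) (x : 'rV[R]_p).
Variables (r : 'rV[R]_q.+1 -> R) (Gp Gb : 'rV[R]_q.+1 -> 'M[R]_q.+1).
Hypotheses (HF : H (F x)) (r0 : r (F x) != 0).
Hypothesis Gb_near : \forall y \near within H (nbhs (F x)), Gb y = r y ^+ 2 *: Gp y.
Hypothesis Gb_at : Gb (F x) = r (F x) ^+ 2 *: Gp (F x).
Hypothesis dr : forall k, pderivable H r k (F x).
Hypothesis dGp : forall i j k, pderivable H (fun y => Gp y i j) k (F x).
Let J := jac D F x.

Lemma mx_pder_conformal xi : mx_pder H Gb (F x) xi =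
  (2 * r (F x) * diff1 H r (F x) xi) *: Gp (F x)
  + r (F x) ^+ 2 *: mx_pder H Gp (F x) xi.
Proof.
rewrite (mx_pder_eq_near xi Gb_at Gb_near).
rewrite (@mx_is_pder_mx_pder _ _ _ _ _ _ (fun k => (2 * r (F x) * pder H r k (F x)) *: Gp (F x)
  + r (F x) ^+ 2 *: \matrix_(i, j) pder H (fun y => Gp y i j) k (F x)))//.
  rewrite /diff1 mulr_sumr scaler_suml scaler_sumr -big_split; apply: eq_bigr => k _ /=.
  by rewrite scalerDr !scalerA; congr (_ *: _ + _ *: _); ring.
move=> k i j.
have := is_pderM (is_pderM (pderivableP (@dr k)) (pderivableP (@dr k)))
                 (pderivableP (@dGp i j k)).
rewrite !mxE (_ : (fun y => r y * r y * Gp y i j) = fun y => (r y ^+ 2 *: Gp y) i j).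
  by congr is_pder; rewrite expr2; ring.
by apply/funext => y; rewrite mxE.
Qed.

Hypotheses (fJ : row_free J) (pG : posdef (Gp (F x))).
Variable nu : 'rV[R]_q.+1.
Hypothesis nnu : normal (Gp (F x)) J nu.

(** Koszul's formula changes by the derivatives of the factor r^2. Those along
    the hypersurface come with an inner product of nu with a tangent vector, which
    is zero; the remaining one, along nu, multiplies the induced metric, whose
    trace is the dimension. The two sides have the same weight because nu is not
    normalized. *)
Lemma mean_curvature_conformal : mean_curvature D H Gb F x nu =
  mean_curvature D H Gp F x nu - p%:R * ((r (F x))^-1 * diff1 H r (F x) nu).
Proof.
have r2 : 0 < r (F x) ^+ 2 by rewrite exprn_even_gt0.
have pGb : posdef (Gb (F x)) by rewrite Gb_at; exact: posdefZ.
rewrite !mean_curvatureE ?posdef_unit ?posdef_sym//.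
set S := koszul_ff D H Gp F x nu; set A := J *m Gp (F x) *m J^T.
have -> : koszul_ff D H Gb F x nu
    = r (F x) ^+ 2 *: S - (r (F x) * diff1 H r (F x) nu) *: A.
  apply/matrixP => a b.
  have -> (c e : R) : (c *: S - e *: A) a b = c * S a b - e * A a b by rewrite !mxE.
  rewrite /S /koszul_ff /koszul [LHS]mxE [X in _ = _ * X - _]mxE !mx_pder_conformal Gb_at -inner_row.
  rewrite !innerDm !innerZm !(normal_row _ nnu).
  by field.
rewrite -/J Gb_at -scalemxAr -scalemxAl -/A.
have uA : A \in unitmx by apply: posdef_unit; exact: posdef_gram.
rewrite invmxZ; last by rewrite unitmxZ ?unitfE ?gt_eqF.
rewrite -scalemxAl mulmxBr -!scalemxAr mulVmx// mxtraceZ raddfB /= !mxtraceZ mxtrace1.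
by field.
Qed.

End ConformalChange.

(** * Invariance of the mean curvature under changes of coordinates *)

Section SecondChain.
Variables (R : realType) (p p' q : nat).
Local Notation H := (halfspace R p).
Local Notation H' := (halfspace R p').
Variables (U : set 'rV[R]_p.+1) (V : set 'rV[R]_p'.+1).
Hypotheses (oU : relopen U) (oV : relopen V).
Variables (F : 'rV[R]_p.+1 -> 'rV[R]_p'.+1) (psi : 'rV[R]_p'.+1 -> 'rV[R]_q).
Hypothesis UV : forall x, U x -> V (F x).
Hypothesis CF : forall i, Ck 2 U (fun x => F x 0 i).
Hypothesis Cpsi : forall i, Ck 2 V (fun x => psi x 0 i).

Lemma pder_compE k b y : U y -> pder H (fun z => psi (F z) 0 k) b y =
  \sum_c pder H (fun z => F z 0 c) b y * pder H' (fun z => psi z 0 k) c (F y).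
Proof.
move=> Uy; have [Hy _] := oU Uy; apply: (is_pder_pder Hy).
exact: (pder_comp oU oV UV CF (Cpsi k) Uy).
Qed.

Lemma jac_comp x : U x ->
  jac H (fun y => psi (F y)) x = jac H F x *m jac H' psi (F x).
Proof.
move=> Ux; apply/matrixP => a k; rewrite !mxE pder_compE//.
by apply: eq_bigr => c _; rewrite !mxE.
Qed.

Lemma hess_comp x a b : U x ->
  hess H (fun y => psi (F y)) a b x =
  \sum_d \sum_c (jac H F x a d * jac H F x b c) *: hess H' psi d c (F x)
  + hess H F a b x *m jac H' psi (F x).
Proof.
move=> Ux; have [Hx _] := oU Ux; apply/rowP => k; rewrite [LHS]mxE.
have -> : pder H (pder H (fun y => psi (F y) 0 k) b) a x =
    pder H (fun y => \sum_c pder H (fun z => F z 0 c) b y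
              * pder H' (fun z => psi z 0 k) c (F y)) a x.
  by apply: pder_eq_near; [exact: pder_compE|exact: (relopen_eq_near oU) (@pder_compE k b) Ux].
have -> := is_pder_pder Hx (@is_pder_sum _ _ _ _ _ _ _ _ _ (fun c =>
   pder H (pder H (fun z => F z 0 c) b) a x * pder H' (fun z => psi z 0 k) c (F x)
   + pder H (fun z => F z 0 c) b x * \sum_d pder H (fun z => F z 0 d) a x
       * pder H' (pder H' (fun z => psi z 0 k) c) d (F x)) _).
  rewrite big_split /= addrC mxE; congr (_ + _).
    rewrite summxE; under [RHS]eq_bigr do rewrite summxE.
    rewrite [RHS]exchange_big /=; apply: eq_bigr => c _; rewrite mulr_sumr.
    by apply: eq_bigr => d _; rewrite !mxE; ring.
  by rewrite mxE; apply: eq_bigr => c _; rewrite !mxE.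
move=> c _; apply: is_pderM; first exact: Ck_is_pder (Ck_pder b (CF c)) Ux.
exact: (pder_comp oU oV UV CF (Ck_pder c (Cpsi k)) Ux).
Qed.

End SecondChain.

Lemma bilinear_rows (R : realType) (p p' q : nat) (B : 'rV[R]_q -> 'rV[R]_q -> R)
    (A : 'M[R]_(p, p')) (J : 'M[R]_(p', q)) a b :
  (forall u v w, B (u + v) w = B u w + B v w) ->
  (forall c u w, B (c *: u) w = c * B u w) ->
  (forall u v w, B w (u + v) = B w u + B w v) ->
  (forall c u w, B w (c *: u) = c * B w u) ->
  B (row a (A *m J)) (row b (A *m J)) =
  (A *m (\matrix_(d, c) B (row d J) (row c J)) *m A^T) a b.
Proof.
move=> BDl BZl BDr BZr.
have B0l w : B 0 w = 0 by rewrite -(scale0r 0) BZl mul0r.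
have B0r w : B w 0 = 0 by rewrite -(scale0r 0) BZr mul0r.
have Bl (I : Type) (s : seq I) (u : I -> 'rV[R]_q) w :
    B (\sum_(i <- s) u i) w = \sum_(i <- s) B (u i) w.
  by elim: s => [|i s IH]; rewrite ?big_nil// !big_cons BDl IH.
have Br (I : Type) (s : seq I) (u : I -> 'rV[R]_q) w :
    B w (\sum_(i <- s) u i) = \sum_(i <- s) B w (u i).
  by elim: s => [|i s IH]; rewrite ?big_nil// !big_cons BDr IH.
have rowE' c : row c (A *m J) = \sum_d A c d *: row d J.
  rewrite row_mul mulmx_sum_row; apply: eq_bigr => d _; by rewrite mxE.
rewrite !rowE' Bl [RHS]mxE.
rewrite (eq_bigr (fun d => \sum_c A a d * A b c * B (row d J) (row c J))); last first.
  by move=> d _; rewrite BZl Br mulr_sumr; apply: eq_bigr => c _; rewrite BZr mulrA.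
rewrite exchange_big /=; apply: eq_bigr => c _.
rewrite mxE [A^T c b]mxE mulr_suml; apply: eq_bigr => d _.
by rewrite mxE; ring.
Qed.

Lemma koszul_rows (R : realType) (p p' q : nat) (E : set 'rV[R]_q.+1)
    (G : 'rV[R]_q.+1 -> 'M[R]_q.+1) y nu (A : 'M[R]_(p, p')) (J : 'M[R]_(p', q.+1)) a b :
  koszul E G y nu (row a (A *m J)) (row b (A *m J)) =
  (A *m (\matrix_(d, c) koszul E G y nu (row d J) (row c J)) *m A^T) a b.
Proof.
apply: bilinear_rows => [u v w|c u w|u v w|c u w]; rewrite /koszul.
- by rewrite mx_pderDr innerDm !innerDl; ring.
- by rewrite mx_pderZr innerZm !innerZl; ring.
- by rewrite mx_pderDr innerDm !innerDl !innerDr; ring.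
- by rewrite mx_pderZr innerZm !innerZl !innerZr; ring.
Qed.

Lemma trace_congruence (R : realType) (n : nat) (A B S : 'M[R]_n) :
  A \in unitmx -> B \in unitmx ->
  \tr (invmx (A *m B *m A^T) *m (A *m S *m A^T)) = \tr (invmx B *m S).
Proof.
move=> uA uB; have uAT : A^T \in unitmx by rewrite unitmx_tr.
have -> : invmx (A *m B *m A^T) = invmx A^T *m invmx B *m invmx A.
  have uABA : A *m B *m A^T \in unitmx by rewrite !unitmx_mul uA uB.
  rewrite -[RHS](mulKmx uABA); rewrite -!mulmxA (mulmxA A^T) mulmxV// mul1mx.
  by rewrite (mulmxA B) mulmxV// mul1mx mulmxV// mulmx1.
rewrite -!mulmxA mxtrace_mulC -!mulmxA mulmxV// mulmx1.
by rewrite mulKmx.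
Qed.

Section Reparametrization.
Variables (R : realType) (p q : nat).
Local Notation H := (halfspace R p).
Variables (U V : set 'rV[R]_p.+1).
Hypotheses (oU : relopen U) (oV : relopen V).
Variables (F : 'rV[R]_p.+1 -> 'rV[R]_q.+1) (phi : 'rV[R]_p.+1 -> 'rV[R]_p.+1).
Hypothesis VU : forall x, V x -> U (phi x).
Hypothesis CF : forall i, Ck 2 U (fun x => F x 0 i).
Hypothesis Cphi : forall i, Ck 2 V (fun x => phi x 0 i).
Variables (E : set 'rV[R]_q.+1) (G : 'rV[R]_q.+1 -> 'M[R]_q.+1).

Lemma mean_curvature_reparam x nu : V x -> posdef (G (F (phi x))) ->
  row_free (jac H F (phi x)) -> jac H phi x \in unitmx ->
  normal (G (F (phi x))) (jac H F (phi x)) nu ->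
  mean_curvature H E G (fun y => F (phi y)) x nu
  = mean_curvature H E G F (phi x) nu.
Proof.
move=> Vx pG fJ uP nnu.
have sG := posdef_sym pG; have uG := posdef_unit pG.
rewrite (@mean_curvatureE _ _ _ H E G F (phi x) nu sG uG).
rewrite (@mean_curvatureE _ _ _ H E G (fun y => F (phi y)) x nu sG uG).
set A := jac H phi x in uP *; set J := jac H F (phi x) in fJ nnu *.
have JE : jac H (fun y => F (phi y)) x = A *m J by exact: (jac_comp oV oU VU Cphi CF Vx).
set S := koszul_ff H E G F (phi x) nu.
have -> : koszul_ff H E G (fun y => F (phi y)) x nu = A *m S *m A^T.
  pose hJ := \matrix_(d, c) inner (G (F (phi x))) (hess H F d c (phi x)) nu.
  have -> : S = hJ + \matrix_(d, c) koszul E G (F (phi x)) nu (row d J) (row c J).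
    by apply/matrixP => d c; rewrite !mxE.
  rewrite mulmxDr mulmxDl; apply/matrixP => a b; rewrite [LHS]mxE [RHS]mxE JE; congr (_ + _).
    rewrite (hess_comp oV oU VU Cphi CF a b Vx) innerDl normal_inner// addr0.
    rewrite inner_suml [RHS]mxE.
    under eq_bigr do rewrite inner_suml.
    rewrite exchange_big /=; apply: eq_bigr => c _.
    rewrite [(A *m hJ) a c]mxE [A^T c b]mxE mulr_suml; apply: eq_bigr => d _.
    by rewrite innerZl [hJ d c]mxE -/A; ring.
  exact: koszul_rows.
rewrite JE !trmx_mul.
have uS : J *m G (F (phi x)) *m J^T \in unitmx by apply: posdef_unit; exact: posdef_gram.
have -> : A *m J *m G (F (phi x)) *m (J^T *m A^T) = A *m (J *m G (F (phi x)) *m J^T) *m A^T.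
  by rewrite !mulmxA.
by rewrite trace_congruence.
Qed.

End Reparametrization.

Section TargetChange.
Variables (R : realType) (p q : nat).
Local Notation H := (halfspace R p).
Local Notation Hq := (halfspace R q).
Variables (U : set 'rV[R]_p.+1) (V V' : set 'rV[R]_q.+1).
Hypotheses (oU : relopen U) (oV : relopen V) (oV' : relopen V').
Variables (F : 'rV[R]_p.+1 -> 'rV[R]_q.+1) (psi : 'rV[R]_q.+1 -> 'rV[R]_q.+1).
Hypothesis UV : forall x, U x -> V (F x).
Hypothesis VV' : forall y, V y -> V' (psi y).
Hypothesis CF : forall i, Ck 2 U (fun x => F x 0 i).
Hypothesis Cpsi : forall i, Ck 2 V (fun x => psi x 0 i).
Variables (G G' : 'rV[R]_q.+1 -> 'M[R]_q.+1).
Hypothesis CG' : Ckmx 1 V' G'.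
Hypothesis GG' : forall y, V y ->
  G y = jac Hq psi y *m G' (psi y) *m (jac Hq psi y)^T.

Let dP y := mx_pder Hq (jac Hq psi) y.

Lemma Ckmx_jac_psi : Ckmx 1 V (jac Hq psi).
Proof.
by move=> i j; apply: Ck_eq (Ck_pder i (Cpsi j)) => // x _; rewrite mxE.
Qed.

Lemma jac_pder_hess (m : nat) (A : 'M[R]_(m, q.+1)) a b y :
  row b A *m dP y (row a A) =
  \sum_d \sum_c (A a d * A b c) *: hess Hq psi d c y.
Proof.
apply/rowP => j; rewrite mxE summxE.
under [RHS]eq_bigr do rewrite summxE.
rewrite [RHS]exchange_big /=; apply: eq_bigr => c _.
rewrite !mxE summxE mulr_sumr; apply: eq_bigr => d _.
rewrite !mxE (_ : (fun z => jac Hq psi z c j) = pder Hq (fun z => psi z 0 j) c).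
  by ring.
by apply/funext => z; rewrite mxE.
Qed.

Lemma jac_pder_sym y u v : V y -> u *m dP y v = v *m dP y u.
Proof.
move=> Vy.
have E (w w' : 'rV[R]_q.+1) : w *m dP y w' = \sum_d \sum_c (w' 0 d * w 0 c) *: hess Hq psi d c y.
  pose A : 'M[R]_(2, q.+1) := \matrix_(i, j) (if i == 0 then w' 0 j else w 0 j).
  have r0 : row 0 A = w' by apply/rowP => j; rewrite !mxE.
  have r1 : row 1 A = w by apply/rowP => j; rewrite !mxE.
  rewrite -{1}r0 -{1}r1 jac_pder_hess; apply: eq_bigr => d _; apply: eq_bigr => c _.
  by rewrite !mxE.
have S c d : hess Hq psi d c y = hess Hq psi c d y.
  by apply/rowP => j; rewrite [LHS]mxE [RHS]mxE; exact: pder_comm oV (Cpsi j) Vy.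
rewrite (E u v) (E v u) exchange_big; apply: eq_bigr => d _; apply: eq_bigr => c _.
by rewrite (S d c) mulrC.
Qed.

Lemma mx_pder_pullback y xi : V y -> mx_pder Hq G y xi =
  dP y xi *m G' (psi y) *m (jac Hq psi y)^T
  + jac Hq psi y *m mx_pder Hq G' (psi y) (xi *m jac Hq psi y) *m (jac Hq psi y)^T
  + jac Hq psi y *m G' (psi y) *m (dP y xi)^T.
Proof.
move=> Vy; have [Hy _] := oV Vy.
set P := jac Hq psi y.
rewrite (mx_pder_eq_near xi (GG' Vy) (relopen_eq_near oV GG' Vy)).
pose L k : 'M[R]_q.+1 := \matrix_(i, j) pder Hq (fun z => jac Hq psi z i j) k y.
pose M k : 'M[R]_q.+1 := \sum_l P k l *: \matrix_(i, j) pder Hq (fun z => G' z i j) l (psi y).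
have dL k : mx_is_pder Hq (jac Hq psi) k y (L k) by exact: Ckmx_is_pder Ckmx_jac_psi Vy.
have dM k : mx_is_pder Hq (fun z => G' (psi z)) k y (M k).
  move=> i j; rewrite summxE; under eq_bigr do rewrite !mxE.
  exact: (pder_comp oV oV' VV' Cpsi (CG' i j) Vy).
rewrite (mx_is_pder_mx_pder xi Hy (fun k =>
  mx_is_pderM (mx_is_pderM (dL k) (dM k)) (mx_is_pder_tr (dL k)))).
have dPE : dP y xi = \sum_k xi 0 k *: L k by [].
have ME : mx_pder Hq G' (psi y) (xi *m P) = \sum_k xi 0 k *: M k.
  rewrite /M; under [RHS]eq_bigr do rewrite scaler_sumr.
  rewrite exchange_big /=; apply: eq_bigr => l _.
  by rewrite mxE scaler_suml; apply: eq_bigr => k _; rewrite scalerA.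
have -> : dP y xi *m G' (psi y) *m P^T = \sum_k xi 0 k *: (L k *m G' (psi y) *m P^T).
  by rewrite dPE !mulmx_suml; apply: eq_bigr => k _; rewrite -!scalemxAl.
rewrite ME; have -> : P *m (\sum_k xi 0 k *: M k) *m P^T = \sum_k xi 0 k *: (P *m M k *m P^T).
  rewrite mulmx_sumr mulmx_suml; apply: eq_bigr => k _.
  by rewrite -scalemxAr -scalemxAl.
have -> : P *m G' (psi y) *m (dP y xi)^T = \sum_k xi 0 k *: (P *m G' (psi y) *m (L k)^T).
  rewrite dPE linear_sum mulmx_sumr; apply: eq_bigr => k _.
  by rewrite linearZ -scalemxAr.
rewrite -!big_split; apply: eq_bigr => k _ /=.
by rewrite mulmxDl !scalerDr.
Qed.

(** In Koszul's formula the second derivatives of the change of coordinates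
    contribute, because of their symmetry, a single term; it is the one which
    transforms the second derivatives of the immersion. *)
Lemma mean_curvature_target x nu : U x -> posdef (G (F x)) ->
  posdef (G' (psi (F x))) ->
  mean_curvature H Hq G F x nu =
  mean_curvature H Hq G' (fun z => psi (F z)) x (nu *m jac Hq psi (F x)).
Proof.
move=> Ux pG pG'; have Vy := UV Ux.
have sG := posdef_sym pG; have uG := posdef_unit pG.
have sG' := posdef_sym pG'; have uG' := posdef_unit pG'.
rewrite (@mean_curvatureE _ _ _ H Hq G F x nu sG uG).
rewrite (@mean_curvatureE _ _ _ H Hq G' (fun z => psi (F z)) x _ sG' uG').
have JE := jac_comp oU oV UV CF Cpsi Ux.
have EG := GG' Vy.
set P := jac Hq psi (F x) in JE EG *; set J := jac H F x in JE *.
congr (\tr (invmx _ *m _)).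
  by rewrite JE EG trmx_mul !mulmxA.
apply/matrixP => a b; rewrite [LHS]mxE [RHS]mxE /koszul JE !row_mul -/J.
rewrite (hess_comp oU oV UV CF Cpsi a b Ux) -/P -/J -jac_pder_hess.
rewrite innerDl !mx_pder_pullback// -/P !innerDm EG !inner_mul.
have t1 (B : 'M[R]_q.+1) u w : inner (B *m G' (psi (F x)) *m P^T) u w
    = inner (G' (psi (F x))) (u *m B) (w *m P).
  by rewrite /inner trmx_mul !mulmxA.
have t2 (B : 'M[R]_q.+1) u w : inner (P *m G' (psi (F x)) *m B^T) u w
    = inner (G' (psi (F x))) (u *m P) (w *m B).
  by rewrite /inner trmx_mul !mulmxA.
rewrite !t1 !t2.
rewrite (jac_pder_sym nu (row a J) Vy) (jac_pder_sym nu (row b J) Vy).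
rewrite (jac_pder_sym (row a J) (row b J) Vy).
rewrite (innerC (row b J *m P) _ sG').
by field.
Qed.

End TargetChange.

Lemma pder_eq_relopen (R : realType) (d : nat) (U : set 'rV[R]_d.+1)
    (f g : 'rV[R]_d.+1 -> R) a x : relopen U -> (forall y, U y -> f y = g y) ->
  U x -> pder (halfspace R d) f a x = pder (halfspace R d) g a x.
Proof.
by move=> oU fg Ux; apply: pder_eq_near (fg _ Ux) (relopen_eq_near oU fg Ux).
Qed.

Lemma mean_curvature_eq (R : realType) (p q : nat) (U : set 'rV[R]_p.+1)
    (E : set 'rV[R]_q) (G : 'rV[R]_q -> 'M[R]_q) (F F' : 'rV[R]_p.+1 -> 'rV[R]_q) x nu :
  relopen U -> (forall y, U y -> F y = F' y) -> U x ->
  mean_curvature (halfspace R p) E G F x nu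
  = mean_curvature (halfspace R p) E G F' x nu.
Proof.
move=> oU FF Ux.
have d1 b k y : U y -> pder (halfspace R p) (fun y => F y 0 k) b y
   = pder (halfspace R p) (fun y => F' y 0 k) b y.
  by move=> Uy; apply: (pder_eq_relopen _ oU _ Uy) => z Uz; rewrite FF.
have JJ : jac (halfspace R p) F x = jac (halfspace R p) F' x.
  by apply/matrixP => a k; rewrite !mxE d1.
rewrite /mean_curvature JJ (FF x Ux); congr (\tr (_ *m _)).
apply/matrixP => a b; rewrite [LHS]mxE [RHS]mxE (FF x Ux); congr (inner _ _ _).
apply/rowP => k; rewrite [LHS]mxE [RHS]mxE JJ (FF x Ux); congr (_ + _).
exact: (pder_eq_relopen _ oU (d1 b k) Ux).
Qed.

(** * Behaviour at the boundary of the half-space *)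

Lemma relopen_interior (R : realType) (d : nat) (U : set 'rV[R]_d.+1) :
  relopen U -> relopen [set x | U x /\ 0 < x 0 ord0].
Proof.
move=> oU x [Ux x0]; have [Hx nU] := oU x Ux; split=> //.
have c0 : (fun z : 'rV[R]_d.+1 => z 0 ord0) @ within (halfspace R d) (nbhs x) --> x 0 ord0.
  exact: (cvg_comp _ _ (@cvg_within _ _ _ (halfspace R d)) (@coord_continuous R 1 d.+1 0 ord0 x)).
have z0 : \forall z \near within (halfspace R d) (nbhs x), 0 < (z : 'rV[R]_d.+1) 0 ord0.
  exact: (cvgr_gt _ c0 _ x0).
by apply: filterS2 nU z0 => z Uz z0'.
Qed.

Section Boundary.
Variables (R : realType) (d : nat) (V : set 'rV[R]_d.+1).
Hypothesis oV : relopen V.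
Local Notation H := (halfspace R d).

Lemma increments_pos y : H y -> y 0 ord0 = 0 ->
  \forall h \near increments H ord0 y, 0 < (y + h *: delta_mx 0 ord0) 0 ord0.
Proof.
move=> Hy y0.
apply: filterS2 (increments_neq0 H ord0 y) (increments_in H ord0 y) => h h0 Hh.
have {}Hh : 0 <= (y + h *: delta_mx 0 ord0) 0 ord0 by exact: Hh.
by rewrite lt_neqAle Hh andbT eq_sym deltaE y0 eqxx mulr1 add0r.
Qed.

Lemma increments_rel a y : V y ->
  \forall h \near increments H a y, V (y + h *: delta_mx 0 a).
Proof. by move=> /oV[_ nV]; exact: (increments_pt a nV). Qed.

Lemma cvg_increments k (f : 'rV[R]_d.+1 -> R) a y : Ck k V f -> V y ->
  (fun h => f (y + h *: delta_mx 0 a)) @ increments H a y --> f y.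
Proof.
by move=> Cf Vy; exact: (cvg_comp _ _ (@increments_pt _ _ _ a y) (Ck_continuous oV Cf Vy)).
Qed.

Lemma boundary_extension k (f g : 'rV[R]_d.+1 -> R) : Ck k V f -> Ck k V g ->
  (forall y, V y -> 0 < y 0 ord0 -> f y = g y) -> forall y, V y -> f y = g y.
Proof.
move=> Cf Cg fg y Vy; have [Hy _] := oV Vy.
have : 0 <= y 0 ord0 by exact: Hy.
rewrite le_eqVlt => /predU1P[/esym y0|]; last exact: fg.
have PF := increments_proper ord0 Hy.
apply: (cvg_unique _ (cvg_increments ord0 Cf Vy)) => //.
apply: (near_cvg _ (cvg_increments ord0 Cg Vy)) => //.
apply: filterS2 (increments_pos Hy y0) (increments_rel ord0 Vy) => h h0 Vh.
by rewrite fg.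
Qed.

Lemma pder_boundary f a y : (forall z, V z -> z 0 ord0 = 0 -> f z = 0) ->
  V y -> y 0 ord0 = 0 -> a != ord0 -> pder H f a y = 0.
Proof.
move=> f0 Vy y0 a0; have [Hy _] := oV Vy; apply: (is_pder_pder Hy).
apply: (near_cvg _ (cvg_cst 0)) => //.
apply: filterS (increments_rel a Vy) => h Vh.
rewrite /diffquot !f0 ?subrr ?mulr0//.
by rewrite deltaE y0 eq_sym (negbTE a0) mulr0 addr0.
Qed.

Lemma diff1_boundary f y xi : (forall z, V z -> z 0 ord0 = 0 -> f z = 0) ->
  V y -> y 0 ord0 = 0 -> diff1 H f y xi = xi 0 ord0 * pder H f ord0 y.
Proof.
move=> f0 Vy y0; rewrite /diff1 (bigD1 ord0)//= big1 ?addr0// => a a0.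
by rewrite (pder_boundary f0)// mulr0.
Qed.

End Boundary.

(** * Compactifications of a metric in coordinates *)

(** The order k of differentiability is a parameter because special
    compactifications, of class C^1, are compared with smoother ones. *)
Record local_compactification (R : realType) (q k : nat) (V : set 'rV[R]_q.+1)
    (Gp : 'rV[R]_q.+1 -> 'M[R]_q.+1) (r : 'rV[R]_q.+1 -> R)
    (G : 'rV[R]_q.+1 -> 'M[R]_q.+1) : Prop := LocalCompactification {
  lc_fun : Ck k V r;
  lc_metric : Ckmx k V G;
  lc_posdef : forall y, V y -> posdef (G y);
  lc_pos : forall y, V y -> 0 < y 0 ord0 -> 0 < r y;
  lc_zero : forall y, V y -> y 0 ord0 = 0 -> r y = 0;
  lc_conformal : forall y, V y -> 0 < y 0 ord0 -> G y = r y ^+ 2 *: Gp y;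
  lc_diff : forall y, V y -> y 0 ord0 = 0 -> pder (halfspace R q) r ord0 y != 0 }.

Section Compactification.
Variables (R : realType) (q : nat) (V : set 'rV[R]_q.+1).
Hypothesis oV : relopen V.
Variable Gp : 'rV[R]_q.+1 -> 'M[R]_q.+1.
Local Notation H := (halfspace R q).

Lemma posdef_diag (G : 'M[R]_q.+1) i : posdef G -> 0 < G i i.
Proof.
move=> [_ pG]; have := pG (delta_mx 0 i); rewrite /inner -rowE trmx_delta -colE !mxE.
apply; apply/eqP => /rowP/(_ i); rewrite !mxE !eqxx => /eqP; by rewrite oner_eq0.
Qed.

Lemma local_compactification_le k l r G : (l <= k)%N ->
  local_compactification k V Gp r G -> local_compactification l V Gp r G.
Proof.
move=> lk [Cr CG a b c e f].
by split; [exact: Ck_le Cr|move=> i j; exact: Ck_le (CG i j)| | | | |].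
Qed.

Section OneMetric.
Variables (k : nat) (r : 'rV[R]_q.+1 -> R) (G : 'rV[R]_q.+1 -> 'M[R]_q.+1).
Hypothesis C : local_compactification k.+1 V Gp r G.

Lemma lc_posdef_interior y : V y -> 0 < y 0 ord0 -> posdef (Gp y).
Proof.
move=> Vy y0; have r0 := lc_pos C Vy y0.
have -> : Gp y = (r y ^+ 2)^-1 *: G y.
  by rewrite (lc_conformal C Vy y0) scalerA mulVf ?scale1r// expf_neq0// gt_eqF.
by apply: posdefZ (lc_posdef C Vy); rewrite invr_gt0 exprn_gt0.
Qed.

Lemma lc_diff1 y xi : V y -> y 0 ord0 = 0 ->
  diff1 H r y xi = xi 0 ord0 * pder H r ord0 y.
Proof. by move=> Vy y0; apply: (diff1_boundary oV) => // z; exact: (lc_zero C). Qed.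

Lemma inner_gradient y xi : V y ->
  inner (G y) (gradient H G r y) xi = diff1 H r y xi.
Proof.
move=> Vy; rewrite /inner /gradient mulmxKV ?posdef_unit//; last exact: (lc_posdef C Vy).
by rewrite mxE; apply: eq_bigr => l _; rewrite !mxE mulrC.
Qed.

Lemma lc_normal_boundary p (J : 'M[R]_(p, q.+1)) y nu : V y -> 0 < y 0 ord0 ->
  normal (G y) J nu <-> normal (Gp y) J nu.
Proof.
move=> Vy y0; have r0 := lc_pos C Vy y0; rewrite (lc_conformal C Vy y0).
split; last exact: normalZm.
by apply: normalZmV; rewrite expf_neq0// gt_eqF.
Qed.

End OneMetric.

(** The quotient r / r0 of the defining functions would lose one derivative at the
    boundary; it is instead obtained from the quotient of the metrics, and is
    therefore as regular as they are. *)
Lemma conformal_factor k r G r0 G0 :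
  local_compactification k.+1 V Gp r G -> local_compactification k.+1 V Gp r0 G0 ->
  exists2 u, Ck k.+1 V u & forall y, V y ->
    [/\ 0 < u y, r y = u y * r0 y & G y = u y ^+ 2 *: G0 y].
Proof.
move=> C C0.
pose u y := Num.sqrt (G y ord0 ord0 * (G0 y ord0 ord0)^-1).
have up y : V y -> 0 < G y ord0 ord0 * (G0 y ord0 ord0)^-1.
  move=> Vy; rewrite mulr_gt0 ?invr_gt0//; apply: posdef_diag.
    exact: (lc_posdef C Vy).
  exact: (lc_posdef C0 Vy).
have Cu : Ck k.+1 V u.
  apply: (Ck_sqrt oV) => //; apply: (CkM oV); first exact: (lc_metric C).
  apply: (CkV oV); last exact: (lc_metric C0).
  by move=> y Vy; rewrite gt_eqF//; apply: posdef_diag; exact: (lc_posdef C0 Vy).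
have uint y : V y -> 0 < y 0 ord0 -> u y = r y / r0 y.
  move=> Vy y0; have g := posdef_diag ord0 (lc_posdef_interior C Vy y0).
  have r1 := lc_pos C Vy y0; have r2 := lc_pos C0 Vy y0.
  rewrite /u (lc_conformal C Vy y0) (lc_conformal C0 Vy y0) !mxE.
  rewrite (_ : _ * _ = (r y / r0 y) ^+ 2); last by field; rewrite !gt_eqF.
  by rewrite sqrtr_sqr ger0_norm// divr_ge0// ltW.
exists u => // y Vy; split.
- by rewrite sqrtr_gt0 up.
- have [Hy _] := oV Vy; have : 0 <= y 0 ord0 by exact: Hy.
  rewrite le_eqVlt => /predU1P[/esym y0|y0].
    by rewrite (lc_zero C Vy y0) (lc_zero C0 Vy y0) mulr0.
  by rewrite uint// divfK// gt_eqF// (lc_pos C0).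
- apply/matrixP => i j; rewrite [RHS]mxE.
  apply: (boundary_extension oV (f := fun y => G y i j)
    (g := fun y => u y ^+ 2 * G0 y i j) (lc_metric C i j) _ _ Vy).
    apply: (CkM oV); last exact: (lc_metric C0).
    by rewrite (_ : (fun x => _) = fun x => u x * u x);
      [exact: CkM|apply/funext => x; rewrite expr2].
  move=> {Vy}z Vz z0; rewrite (lc_conformal C Vz z0) (lc_conformal C0 Vz z0) uint// !mxE.
  by have r2 := lc_pos C0 Vz z0; field; rewrite gt_eqF.
Qed.

End Compactification.

(** * Second derivatives of a special defining function *)

Lemma cvg_quotient_min (R : realType) (f : R -> R) (L : R) :
  (fun h => h^-1 * f h) @ 0^' --> L -> (\forall h \near 0^', 0 <= f h) -> L = 0.
Proof.
move=> fL f0; apply/eqP; case: (ltrgtP L 0) => // L0; exfalso.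
- have [e /= e0 eP] : (0 : R)^' [set h | h^-1 * f h < 0 /\ 0 <= f h].
    exact: (filterI (cvgr_lt _ fL _ L0) f0).
  have [||] := eP (e / 2); rewrite /ball_ /=.
  + by rewrite sub0r normrN gtr0_norm ?divr_gt0// ltr_pdivrMr// ltr_pMr// ltr1n.
  + by rewrite gt_eqF// divr_gt0.
  by move=> + f1; rewrite ltNge mulr_ge0// invr_ge0 ltW// divr_gt0.
- have [e /= e0 eP] : (0 : R)^' [set h | 0 < h^-1 * f h /\ 0 <= f h].
    exact: (filterI (cvgr_gt _ fL _ L0) f0).
  have [||] := eP (- (e / 2)); rewrite /ball_ /=.
  + by rewrite sub0r opprK gtr0_norm ?divr_gt0// ltr_pdivrMr// ltr_pMr// ltr1n.
  + by rewrite oppr_eq0 gt_eqF// divr_gt0.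
  by move=> + f1; rewrite ltNge invrN mulNr oppr_le0 mulr_ge0// invr_ge0 ltW// divr_gt0.
Qed.

(** Paths along which second derivatives are taken: the images of the coordinate
    lines of the hypersurface, one-sided at the boundary, and the lines contained
    in the boundary. Nothing is required away from p. *)
Record admissible_path (R : realType) (q : nat) (F : set_system R)
    (gam : R -> 'rV[R]_q.+1) (p v : 'rV[R]_q.+1) : Prop := AdmissiblePath {
  ap_filter : Filter F;
  ap_zero : (fun h => h) @ F --> (0 : R);
  ap_neq0 : \forall h \near F, h != 0;
  ap_in : \forall h \near F, halfspace R q (gam h);
  ap_velocity : forall k, (fun h => h^-1 * (gam h 0 k - p 0 k)) @ F --> v 0 k }.

Section AdmissiblePaths.
Variables (R : realType) (q : nat) (V : set 'rV[R]_q.+1).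
Hypothesis oV : relopen V.
Variables (F : set_system R) (gam : R -> 'rV[R]_q.+1) (p v : 'rV[R]_q.+1).
Hypotheses (Pg : admissible_path F gam p v) (Vp : V p).
Local Notation H := (halfspace R q).

Lemma ap_within : gam @ F --> within H (nbhs p).
Proof.
exact: (@cvg_path_within _ _ _ _ (ap_filter Pg) _ _ (ap_zero Pg) (ap_neq0 Pg)
  (ap_in Pg) (ap_velocity Pg)).
Qed.

Lemma ap_near : \forall h \near F, V (gam h).
Proof. by have [_ nV] := oV Vp; exact: (ap_within nV). Qed.

Lemma ap_cvg k f : Ck k V f -> (fun h => f (gam h)) @ F --> f p.
Proof.
move=> Cf; apply: (cvg_comp _ _ ap_within); exact: (Ck_continuous oV Cf Vp).
Qed.

Lemma ap_diffquot k f : Ck k.+1 V f ->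
  (fun h => h^-1 * (f (gam h) - f p)) @ F --> \sum_l v 0 l * pder H f l p.
Proof.
move=> Cf; apply: (@cvg_diffquot_path _ _ _ _ (ap_filter Pg) _ _ (ap_zero Pg)
  (ap_neq0 Pg) (ap_in Pg) (ap_velocity Pg) V) => //.
exact: Ck_le Cf.
Qed.

End AdmissiblePaths.

Lemma is_pder_path (R : realType) (d q : nat) (U : set 'rV[R]_d.+1)
    (V : set 'rV[R]_q.+1) (F : 'rV[R]_d.+1 -> 'rV[R]_q.+1) k a x :
  relopen U -> relopen V -> (forall y, U y -> V (F y)) ->
  (forall i, Ck k.+1 U (fun y => F y 0 i)) -> U x ->
  admissible_path (increments (halfspace R d) a x)
    (fun h => F (x + h *: delta_mx 0 a)) (F x) (row a (jac (halfspace R d) F x)).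
Proof.
move=> oU oV UV CF Ux; split.
- exact: increments_filter.
- exact: increments_nbhs0.
- exact: increments_neq0.
- exact: (increments_pt a (relopen_map_near oU oV UV Ux)).
- by move=> i; rewrite !mxE; exact: (Ck_is_pder (CF i) Ux).
Qed.

Section WeakHessian.
Variables (R : realType) (q : nat) (V : set 'rV[R]_q.+1).
Hypothesis oV : relopen V.
Variable Gp : 'rV[R]_q.+1 -> 'M[R]_q.+1.
Local Notation H := (halfspace R q).
Variables (r r0 : 'rV[R]_q.+1 -> R) (G G0 : 'rV[R]_q.+1 -> 'M[R]_q.+1).
Hypotheses (C : local_compactification 1 V Gp r G)
  (C0 : local_compactification 2 V Gp r0 G0).

(** Write r = u r0 with u of class C^1, and r0 of class C^2 and zero on the
    boundary. In dr = r0 du + u dr0 the only factor which is not C^1 is du, and it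
    is multiplied by a function which vanishes at p. *)
Lemma weak_hessian p : V p -> p 0 ord0 = 0 -> exists2 Hs : 'M[R]_q.+1, Hs^T = Hs &
  forall F gam v, admissible_path F gam p v -> forall k,
    (fun h => h^-1 * (pder H r k (gam h) - pder H r k p)) @ F
      --> \sum_l v 0 l * Hs k l.
Proof.
move=> Vp p0.
have C0' : local_compactification 1 V Gp r0 G0.
  exact: (@local_compactification_le _ _ _ _ 2).
have [u Cu uE] := conformal_factor oV C C0'.
have Cr0 := lc_fun C0.
pose Hs : 'M[R]_q.+1 := \matrix_(k, l) (pder H u k p * pder H r0 l p
  + pder H u l p * pder H r0 k p + u p * pder H (pder H r0 k) l p).
exists Hs.
  apply/matrixP => k l; rewrite mxE [LHS]mxE [RHS]mxE (pder_comm k l oV Cr0 Vp).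
  by rewrite [X in X + _]addrC.
move=> F gam v Pg k; have FF := ap_filter Pg.
have rk y : V y -> pder H r k y = pder H u k y * r0 y + u y * pder H r0 k y.
  move=> Vy; have [Hy _] := oV Vy.
  rewrite (pder_eq_relopen k oV (g := fun y => u y * r0 y) _ Vy).
    by apply: (is_pder_pder Hy); apply: is_pderM;
      [exact: Ck_is_pder Cu Vy|exact: Ck_is_pder Cr0 Vy].
  by move=> z /uE[].
have l1 := cvgM (ap_cvg oV Pg Vp (Ck_pder k Cu)) (ap_diffquot oV Pg Vp Cr0).
have l2 := cvgM (ap_diffquot oV Pg Vp Cu) (ap_cvg oV Pg Vp (Ck_pder k Cr0)).
have l3 := cvgM (cvg_cst (u p)) (ap_diffquot oV Pg Vp (Ck_pder k Cr0)).
apply: (near_cvg _ (cvgD (cvgD (l1 FF) (l2 FF)) (l3 FF FF))).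
  apply: filterS (ap_near oV Pg Vp) => h Vh.
  by rewrite !fctE /= (rk _ Vh) (rk _ Vp) (lc_zero C0 Vp p0); ring.
rewrite mulr_sumr mulr_suml mulr_sumr -!big_split; apply: eq_bigr => l _ /=.
rewrite [Hs k l]mxE.
have E (a b c d e f t : R) : a * (t * b) + t * c * d + e * (t * f)
  = t * (a * b + c * d + e * f) by ring.
exact: E.
Qed.

Hypothesis unit_gradient : forall y, V y -> y 0 ord0 = 0 ->
  inner (G y) (gradient H G r y) (gradient H G r y) = 1.

(** This is |dr|^2 = 1 differentiated along the boundary. With X the gradient of r,
    the function y |-> |X(y) - X(p)|^2 is nonnegative and vanishes at p, so its
    derivative is zero; and it equals 1 - 2 dr(y)(X(p)) + G(y)(X(p), X(p)), which
    involves neither the inverse metric nor a derivative of X. *)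
Lemma weak_hessian_gradient (p : 'rV[R]_q.+1) (Hs : 'M[R]_q.+1)
    (nu : 'rV[R]_q.+1) : V p -> p 0 ord0 = 0 ->
  (forall F gam v, admissible_path F gam p v -> forall k,
    (fun h => h^-1 * (pder H r k (gam h) - pder H r k p)) @ F
      --> \sum_l v 0 l * Hs k l) ->
  nu 0 ord0 = 0 -> let X := gradient H G r p in
  \sum_k \sum_l X 0 k * nu 0 l * Hs k l = 2^-1 * inner (mx_pder H G p nu) X X.
Proof.
move=> Vp p0 HsP nu0 X.
pose gam h : 'rV[R]_q.+1 := p + h *: nu.
have gam0 h : (gam h) 0 ord0 = 0 by rewrite !mxE nu0 mulr0 p0 addr0.
have Pg : admissible_path (0 : R)^' gam p nu.
  split.
  - exact: dnbhs_filter.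
  - by move=> A A0; exact: nbhs_dnbhs.
  - exact: withinT.
  - by apply: nearW => h; rewrite /halfspace /= gam0.
  - move=> k; apply: (near_cvg _ (cvg_cst (nu 0 k))) => //.
    have : (0 : R)^' [set h : R | h != 0] by exact: withinT.
    by apply: filterS => h h0; rewrite !mxE addrAC subrr add0r mulKf.
pose f h := 1 - 2 * diff1 H r (gam h) X + inner (G (gam h)) X X.
have f0 : \forall h \near (0 : R)^', 0 <= f h.
  apply: filterS (ap_near oV Pg Vp) => h Vh.
  have [sG pG] := lc_posdef C Vh; set Y := gradient H G r (gam h).
  have -> : f h = inner (G (gam h)) (Y - X) (Y - X).
    rewrite innerBl !innerBr /f unit_gradient// (innerC X Y sG).
    by rewrite (inner_gradient C X Vh); ring.
  have [->|YX] := eqVneq (Y - X) 0; first by rewrite inner0l.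
  exact/ltW/pG.
have lim1 : (fun h => \sum_k X 0 k * (h^-1 * (pder H r k (gam h) - pder H r k p)))
   @ (0 : R)^' --> \sum_k X 0 k * (\sum_l nu 0 l * Hs k l).
  by apply: cvg_fsum => k; apply: cvgM; [exact: cvg_cst|exact: HsP Pg k].
have lim2 : (fun h => \sum_i \sum_j X 0 i * (h^-1 * (G (gam h) i j - G p i j)) * X 0 j)
   @ (0 : R)^' --> \sum_i \sum_j X 0 i * (\sum_l nu 0 l * pder H (fun z => G z i j) l p) * X 0 j.
  apply: cvg_fsum => i; apply: cvg_fsum => j; apply: cvgM; last exact: cvg_cst.
  apply: cvgM; first exact: cvg_cst.
  exact: (ap_diffquot oV Pg Vp (lc_metric C i j)).
have /cvg_quotient_min/(_ f0) : (fun h => h^-1 * f h) @ (0 : R)^' -->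
   - 2 * (\sum_k X 0 k * (\sum_l nu 0 l * Hs k l)) +
   \sum_i \sum_j X 0 i * (\sum_l nu 0 l * pder H (fun z => G z i j) l p) * X 0 j.
  apply: (near_cvg _ (cvgD (cvgM (cvg_cst (- 2 : R)) lim1) lim2)) => //.
  apply: nearW => h; rewrite !fctE /=.
  have -> : \sum_k X 0 k * (h^-1 * (pder H r k (gam h) - pder H r k p))
      = h^-1 * (diff1 H r (gam h) X - diff1 H r p X).
    by rewrite /diff1 -sumrB mulr_sumr; apply: eq_bigr => k _; ring.
  have -> : \sum_i \sum_j X 0 i * (h^-1 * (G (gam h) i j - G p i j)) * X 0 j
      = h^-1 * (inner (G (gam h)) X X - inner (G p) X X).
    rewrite !innerE -sumrB mulr_sumr; apply: eq_bigr => i _.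
    by rewrite -sumrB mulr_sumr; apply: eq_bigr => j _; ring.
  rewrite /f -[diff1 H r p X](inner_gradient C X Vp) unit_gradient//; ring.
rewrite inner_mx_pder.
have -> : \sum_k \sum_i \sum_j nu 0 k * (X 0 i * pder H (fun z => G z i j) k p * X 0 j)
  = \sum_i \sum_j X 0 i * (\sum_l nu 0 l * pder H (fun z => G z i j) l p) * X 0 j.
  rewrite exchange_big /=; apply: eq_bigr => i _.
  rewrite exchange_big /=; apply: eq_bigr => j _.
  by rewrite mulr_sumr mulr_suml; apply: eq_bigr => l _; ring.
have -> : \sum_k \sum_l X 0 k * nu 0 l * Hs k l = \sum_k X 0 k * (\sum_l nu 0 l * Hs k l).
  by apply: eq_bigr => k _; rewrite mulr_sumr; apply: eq_bigr => l _; rewrite mulrA.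
by set A := \sum_k _; set B := \sum_i _; lra.
Qed.

End WeakHessian.

(** * The mean curvature of an immersed hypersurface near the boundary *)

Lemma mean_curvature_linear (R : realType) (p q : nat) (D : set 'rV[R]_p)
    (E : set 'rV[R]_q) G F x (nu : 'rV[R]_q) :
  mean_curvature D E G F x nu =
  \sum_l nu 0 l * mean_curvature D E G F x (delta_mx 0 l).
Proof.
have S : second_ff D E G F x nu = \sum_l nu 0 l *: second_ff D E G F x (delta_mx 0 l).
  apply/matrixP => a b; rewrite summxE mxE {1}[nu]row_sum_delta inner_sumr.
  by apply: eq_bigr => l _; rewrite innerZr !mxE.
rewrite /mean_curvature S mulmx_sumr linear_sum /=.
by apply: eq_bigr => l _; rewrite -scalemxAr mxtraceZ.
Qed.

Lemma mean_curvatureZ (R : realType) (p q : nat) (D : set 'rV[R]_p)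
    (E : set 'rV[R]_q) G F x c (nu : 'rV[R]_q) :
  mean_curvature D E G F x (c *: nu) = c * mean_curvature D E G F x nu.
Proof.
rewrite mean_curvature_linear [in RHS]mean_curvature_linear mulr_sumr.
by apply: eq_bigr => l _; rewrite mxE mulrA.
Qed.

Section Immersion.
Variables (R : realType) (p q : nat) (U : set 'rV[R]_p.+1) (V : set 'rV[R]_q.+1).
Hypotheses (oU : relopen U) (oV : relopen V).
Local Notation H := (halfspace R p).
Local Notation H' := (halfspace R q).
Variable F : 'rV[R]_p.+1 -> 'rV[R]_q.+1.
Hypothesis UV : forall x, U x -> V (F x).
Hypothesis fJ : forall x, U x -> row_free (jac H F x).
Variables (k : nat) (G : 'rV[R]_q.+1 -> 'M[R]_q.+1).
Hypothesis pG : forall y, V y -> posdef (G y).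

Lemma Ckmx_jac l : (forall i, Ck l.+1 U (fun x => F x 0 i)) -> Ckmx l U (jac H F).
Proof.
by move=> CF a i; apply: (Ck_eq oU _ (Ck_pder a (CF i))) => x _; rewrite mxE.
Qed.

Lemma Ckmx_comp l m n (A : 'rV[R]_q.+1 -> 'M[R]_(m, n)) :
  (forall i, Ck l U (fun x => F x 0 i)) -> Ckmx l V A ->
  Ckmx l U (fun x => A (F x)).
Proof. by move=> CF CA i j; apply: (Ck_comp oU oV UV CF (CA i j)). Qed.

Lemma Ckmx_gram l : (forall i, Ck l.+1 U (fun x => F x 0 i)) -> Ckmx l V G ->
  Ckmx l U (fun x => jac H F x *m G (F x) *m (jac H F x)^T).
Proof.
move=> CF CG; apply: (Ckmx_mul oU); last by apply: (Ckmx_tr oU); exact: Ckmx_jac.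
apply: (Ckmx_mul oU); first exact: Ckmx_jac.
by apply: Ckmx_comp => // i; exact: CkS.
Qed.

Lemma gram_unit x : U x -> jac H F x *m G (F x) *m (jac H F x)^T \in unitmx.
Proof. by move=> Ux; apply: posdef_unit; apply: posdef_gram; [exact: fJ|exact/pG/UV]. Qed.

Lemma Ck_inner l (u w : 'rV[R]_p.+1 -> 'rV[R]_q.+1) :
  (forall i, Ck l U (fun x => F x 0 i)) -> Ckmx l V G ->
  (forall i, Ck l U (fun x => u x 0 i)) -> (forall i, Ck l U (fun x => w x 0 i)) ->
  Ck l U (fun x => inner (G (F x)) (u x) (w x)).
Proof.
move=> CF CG Cu Cw.
apply: (Ck_eq oU (f := fun x => \sum_i \sum_j u x 0 i * G (F x) i j * w x 0 j)).
  by move=> x _; rewrite innerE.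
do 2 (apply: (Ck_sum oU) => ?).
by apply: (CkM oU) => //; apply: (CkM oU) => //; exact: Ckmx_comp.
Qed.

Lemma Ck_mean_curvature nu : (forall i, Ck k.+2 U (fun x => F x 0 i)) ->
  Ckmx k.+1 V G -> Ck k U (fun x => mean_curvature H H' G F x nu).
Proof.
move=> CF CG.
have CF1 i : Ck k.+1 U (fun x => F x 0 i) by exact: CkS.
have CF0 i : Ck k U (fun x => F x 0 i) by exact: CkS.
have CG0 : Ckmx k V G by move=> i j; exact: CkS (CG i j).
pose A x := invmx (jac H F x *m G (F x) *m (jac H F x)^T) *m koszul_ff H H' G F x nu.
apply: (Ck_eq oU (f := fun x => \tr (A x))).
  move=> x Ux; have pGx := pG (UV Ux).
  by rewrite mean_curvatureE //; [exact: posdef_sym|exact: posdef_unit].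
apply: (Ck_trace oU); apply: (Ckmx_mul oU).
  by apply: (Ckmx_inv oU); [exact: gram_unit|exact: Ckmx_gram].
move=> a b.
have CJ : Ckmx k U (jac H F) by exact: Ckmx_jac.
have Ch i : Ck k U (fun x => hess H F a b x 0 i).
  by apply: (Ck_eq oU _ (Ck_pder a (Ck_pder b (CF i)))) => x _; rewrite mxE.
have CdG (u v w : 'rV[R]_p.+1 -> 'rV[R]_q.+1) :
    (forall i, Ck k U (fun x => u x 0 i)) -> (forall i, Ck k U (fun x => v x 0 i)) ->
    (forall i, Ck k U (fun x => w x 0 i)) ->
    Ck k U (fun x => inner (mx_pder H' G (F x) (u x)) (v x) (w x)).
  move=> Cu Cv Cw; apply: (Ck_eq oU (f := fun x => \sum_l \sum_i \sum_j
     u x 0 l * (v x 0 i * pder H' (fun z => G z i j) l (F x) * w x 0 j))).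
    by move=> x _; rewrite inner_mx_pder.
  do 3 (apply: (Ck_sum oU) => ?).
  apply: (CkM oU) => //; apply: (CkM oU) => //; apply: (CkM oU) => //.
  by apply: (Ck_comp oU oV UV CF0); exact: Ck_pder (CG _ _).
have Crow c i : Ck k U (fun x => row c (jac H F x) 0 i).
  by apply: (Ck_eq oU _ (CJ c i)) => x _; rewrite [RHS]mxE.
have Cnu i : Ck k U (fun=> nu 0 i) by exact: (Ck_cst oU).
apply: (Ck_eq oU (f := fun x => inner (G (F x)) (hess H F a b x) nu
    + 2^-1 * (inner (mx_pder H' G (F x) (row a (jac H F x))) (row b (jac H F x)) nu
              + inner (mx_pder H' G (F x) (row b (jac H F x))) (row a (jac H F x)) nu
              - inner (mx_pder H' G (F x) nu) (row a (jac H F x)) (row b (jac H F x))))).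
  by move=> x _; rewrite [RHS]mxE /koszul.
apply: (CkD oU); first exact: Ck_inner.
apply: (CkZ oU); apply: (CkB oU); last exact: CdG.
by apply: (CkD oU); apply: CdG.
Qed.

Lemma Ck_mean_curvature_field (W : 'rV[R]_p.+1 -> 'rV[R]_q.+1) :
  (forall i, Ck k.+2 U (fun x => F x 0 i)) -> Ckmx k.+1 V G ->
  (forall i, Ck k U (fun x => W x 0 i)) ->
  Ck k U (fun x => mean_curvature H H' G F x (W x)).
Proof.
move=> CF CG CW; apply: (Ck_eq oU (f := fun x =>
    \sum_l W x 0 l * mean_curvature H H' G F x (delta_mx 0 l))).
  by move=> x _; rewrite -mean_curvature_linear.
by apply: (Ck_sum oU) => l; apply: (CkM oU) => //; exact: Ck_mean_curvature.
Qed.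

End Immersion.

Section NormalField.
Variables (R : realType) (p q : nat) (U : set 'rV[R]_p.+1) (V : set 'rV[R]_q.+1).
Hypotheses (oU : relopen U) (oV : relopen V).
Local Notation H := (halfspace R p).
Variable F : 'rV[R]_p.+1 -> 'rV[R]_q.+1.
Hypothesis UV : forall x, U x -> V (F x).
Hypothesis fJ : forall x, U x -> row_free (jac H F x).
Variables (k : nat) (G : 'rV[R]_q.+1 -> 'M[R]_q.+1).
Hypothesis pG : forall y, V y -> posdef (G y).
Hypothesis CF : forall i, Ck k.+1 U (fun x => F x 0 i).
Hypothesis CG : Ckmx k V G.
Variable nu : 'rV[R]_q.+1.

(** The orthogonal projection of a constant vector to the normal line, as a
    normal field which is as regular as the tangent spaces. *)
Definition normal_field x := normal_part (G (F x)) (jac H F x) nu.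

Lemma normal_field_normal x : U x ->
  normal (G (F x)) (jac H F x) (normal_field x).
Proof. by move=> Ux; apply: normal_part_normal; [exact: fJ|exact/pG/UV]. Qed.

Lemma normal_field_id x : U x -> normal (G (F x)) (jac H F x) nu ->
  normal_field x = nu.
Proof. by move=> Ux; apply: normal_part_id; exact/posdef_sym/pG/UV. Qed.

Lemma Ck_normal_field i : Ck k U (fun x => normal_field x 0 i).
Proof.
have CJ : Ckmx k U (jac H F) by exact: (Ckmx_jac oU).
have CF0 j : Ck k U (fun x => F x 0 j) by exact: CkS.
suff : Ckmx k U normal_field by exact.
apply: (Ckmx_sub oU); first exact: (Ckmx_cst oU).
apply: (Ckmx_mul oU) => //; apply: (Ckmx_mul oU).
  apply: (Ckmx_mul oU); last exact: (Ckmx_tr oU).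
  by apply: (Ckmx_mul oU); [exact: (Ckmx_cst oU)|exact: (Ckmx_comp oU oV UV)].
apply: (Ckmx_inv oU); first exact: (gram_unit UV fJ pG).
exact: (Ckmx_gram oU oV UV).
Qed.

End NormalField.

(** * The limit of the mean curvature at the boundary *)

Lemma mx_pder_sum (R : realType) (q m n : nat) (E : set 'rV[R]_q.+1)
    (A : 'rV[R]_q.+1 -> 'M[R]_(m, n)) y (I : Type) (s : seq I) (xi : I -> 'rV[R]_q.+1) :
  mx_pder E A y (\sum_(i <- s) xi i) = \sum_(i <- s) mx_pder E A y (xi i).
Proof.
elim: s => [|i s IH]; last by rewrite !big_cons mx_pderDr IH.
by rewrite !big_nil -(scale0r 0) mx_pderZr scale0r.
Qed.

Section BoundaryLimit.
Variables (R : realType) (n : nat).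
Local Notation H := (halfspace R n).
Local Notation H' := (halfspace R n.+1).
Variables (U : set 'rV[R]_n.+1) (V : set 'rV[R]_n.+2).
Hypotheses (oU : relopen U) (oV : relopen V).
Variable F : 'rV[R]_n.+1 -> 'rV[R]_n.+2.
Hypothesis UV : forall x, U x -> V (F x).
Hypothesis CF : forall i, Ck 2 U (fun x => F x 0 i).
Hypothesis fJ : forall x, U x -> row_free (jac H F x).
Hypothesis bF : forall x, U x -> x 0 ord0 = 0 -> F x 0 ord0 = 0.
Hypothesis iF : forall x, U x -> 0 < x 0 ord0 -> 0 < F x 0 ord0.
Variable Gp : 'rV[R]_n.+2 -> 'M[R]_n.+2.
Hypothesis CGp : forall y, V y -> 0 < y 0 ord0 ->
  forall i j k, pderivable H' (fun z => Gp z i j) k y.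
Variables (r : 'rV[R]_n.+2 -> R) (G : 'rV[R]_n.+2 -> 'M[R]_n.+2).
Hypothesis C : local_compactification 1 V Gp r G.

Local Notation mc := (mean_curvature H H').
Local Notation J x := (jac H F x).

Lemma conformal_near y : V y -> 0 < y 0 ord0 ->
  \forall z \near within H' (nbhs y), G z = r z ^+ 2 *: Gp z.
Proof.
move=> Vy y0; have [|_ nV] := relopen_interior oV (x := y); first by split.
by apply: filterS nV => z [Vz z0]; exact: (lc_conformal C).
Qed.

Lemma mean_curvature_interior x nu : U x -> 0 < x 0 ord0 ->
  normal (G (F x)) (J x) nu ->
  mc G F x nu = mc Gp F x nu - n.+1%:R * ((r (F x))^-1 * diff1 H' r (F x) nu).
Proof.
move=> Ux x0 nnu; have Vy := UV Ux; have y0 := iF Ux x0.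
have [Hy _] := oV Vy.
apply: mean_curvature_conformal => //.
- by rewrite gt_eqF// (lc_pos C).
- exact: conformal_near.
- exact: (lc_conformal C).
- by move=> k; exact: (Ck_is_pder (lc_fun C) Vy).
- by move=> i j k; exact: CGp.
- exact: fJ.
- exact: (lc_posdef_interior C).
- by apply/(lc_normal_boundary C _ _ Vy y0).
Qed.

Variables (r0 : 'rV[R]_n.+2 -> R) (G0 : 'rV[R]_n.+2 -> 'M[R]_n.+2).
Hypothesis C0 : local_compactification 2 V Gp r0 G0.
Hypothesis unit_gradient : forall y, V y -> y 0 ord0 = 0 ->
  inner (G y) (gradient H' G r y) (gradient H' G r y) = 1.
Hypothesis tangency : forall x nu, U x -> x 0 ord0 = 0 ->
  normal (G (F x)) (J x) nu -> nu 0 ord0 = 0.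

Section AtPoint.
Variable x : 'rV[R]_n.+1.
Hypotheses (Ux : U x) (x0 : x 0 ord0 = 0).
Let p := F x.
Let Vp : V p. Proof. exact: UV. Qed.
Let p0 : p 0 ord0 = 0. Proof. exact: bF. Qed.
Let Hx : H x. Proof. by have [] := oU Ux. Qed.
Let X := gradient H' G r p.

(** By tangency dr annihilates the normals at x, so grad r is tangent to the
    hypersurface; the equation on v is |dr|^2 = 1. *)
Lemma gradient_tangent : exists2 v, X = v *m J x &
  v 0 ord0 * (pder H (fun z => F z 0 ord0) ord0 x * pder H' r ord0 p) = 1.
Proof.
have [v Xv] : exists v, X = v *m J x.
  apply: (orthogonal_normal_tangent (fJ Ux) (lc_posdef C Vp)) => nu nnu.
  by rewrite (inner_gradient C nu Vp) (lc_diff1 oV C)// (tangency Ux x0 nnu) mul0r.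
exists v => //; rewrite -(unit_gradient Vp p0) (inner_gradient C _ Vp) (lc_diff1 oV C)//.
rewrite -/X Xv mxE (bigD1 ord0)//= big1 ?addr0; first by rewrite mxE mulrA.
move=> a a0; rewrite mxE (@pder_boundary _ _ _ oU (fun z => F z 0 ord0)) ?mulr0//.
Qed.

Variable W : 'rV[R]_n.+1 -> 'rV[R]_n.+2.
Hypothesis CW : forall i, Ck 0 U (fun z => W z 0 i).
Hypothesis nW : forall z, U z -> normal (G (F z)) (J z) (W z).
Let nu := W x.

Variable v : 'rV[R]_n.+1.
Hypothesis Xv : X = v *m J x.
Hypothesis vc : v 0 ord0 * (pder H (fun z => F z 0 ord0) ord0 x * pder H' r ord0 p) = 1.
Variable Hs : 'M[R]_n.+2.
Hypothesis sHs : Hs^T = Hs.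
Hypothesis HsP : forall F gam v, admissible_path F gam p v -> forall k,
    (fun h => h^-1 * (pder H' r k (gam h) - pder H' r k p)) @ F
      --> \sum_l v 0 l * Hs k l.

Let L a : 'M[R]_(n.+1, n.+2) := \matrix_(b, l) hess H F a b x 0 l.
Let dG a := mx_pder H' G p (row a (J x)).
(* The derivative of dr(W) along the coordinate a. *)
Let ell a := \sum_k nu 0 k * (\sum_l J x a l * Hs k l)
  - inner (G p) (v *m L a) nu - inner (dG a) X nu.

(** The covector dr - <v J, _> agrees with dr on the normals and vanishes at x:
    hence its derivative at x, paired with W x, is that of dr(W), although W may
    not be differentiable. *)
Lemma diff_normal_quotient a :
  (fun h => h^-1 * diff1 H' r (F (x + h *: delta_mx 0 a)) (W (x + h *: delta_mx 0 a)))
   @ increments H a x --> ell a.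
Proof.
have CF1 i : Ck 1 U (fun z => F z 0 i) by exact: CkS.
pose lam z : 'rV[R]_n.+2 := v *m (J z *m G (F z)).
have lamx k : lam x 0 k = pder H' r k p.
  rewrite /lam mulmxA -Xv /X /gradient mulmxKV ?mxE//.
  by apply: posdef_unit; exact: (lc_posdef C).
have lamW z : U z -> \sum_k W z 0 k * lam z 0 k = 0.
  move=> Uz; have := normal_inner v (nW Uz).
  rewrite /inner -[v *m J z *m G (F z)]mulmxA -/(lam z) mxE => E; rewrite -[RHS]E.
  by apply: eq_bigr => k _; rewrite [(W z)^T k 0]mxE mulrC.
have dJG : mx_is_pder H (fun z => J z *m G (F z)) a x (L a *m G p + J x *m dG a).
  apply: mx_is_pderM.
    move=> b l; rewrite !mxE (_ : (fun z => J z b l) = pder H (fun z => F z 0 l) b).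
      exact: (Ck_is_pder (Ck_pder b (CF l)) Ux).
    by apply/funext => z; rewrite mxE.
  move=> i j; rewrite /dG /mx_pder summxE.
  rewrite (eq_bigr (fun k => pder H (fun z => F z 0 k) a x * pder H' (fun z => G z i j) k (F x))).
    exact: (pder_comp oU oV UV CF1 (lc_metric C i j) Ux).
  by move=> k _; rewrite !mxE.
have dlam k : is_pder H (fun z => lam z 0 k) a x ((v *m (L a *m G p + J x *m dG a)) 0 k).
  rewrite (_ : (fun z => lam z 0 k) = fun z => \sum_b v 0 b * (J z *m G (F z)) b k).
    by rewrite mxE; apply: is_pder_sum => b _; apply: is_pderZ; exact: dJG.
  by apply/funext => z; rewrite mxE.
have Pg := is_pder_path a oU oV UV CF1 Ux.
have lim : (fun h => \sum_k W (x + h *: delta_mx 0 a) 0 k *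
    (h^-1 * (pder H' r k (F (x + h *: delta_mx 0 a)) - pder H' r k p)
     - diffquot (fun z => lam z 0 k) a x h)) @ increments H a x -->
   \sum_k nu 0 k * ((\sum_l row a (J x) 0 l * Hs k l)
     - (v *m (L a *m G p + J x *m dG a)) 0 k).
  apply: cvg_fsum => k; apply: cvgM; first exact: (cvg_increments oU a (CW k) Ux).
  by apply: cvgB; [exact: (@HsP _ _ _ Pg k)|exact: dlam].
apply: (near_cvg _ lim).
  apply: filterS (increments_rel oU a Ux) => h Uh.
  set z := x + h *: delta_mx 0 a in Uh *.
  have -> : diff1 H' r (F z) (W z) = \sum_k W z 0 k * (pder H' r k (F z) - lam z 0 k).
    under [RHS]eq_bigr do rewrite mulrBr.
    by rewrite sumrB (lamW _ Uh) subr0.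
  rewrite mulr_sumr; apply: eq_bigr => k _.
  by rewrite /diffquot -/z lamx; ring.
rewrite (eq_bigr (fun k => nu 0 k * (\sum_l J x a l * Hs k l)
   - (v *m (L a *m G p + J x *m dG a)) 0 k * nu 0 k)); last first.
  move=> k _; rewrite mulrBr [X in _ - X]mulrC; congr (_ * _ - _).
  by apply: eq_bigr => l _; rewrite !mxE.
rewrite sumrB /ell -addrA -opprD; congr (_ - _).
have -> : \sum_k (v *m (L a *m G p + J x *m dG a)) 0 k * nu 0 k
    = (v *m (L a *m G p + J x *m dG a) *m nu^T) 0 0.
  by rewrite [RHS]mxE; apply: eq_bigr => k _; rewrite [nu^T k 0]mxE.
by rewrite mulmxDr mulmxDl mxE !mulmxA -Xv.
Qed.

(** By tangency dr(W) vanishes on the boundary. *)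
Lemma ell_tangential a : a != ord0 -> ell a = 0.
Proof.
move=> a0; have PF := increments_proper a Hx.
apply: (cvg_unique _ (@diff_normal_quotient a)) => //.
apply: (near_cvg _ (cvg_cst 0)) => //.
apply: filterS (increments_rel oU a Ux) => h Uh.
have h0 : (x + h *: delta_mx 0 a) 0 ord0 = 0.
  by rewrite deltaE x0 eq_sym (negbTE a0) mulr0 addr0.
by rewrite (lc_diff1 oV C)//; [rewrite (tangency Uh h0 (nW Uh)) mul0r mulr0|exact: UV|exact: bF].
Qed.

(** By the previous lemma the left side is the derivative of dr(W) along v, that
    is along X = grad r. In the expression of [ell] the weak Hessian of r gives
    half of the derivative of G(X, X) along nu, by [weak_hessian_gradient]; this
    is the term which turns the two others into Koszul's formula. *)
Lemma ell_normal : v 0 ord0 * ell ord0 = - inner (second_ff H H' G F x nu) v v.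
Proof.
have sG := posdef_sym (lc_posdef C Vp); have uG := posdef_unit (lc_posdef C Vp).
have -> : v 0 ord0 * ell ord0 = \sum_a v 0 a * ell a.
  by rewrite (bigD1 ord0)//= big1 ?addr0// => a a0; rewrite ell_tangential// mulr0.
have XE : X = \sum_a v 0 a *: row a (J x) by rewrite Xv mulmx_sum_row.
have E1 : \sum_a v 0 a * (\sum_k nu 0 k * (\sum_l J x a l * Hs k l))
    = 2^-1 * inner (mx_pder H' G p nu) X X.
  rewrite -(weak_hessian_gradient oV C unit_gradient Vp p0 HsP (tangency Ux x0 (nW Ux))).
  rewrite -/X [RHS]exchange_big /=.
  under eq_bigr do rewrite mulr_sumr.
  rewrite exchange_big /=; apply: eq_bigr => k _.
  under eq_bigr do rewrite !mulr_sumr.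
  rewrite exchange_big /=; apply: eq_bigr => l _.
  rewrite Xv mxE !mulr_suml; apply: eq_bigr => a _.
  by rewrite -[in RHS]sHs [Hs^T l k]mxE; ring.
have E2 : \sum_a v 0 a * inner (G p) (v *m L a) nu =
    \sum_a \sum_b v 0 a * inner (G p) (hess H F a b x) nu * v 0 b.
  apply: eq_bigr => a _; rewrite mulmx_sum_row inner_suml mulr_sumr.
  apply: eq_bigr => b _; rewrite innerZl.
  rewrite (_ : row b (L a) = hess H F a b x); first by ring.
  by apply/rowP => l; rewrite !mxE.
have E3 : \sum_a v 0 a * inner (dG a) X nu = inner (mx_pder H' G p X) X nu.
  rewrite [in mx_pder _ _ _ X]XE mx_pder_sum inner_summ.
  by apply: eq_bigr => a _; rewrite mx_pderZr innerZm.
have -> : \sum_a v 0 a * ell a = 2^-1 * inner (mx_pder H' G p nu) X X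
   - (\sum_a \sum_b v 0 a * inner (G p) (hess H F a b x) nu * v 0 b)
   - inner (mx_pder H' G p X) X nu.
  rewrite -E1 -E2 -E3 -!sumrB; apply: eq_bigr => a _.
  by rewrite /ell; ring.
rewrite second_ffE//.
pose K := koszul H' G p nu.
pose hJ := \matrix_(d, c) inner (G p) (hess H F d c x) nu.
have -> : koszul_ff H H' G F x nu = hJ + \matrix_(d, c) K (row d (J x)) (row c (J x)).
  by apply/matrixP => d c; rewrite !mxE.
rewrite innerDm.
have -> : inner (\matrix_(d, c) K (row d (J x)) (row c (J x))) v v = K X X.
  rewrite /inner -koszul_rows -Xv (_ : row 0 X = X)//.
  by apply/rowP => l; rewrite mxE.
have -> : inner hJ v v = \sum_a \sum_b v 0 a * inner (G p) (hess H F a b x) nu * v 0 b.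
  rewrite innerE; apply: eq_bigr => a _; apply: eq_bigr => b _.
  by rewrite [hJ a b]mxE.
by rewrite /K /koszul; set S := \sum_a _; field.
Qed.

End AtPoint.
End BoundaryLimit.

Section LimitTheorem.
Variables (R : realType) (n : nat).
Local Notation H := (halfspace R n).
Local Notation H' := (halfspace R n.+1).
Variables (U : set 'rV[R]_n.+1) (V : set 'rV[R]_n.+2).
Hypotheses (oU : relopen U) (oV : relopen V).
Variable F : 'rV[R]_n.+1 -> 'rV[R]_n.+2.
Hypothesis UV : forall x, U x -> V (F x).
Hypothesis CF : forall i, Ck 2 U (fun x => F x 0 i).
Hypothesis fJ : forall x, U x -> row_free (jac H F x).
Hypothesis bF : forall x, U x -> x 0 ord0 = 0 -> F x 0 ord0 = 0.
Hypothesis iF : forall x, U x -> 0 < x 0 ord0 -> 0 < F x 0 ord0.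
Variable Gp : 'rV[R]_n.+2 -> 'M[R]_n.+2.
Hypothesis CGp : forall y, V y -> 0 < y 0 ord0 ->
  forall i j k, pderivable H' (fun z => Gp z i j) k y.
Variables (r : 'rV[R]_n.+2 -> R) (G : 'rV[R]_n.+2 -> 'M[R]_n.+2).
Hypothesis C : local_compactification 1 V Gp r G.

Local Notation mc := (mean_curvature H H').
Local Notation J x := (jac H F x).

Lemma mean_curvature_field_cvg (W : 'rV[R]_n.+1 -> 'rV[R]_n.+2) a x :
  (forall i, Ck 0 U (fun z => W z 0 i)) -> U x ->
  (fun h => mc G F (x + h *: delta_mx 0 a) (W (x + h *: delta_mx 0 a)))
    @ increments H a x --> mc G F x (W x).
Proof.
move=> CW Ux.
apply: (cvg_increments oU a (k := 0) (f := fun z => mc G F z (W z))) => //.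
exact: (Ck_mean_curvature_field oU oV UV fJ (lc_posdef C) CF (lc_metric C) CW).
Qed.

Lemma defining_function_cvg k x : U x -> x 0 ord0 = 0 ->
  (fun h => h^-1 * r (F (x + h *: delta_mx 0 k))) @ increments H k x -->
    J x k ord0 * pder H' r ord0 (F x).
Proof.
move=> Ux x0; have CF1 i : Ck 1 U (fun z => F z 0 i) by exact: CkS.
have L := pder_comp oU oV UV (a := k) CF1 (lc_fun C) Ux.
apply: (near_cvg _ L).
  by apply: nearW => h; rewrite /diffquot (lc_zero C (UV Ux) (bF Ux x0)) subr0.
rewrite (bigD1 ord0)//= big1 ?addr0 ?mxE// => i i0.
rewrite (pder_boundary oV _ (UV Ux) (bF Ux x0) i0) ?mulr0//.
by move=> z; exact: (lc_zero C).
Qed.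

(** The unit normals of Gp are obtained from the normal W by scaling. *)
Lemma unit_normal_bound x W B : U x -> 0 < x 0 ord0 ->
  normal (G (F x)) (J x) W -> 0 < inner (G (F x)) W W ->
  (forall N, unit_normal (Gp (F x)) (J x) N -> `|mc Gp F x N| <= B) ->
  `|mc Gp F x W| <= B * (Num.sqrt (inner (G (F x)) W W) / r (F x)).
Proof.
move=> Ux x0 nW w0 NB; have Vy := UV Ux; have y0 := iF Ux x0.
have r0 := lc_pos C Vy y0; set w := inner _ _ _ in w0 *.
have s0 : 0 < Num.sqrt w by rewrite sqrtr_gt0.
pose c := r (F x) / Num.sqrt w.
have c0 : 0 < c by rewrite divr_gt0.
have : unit_normal (Gp (F x)) (J x) (c *: W).
  apply/unit_normalE; split; last first.
    by apply: normalZ; apply/(lc_normal_boundary C _ _ Vy y0).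
  have E : inner (G (F x)) W W = r (F x) ^+ 2 * inner (Gp (F x)) W W.
    by rewrite (lc_conformal C Vy y0) innerZm.
  rewrite innerZl innerZr mulrA -expr2 /c expr_div_n sqr_sqrtr ?ltW//.
  by rewrite mulrAC -E mulfV// gt_eqF.
move=> /NB; rewrite mean_curvatureZ normrM gtr0_norm// => le.
have -> : Num.sqrt w / r (F x) = c^-1 by rewrite /c invf_div.
by rewrite ler_pdivlMr// mulrC.
Qed.

(** Multiplied by r, the conformal change of the mean curvature expresses dr(W) by
    r times the mean curvatures for G and Gp. The first one is bounded, and so is
    the second one, as the unit normal for Gp is r / |W| times W. Hence dr(W)
    tends to zero. *)
Lemma tangency_of_bounded_mean_curvature B e : 0 < e ->
  (forall x N, U x -> 0 < x 0 ord0 -> r (F x) < e ->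
     unit_normal (Gp (F x)) (J x) N -> `|mc Gp F x N| <= B * r (F x)) ->
  forall x nu, U x -> x 0 ord0 = 0 -> normal (G (F x)) (J x) nu -> nu 0 ord0 = 0.
Proof.
move=> e0 NB x nu Ux x0 nnu; have [Hx _] := oU Ux; have Vy := UV Ux.
have [->|nu0] := eqVneq nu 0; first by rewrite mxE.
have y0 := bF Ux x0; have PF := increments_proper ord0 Hx.
have CF1 i : Ck 1 U (fun z => F z 0 i) by exact: CkS.
have CF0 i : Ck 0 U (fun z => F z 0 i) by exact: CkS.
have CG0 : Ckmx 0 V G by move=> i j; exact: CkS (lc_metric C i j).
pose W := normal_field F G nu.
have CW i : Ck 0 U (fun z => W z 0 i).
  exact: (Ck_normal_field oU oV UV fJ (lc_posdef C) CF1 CG0).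
have nW z : U z -> normal (G (F z)) (J z) (W z).
  exact: (normal_field_normal UV fJ (lc_posdef C)).
have Wx : W x = nu by exact: (normal_field_id UV (lc_posdef C)).
have Cw : Ck 0 U (fun z => inner (G (F z)) (W z) (W z)).
  exact: (Ck_inner oU oV UV CF0 CG0 CW CW).
have Crf : Ck 0 U (fun z => r (F z)) by exact: (Ck_comp oU oV UV CF0 (CkS (lc_fun C))).
have Cd : Ck 0 U (fun z => diff1 H' r (F z) (W z)).
  apply: (Ck_sum oU) => k; apply: (CkM oU) => //.
  exact: (Ck_comp oU oV UV CF0 (Ck_pder k (lc_fun C))).
pose pt h := x + h *: delta_mx 0 ord0 : 'rV[R]_n.+1.
have lw := cvg_increments oU ord0 Cw Ux.
have lr := cvg_increments oU ord0 Crf Ux.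
have ld := cvg_increments oU ord0 Cd Ux.
have lm := mean_curvature_field_cvg ord0 CW Ux.
have w0 : 0 < inner (G (F x)) (W x) (W x) by rewrite Wx; apply: (lc_posdef C Vy).2.
have rx : r (F x) = 0 by exact: (lc_zero C).
rewrite rx in lr.
have bnd : \forall h \near increments H ord0 x,
    n.+1%:R * `|diff1 H' r (F (pt h)) (W (pt h))|
    <= B * r (F (pt h)) * Num.sqrt (inner (G (F (pt h))) (W (pt h)) (W (pt h)))
       + r (F (pt h)) * `|mc G F (pt h) (W (pt h))|.
  have c1 := increments_pos Hx x0; have c2 := increments_rel oU ord0 Ux.
  have c3 : \forall h \near increments H ord0 x, 0 < inner (G (F (pt h))) (W (pt h)) (W (pt h)).
    exact: (cvgr_gt _ lw _ w0).
  have c4 : \forall h \near increments H ord0 x, r (F (pt h)) < e by exact: (cvgr_lt _ lr _ e0).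
  apply: filterS2 (filterI c1 c2) (filterI c3 c4) => h [h1 Uh] [wh rh].
  have r0 := lc_pos C (UV Uh) (iF Uh h1).
  have Kb : `|mc Gp F (pt h) (W (pt h))|
      <= B * Num.sqrt (inner (G (F (pt h))) (W (pt h)) (W (pt h))).
    have := unit_normal_bound Uh h1 (nW _ Uh) wh (fun N => NB _ N Uh h1 rh).
    have E (b s t : R) : t != 0 -> b * t * (s / t) = b * s by move=> t0; field.
    by rewrite E// gt_eqF.
  have E := mean_curvature_interior oV UV fJ iF CGp C Uh h1 (nW _ Uh).
  rewrite -/(pt h) in E *.
  have -> : n.+1%:R * `|diff1 H' r (F (pt h)) (W (pt h))| =
     `|r (F (pt h)) * (mc Gp F (pt h) (W (pt h)) - mc G F (pt h) (W (pt h)))|.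
    rewrite E opprB addrCA subrr addr0 mulrCA mulVKf ?gt_eqF// normrM.
    by rewrite ger0_norm// ler0n.
  rewrite normrM (gtr0_norm r0).
  apply: (le_trans (ler_wpM2l (ltW r0) (ler_normB _ _))).
  rewrite mulrDr lerD2r.
  apply: (le_trans (ler_wpM2l (ltW r0) Kb)).
  by rewrite mulrA [_ * B]mulrC.
have lim0 : (fun h => B * r (F (pt h)) * Num.sqrt (inner (G (F (pt h))) (W (pt h)) (W (pt h)))
       + r (F (pt h)) * `|mc G F (pt h) (W (pt h))|) @ increments H ord0 x --> (0 : R).
  have ls := cvg_comp _ _ lw (@sqrt_continuous _ (inner (G (F x)) (W x) (W x))).
  apply: (near_cvg _ (cvgD (cvgM (cvgM (cvg_cst B) lr) ls) (cvgM lr (cvg_norm lm)))).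
    exact: nearW.
  by rewrite mulr0 !mul0r addr0.
have : n.+1%:R * `|diff1 H' r (F x) (W x)| <= 0.
  exact: (ler_cvg_to (cvgM (cvg_cst (n.+1%:R : R)) (cvg_norm ld)) lim0 bnd).
rewrite Wx (lc_diff1 oV C)// pmulr_rle0 ?ltr0n// normr_le0 mulf_eq0.
by rewrite (negbTE (lc_diff C Vy y0)) orbF => /eqP.
Qed.

Variables (r0 : 'rV[R]_n.+2 -> R) (G0 : 'rV[R]_n.+2 -> 'M[R]_n.+2).
Hypothesis C0 : local_compactification 2 V Gp r0 G0.
Hypothesis unit_gradient : forall y, V y -> y 0 ord0 = 0 ->
  inner (G y) (gradient H' G r y) (gradient H' G r y) = 1.
Hypothesis tangency : forall x nu, U x -> x 0 ord0 = 0 ->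
  normal (G (F x)) (J x) nu -> nu 0 ord0 = 0.

(** In the conformal change of the mean curvature, dr(W) / r tends to the quotient
    of the transverse derivatives of dr(W) and of r o F, which [ell_normal]
    computes. The left side only depends on Gp and W, and the right side only on
    the compactification (r, G) and on the value of W at x. *)
Theorem mean_curvature_limit (W : 'rV[R]_n.+1 -> 'rV[R]_n.+2) x :
  (forall i, Ck 0 U (fun z => W z 0 i)) ->
  (forall z, U z -> normal (G (F z)) (J z) (W z)) -> U x -> x 0 ord0 = 0 ->
  let v := gradient H' G r (F x) *m pinvmx (J x) in
  (fun h => mc Gp F (x + h *: delta_mx 0 ord0) (W (x + h *: delta_mx 0 ord0)))
    @ increments H ord0 x -->
  mc G F x (W x) - n.+1%:R * inner (second_ff H H' G F x (W x)) v v.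
Proof.
move=> CW nW Ux x0 v; have [Hx _] := oU Ux; have Vy := UV Ux.
have y0 := bF Ux x0.
have [v' Xv vc] := gradient_tangent oU oV UV fJ bF C unit_gradient tangency Ux x0.
have -> : v = v' by rewrite /v Xv -mulmxA mulmxVp ?fJ// mulmx1.
have [Hs sHs HsP] := weak_hessian oV C C0 Vy y0.
have ln := diff_normal_quotient oU oV UV CF C Ux CW nW Xv HsP (a := ord0).
have ell := ell_normal oU oV UV CF bF C unit_gradient tangency Ux x0 CW nW Xv sHs HsP.
have lm := mean_curvature_field_cvg ord0 CW Ux.
have lr := defining_function_cvg (k := ord0) Ux x0.
set l := (X in _ --> X) in ln; rewrite -/l in ell.
set c := (X in _ --> X) in lr.
have vc' : v' 0 ord0 * c = 1 by rewrite /c mxE.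
have c0 : c != 0.
  by apply: contra_eqN vc' => /eqP ->; rewrite mulr0 eq_sym oner_eq0.
apply: (near_cvg _ (cvgD lm (cvgM (cvg_cst (n.+1%:R : R)) (cvgM ln (cvgV c0 lr))))).
  have c1 := increments_pos Hx x0; have c2 := increments_rel oU ord0 Ux.
  apply: filterS2 (filterI c1 c2) (increments_neq0 H ord0 x) => h [h1 Uh] h0.
  have rh := lc_pos C (UV Uh) (iF Uh h1).
  rewrite !fctE /= (mean_curvature_interior oV UV fJ iF CGp C Uh h1 (nW _ Uh)).
  set A := mc Gp _ _ _; set B := diff1 _ _ _ _.
  by field; rewrite h0 gt_eqF.
congr (_ + _); rewrite -mulrN -ell; congr (_ * _).
have -> : v' 0 ord0 = c^-1 by rewrite -[LHS](mulfK c0) vc' mul1r.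
by rewrite mulrC.
Qed.

End LimitTheorem.

(** * The boundary of the hypersurface *)

Section BoundaryEmbedding.
Variables (R : realType) (d : nat).
Local Notation H := (halfspace R d).

Lemma bemb0 (z : 'rV[R]_d) : bemb z 0 ord0 = 0.
Proof.
by rewrite mxE; case: splitP => j //; rewrite mxE.
Qed.

Lemma bembS (z : 'rV[R]_d) a : bemb z 0 (lift ord0 a) = z 0 a.
Proof.
rewrite mxE; case: splitP => j /=; first by rewrite (ord1 j).
by rewrite /bump /= !add1n => -[/val_inj ->].
Qed.

Lemma bembP (x y : 'rV[R]_d.+1) : x 0 ord0 = y 0 ord0 ->
  (forall a, x 0 (lift ord0 a) = y 0 (lift ord0 a)) -> x = y.
Proof.
by move=> e0 eS; apply/rowP => i; case: (unliftP ord0 i) => [a ->|->].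
Qed.

Lemma bemb_btail (x : 'rV[R]_d.+1) : x 0 ord0 = 0 -> bemb (btail x) = x.
Proof.
move=> x0; apply: bembP => [|a]; first by rewrite bemb0.
by rewrite bembS mxE.
Qed.

Lemma halfspace_bemb (z : 'rV[R]_d) : H (bemb z).
Proof. by rewrite /halfspace /= bemb0. Qed.

Lemma bembD (z : 'rV[R]_d) a h :
  bemb (z + h *: delta_mx 0 a) = bemb z + h *: delta_mx 0 (lift ord0 a).
Proof.
apply: bembP => [|b]; rewrite ?deltaE ?bembS ?bemb0; first by rewrite mulr0 addr0.
by rewrite !mxE eqxx (inj_eq lift_inj).
Qed.

Lemma increments_bemb (z : 'rV[R]_d) a :
  increments setT a z = increments H (lift ord0 a) (bemb z).
Proof.
rewrite /increments (_ : [set h | H _] = [set h | setT (z + h *: delta_mx 0 a)])//.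
apply/seteqP; split => h //= _; by rewrite -bembD; exact: halfspace_bemb.
Qed.

Lemma pder_bemb (f : 'rV[R]_d.+1 -> R) a :
  pder setT (fun z => f (bemb z)) a = fun z => pder H f (lift ord0 a) (bemb z).
Proof.
apply/funext => z; rewrite /pder increments_bemb; congr lim.
rewrite (_ : diffquot _ a z = diffquot f (lift ord0 a) (bemb z))//.
by apply/funext => h; rewrite /diffquot bembD.
Qed.

Lemma bemb_near (V : set 'rV[R]_d.+1) z : relopen V -> V (bemb z) ->
  \forall z' \near within setT (nbhs z), V (bemb z').
Proof.
move=> oV /oV[_]; rewrite withinET.
have c : (fun z' => bemb z') @ nbhs z --> bemb z.
  apply: cvg_row => i; case: (unliftP ord0 i) => [a ->|->].
    apply: (near_cvg _ (@coord_continuous R 1 d 0 a z)); last by rewrite bembS.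
    by apply: nearW => z'; rewrite bembS.
  by apply: (near_cvg _ (cvg_cst 0)); [apply: nearW => z'|]; rewrite bemb0.
move=> nV; have {}nV : nbhs (bemb z) [set y | H y -> V y] by exact: nV.
have cV : nbhs z [set z' | H (bemb z') -> V (bemb z')] by exact: (c _ nV).
by apply: filterS cV => z' Vz'; exact: (Vz' (halfspace_bemb z')).
Qed.

Definition tail_mx (G : 'M[R]_d.+1) : 'M[R]_d :=
  \matrix_(a, b) G (lift ord0 a) (lift ord0 b).

Lemma inner_bemb G (u w : 'rV[R]_d) :
  inner G (bemb u) (bemb w) = inner (tail_mx G) u w.
Proof.
rewrite !innerE big_ord_recl big1 ?add0r; last first.
  by move=> j _; rewrite bemb0 !mul0r.
apply: eq_bigr => i _; rewrite big_ord_recl bemb0 mulr0 add0r.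
by apply: eq_bigr => j _; rewrite !bembS mxE.
Qed.

Lemma posdef_tail G : posdef G -> posdef (tail_mx G).
Proof.
move=> [sG pG]; split; first by apply/matrixP => a b; rewrite !mxE -[in RHS]sG mxE.
move=> v v0; rewrite -inner_bemb pG//; apply: contra_neq v0 => b0.
by apply/rowP => a; rewrite -bembS b0 !mxE.
Qed.

End BoundaryEmbedding.

(** The trace is computed in the basis which consists of v and of the last
    coordinate vectors, where the matrix of A is block diagonal. *)
Lemma trace_split (R : realType) (n : nat) (A S : 'M[R]_n.+1) (v : 'rV[R]_n.+1) :
  posdef A -> v 0 ord0 != 0 -> inner A v v = 1 ->
  (forall a, inner A v (delta_mx 0 (lift ord0 a)) = 0) ->
  \tr (invmx A *m S) = inner S v v + \tr (invmx (tail_mx A) *m tail_mx S).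
Proof.
move=> pA v0 vv1 vd0; have sA := posdef_sym pA.
pose P : 'M[R]_n.+1 := \matrix_(i, j) (if i == ord0 then v 0 j else (i == j)%:R).
have rP0 : row ord0 P = v by apply/rowP => j; rewrite !mxE.
have rPS a : row (lift ord0 a) P = delta_mx 0 (lift ord0 a).
  by apply/rowP => j; rewrite !mxE eqxx /= eq_sym.
have uP : P \in unitmx.
  rewrite -row_free_unit -kermx_eq0; apply/rowV0P => u /sub_kermxP uP.
  have uE j : (u *m P) 0 j = u 0 ord0 * v 0 j + \sum_a u 0 (lift ord0 a) * (lift ord0 a == j)%:R.
    by rewrite mxE big_ord_recl mxE; congr (_ + _); apply: eq_bigr => a _; rewrite mxE.
  have u0 : u 0 ord0 = 0.
    have := uE ord0; rewrite uP mxE big1 ?addr0 => [/esym/eqP|a _]; last by rewrite mulr0.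
    by rewrite mulf_eq0 (negbTE v0) orbF => /eqP.
  apply: bembP => [|b]; rewrite mxE //.
  have := uE (lift ord0 b); rewrite uP mxE u0 mul0r add0r (bigD1 b)//= eqxx mulr1.
  rewrite big1 ?addr0// => a ab; by rewrite (inj_eq lift_inj) (negbTE ab) mulr0.
have E (B : 'M[R]_n.+1) i j : (P *m B *m P^T) i j = inner B (row i P) (row j P).
  by rewrite inner_row.
have tE (B : 'M[R]_n.+1) a b :
    inner B (delta_mx 0 (lift ord0 a)) (delta_mx 0 (lift ord0 b)) = tail_mx B a b.
  by rewrite /inner trmx_delta -rowE -colE !mxE.
have uA := posdef_unit pA; have uT := posdef_unit (posdef_tail pA).
rewrite -(trace_congruence S uP uA).
pose Z : 'M[R]_n.+1 := \matrix_(i, j) match unlift ord0 i, unlift ord0 j with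
  | None, None => 1 | Some a, Some b => invmx (tail_mx A) a b | _, _ => 0 end.
have Z00 : Z ord0 ord0 = 1 by rewrite mxE unlift_none.
have Z0S a : Z ord0 (lift ord0 a) = 0 by rewrite mxE unlift_none liftK.
have ZS0 a : Z (lift ord0 a) ord0 = 0 by rewrite mxE unlift_none liftK.
have ZSS a b : Z (lift ord0 a) (lift ord0 b) = invmx (tail_mx A) a b by rewrite mxE !liftK.
have uQ : P *m A *m P^T \in unitmx by rewrite !unitmx_mul unitmx_tr uP uA.
have ZQ : Z *m (P *m A *m P^T) = 1%:M.
  apply/matrixP => i j; rewrite mxE big_ord_recl.
  case: (unliftP ord0 i) => [a ->|->].
    rewrite ZS0 mul0r add0r; case: (unliftP ord0 j) => [b ->|->].
      rewrite (eq_bigr (fun c => invmx (tail_mx A) a c * tail_mx A c b)); last first.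
        by move=> c _; rewrite ZSS E !rPS tE.
      rewrite [RHS]mxE (inj_eq lift_inj).
      have := congr1 (fun M : 'M[R]_n => M a b) (mulVmx uT).
      by rewrite mxE => ->; rewrite mxE.
    rewrite big1 ?mxE// => c _; rewrite E rPS rP0 (innerC _ _ sA) vd0 mulr0//.
  rewrite Z00 mul1r big1 ?addr0 => [|c _]; last by rewrite Z0S mul0r.
  rewrite E rP0; case: (unliftP ord0 j) => [b ->|->]; first by rewrite rPS vd0 mxE.
  by rewrite rP0 vv1 mxE.
have -> : invmx (P *m A *m P^T) = Z by rewrite -[RHS](mulmxK uQ) ZQ mul1mx.
rewrite /mxtrace big_ord_recl; congr (_ + _).
  rewrite mxE big_ord_recl Z00 mul1r big1 ?addr0 => [|c _]; last by rewrite Z0S mul0r.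
  by rewrite E rP0.
apply: eq_bigr => a _; rewrite mxE big_ord_recl ZS0 mul0r add0r mxE.
by apply: eq_bigr => c _; rewrite ZSS E !rPS tE.
Qed.

Section BoundaryCurvature.
Variables (R : realType) (n : nat).
Local Notation H := (halfspace R n).
Local Notation H' := (halfspace R n.+1).
Variables (U : set 'rV[R]_n.+1) (V : set 'rV[R]_n.+2).
Hypotheses (oU : relopen U) (oV : relopen V).
Variable F : 'rV[R]_n.+1 -> 'rV[R]_n.+2.
Hypothesis UV : forall x, U x -> V (F x).
Hypothesis fJ : forall x, U x -> row_free (jac H F x).
Hypothesis bF : forall x, U x -> x 0 ord0 = 0 -> F x 0 ord0 = 0.
Variable G : 'rV[R]_n.+2 -> 'M[R]_n.+2.
Hypothesis pG : forall y, V y -> posdef (G y).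
Variable h : 'rV[R]_n.+1 -> 'M[R]_n.+1.
Hypothesis hG : forall z, V (bemb z) -> h z = tail_mx (G (bemb z)).
Local Notation Fb := (fun z => btail (F (bemb z))).

Lemma mx_pder_tail y xi u w : V y -> y 0 ord0 = 0 ->
  inner (mx_pder setT h (btail y) xi) u w
  = inner (mx_pder H' G y (bemb xi)) (bemb u) (bemb w).
Proof.
move=> Vy y0; have yE := bemb_btail y0.
have Vb : V (bemb (btail y)) by rewrite yE.
have hn : \forall z \near within setT (nbhs (btail y)), h z = tail_mx (G (bemb z)).
  by apply: filterS (bemb_near oV Vb) => z; exact: hG.
rewrite (mx_pder_eq_near xi (hG Vb) hn) inner_bemb; congr inner.
apply/matrixP => a b; rewrite mxE /mx_pder !summxE [RHS]big_ord_recl.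
rewrite [X in _ = X + _]mxE bemb0 mul0r add0r; apply: eq_bigr => k _.
rewrite bembS [LHS]mxE [RHS]mxE; congr (_ * _); rewrite [LHS]mxE [RHS]mxE.
pose g z := G z (lift ord0 a) (lift ord0 b).
rewrite (_ : (fun z => tail_mx (G (bemb z)) a b) = (fun z => g (bemb z))).
  by rewrite (pder_bemb g) yE.
by apply/funext => z; rewrite mxE.
Qed.

(** Since nu is tangent to the boundary, Koszul's formula shows that the second
    fundamental form of the boundary of the hypersurface is the restriction of
    that of the hypersurface; the missing term of the trace is that of v. *)
Lemma mean_curvature_split (x : 'rV[R]_n.+1) (nu : 'rV[R]_n.+2)
    (v : 'rV[R]_n.+1) : U x -> x 0 ord0 = 0 -> nu 0 ord0 = 0 ->
  v 0 ord0 != 0 -> inner (G (F x)) (v *m jac H F x) (v *m jac H F x) = 1 ->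
  (forall a, inner (G (F x)) (v *m jac H F x) (row (lift ord0 a) (jac H F x)) = 0) ->
  mean_curvature H H' G F x nu =
  mean_curvature setT setT h Fb (btail x) (btail nu)
  + inner (second_ff H H' G F x nu) v v.
Proof.
move=> Ux x0 nu0 v0 vv vd; have Vy := UV Ux; have y0 := bF Ux x0.
have pGx := pG Vy.
have xE := bemb_btail x0; have yE := bemb_btail y0; have nuE := bemb_btail nu0.
set J := jac H F x in vv vd *.
have pJ : posdef (J *m G (F x) *m J^T) by apply: posdef_gram => //; exact: fJ.
rewrite /mean_curvature -/J (trace_split _ pJ v0); last 2 first.
- by rewrite inner_mul.
- by move=> a; rewrite inner_mul -rowE.
rewrite addrC; congr (_ + _).
have Fb0 : Fb (btail x) = btail (F x) by rewrite xE.
have hx : h (Fb (btail x)) = tail_mx (G (F x)).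
  by rewrite Fb0 hG ?yE.
have dFb a k z : pder setT (fun z => Fb z 0 k) a z
    = pder H (fun z => F z 0 (lift ord0 k)) (lift ord0 a) (bemb z).
  rewrite (_ : (fun z => Fb z 0 k) = (fun z => (fun y => F y 0 (lift ord0 k)) (bemb z))).
    by rewrite (pder_bemb (fun y => F y 0 (lift ord0 k))).
  by apply/funext => z'; rewrite mxE.
have rowJ a : row (lift ord0 a) J = bemb (row a (jac setT Fb (btail x))).
  apply: bembP => [|k]; last by rewrite bembS !mxE dFb xE.
  rewrite bemb0 !mxE; apply: (@pder_boundary _ _ _ oU (fun z => F z 0 ord0)) => //.
have hessE a b : hess H F (lift ord0 a) (lift ord0 b) x = bemb (hess setT Fb a b (btail x)).
  apply: bembP => [|k].
    rewrite bemb0 mxE; apply: (@pder_boundary _ _ _ oU) => // z Uz z0.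
    exact: (@pder_boundary _ _ _ oU (fun z => F z 0 ord0)).
  rewrite bembS !mxE.
  rewrite (_ : pder setT (fun z => Fb z 0 k) b = (fun z =>
     pder H (fun z => F z 0 (lift ord0 k)) (lift ord0 b) (bemb z))); last first.
    by apply/funext => z; rewrite dFb.
  by rewrite (pder_bemb (pder H (fun z => F z 0 (lift ord0 k)) (lift ord0 b))) xE.
have pT := posdef_tail pGx.
congr (\tr (invmx _ *m _)).
  apply/matrixP => a b; rewrite [LHS]mxE -!inner_row !rowJ inner_bemb hx.
  by [].
rewrite (@second_ffE _ _ _ H H' G F x nu (posdef_sym pGx) (posdef_unit pGx)).
rewrite (@second_ffE _ _ _ setT setT h Fb (btail x));
  [|by rewrite hx; exact: posdef_sym|by rewrite hx; exact: posdef_unit].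
apply/matrixP => a b; rewrite [LHS]mxE [LHS]mxE [RHS]mxE /koszul -/J.
rewrite hx Fb0 !(mx_pder_tail _ _ _ Vy y0) nuE -!rowJ.
by rewrite -{1}[btail nu]/(btail nu) hessE -inner_bemb nuE.
Qed.

End BoundaryCurvature.

(** * Second-order estimate at the boundary *)

Section NormalLines.
Variables (R : realType) (d : nat).
Local Notation H := (halfspace R d).

(** The line through x which is parallel to the first axis, parametrized by the
    height above the boundary. *)
Definition at_height (x : 'rV[R]_d.+1) (s : R) : 'rV[R]_d.+1 :=
  (x - x 0 ord0 *: delta_mx 0 ord0) + s *: delta_mx 0 ord0.

Lemma at_heightE x : at_height x (x 0 ord0) = x.
Proof. by rewrite /at_height subrK. Qed.

Lemma at_height0 x s : at_height x s 0 ord0 = s.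
Proof. by rewrite /at_height deltaE !mxE eqxx mulr1 subrr add0r mulr1. Qed.

Lemma at_heightD x s t : at_height x s + t *: delta_mx 0 ord0 = at_height x (s + t).
Proof. by rewrite /at_height -addrA -scalerDl. Qed.

Lemma near_at_height (P : set 'rV[R]_d.+1) (z : 'rV[R]_d.+1) : z 0 ord0 = 0 ->
  (\forall x \near within H (nbhs z), P x) ->
  \forall x \near within H (nbhs z),
    forall s, 0 <= s <= (x : 'rV[R]_d.+1) 0 ord0 -> P (at_height x s).
Proof.
move=> z0 /= /nbhs_ballP[delta /= delta0 good].
apply/nbhs_ballP; exists delta => // x; rewrite -ball_normE /= => xz Hx s /andP[s0 sx].
apply: good; last by rewrite /halfspace /= at_height0.
rewrite -ball_normE /=; apply: le_lt_trans xz; apply: ler_norm_row => // k.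
apply: (le_trans _ (ler_coord_norm (z - x) k)).
have E (y : 'rV[R]_d.+1) l : (z - y) 0 l = z 0 l - y 0 l by rewrite !mxE.
rewrite !E; have [->|k0] := eqVneq k ord0.
  rewrite at_height0 z0 !sub0r !normrN !ger0_norm//; exact: le_trans sx.
by rewrite /at_height !mxE (negbTE k0) !andbF !mulr0 subr0 addr0.
Qed.

Lemma line_bound (U : set 'rV[R]_d.+1) f M (x : 'rV[R]_d.+1) s : Ck 1 U f -> 0 <= s ->
  (forall t, 0 <= t <= s -> U (at_height x t)) ->
  (forall t, 0 <= t <= s -> `|pder H f ord0 (at_height x t)| <= M) ->
  `|f (at_height x s) - f (at_height x 0)| <= M * s.
Proof.
move=> Cf; rewrite le_eqVlt => /predU1P[<- _ _|s0 US fM].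
  by rewrite subrr normr0 mulr0.
have [t th|t th|t th E] := @mean_value_line R d f ord0 (at_height x 0) s
  (fun t => pder H f ord0 (at_height x t)) s0.
- by rewrite at_heightD add0r /halfspace /= at_height0; case/andP: th.
- by rewrite at_heightD add0r; apply: (Ck_is_pder Cf); exact: US.
have th' : 0 <= t <= s by case/andP: th => ? ?; rewrite !ltW.
move: E; rewrite at_heightD add0r => ->.
by rewrite normrM (gtr0_norm s0) (ler_wpM2r (ltW s0))// fM.
Qed.

Lemma line_lower_bound (U : set 'rV[R]_d.+1) f m (x : 'rV[R]_d.+1) s : Ck 1 U f -> 0 < s ->
  (forall t, 0 <= t <= s -> U (at_height x t)) ->
  (forall t, 0 <= t <= s -> m <= pder H f ord0 (at_height x t)) ->
  m * s <= f (at_height x s) - f (at_height x 0).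
Proof.
move=> Cf s0 US fM.
have [t th|t th|t th E] := @mean_value_line R d f ord0 (at_height x 0) s
  (fun t => pder H f ord0 (at_height x t)) s0.
- by rewrite at_heightD add0r /halfspace /= at_height0; case/andP: th.
- by rewrite at_heightD add0r; apply: (Ck_is_pder Cf); exact: US.
have th' : 0 <= t <= s by case/andP: th => ? ?; rewrite !ltW.
move: E; rewrite at_heightD add0r => ->.
by rewrite (ler_wpM2r (ltW s0))// fM.
Qed.

Lemma Ck_bounded (U : set 'rV[R]_d.+1) f z : relopen U -> Ck 0 U f -> U z ->
  \forall x \near within H (nbhs z), `|f x| <= `|f z| + 1.
Proof.
move=> oU Cf Uz.
have : \forall x \near within H (nbhs z), `|f z - f x| <= 1.
  exact: (cvgr_dist_le _ _ (Ck_continuous oU Cf Uz) _ ltr01).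
apply: filterS => x fx; rewrite -[f x](subKr (f z)).
by rewrite (le_trans (ler_normB _ _))// lerD2l.
Qed.

End NormalLines.

(** On K rho = A rho + c B the derivative along the transverse lines is A' rho + g
    with g of class C^1; as K tends to zero, g vanishes on the boundary. So this
    derivative is O(x_0), hence the numerator is O(x_0^2), while rho is bounded
    below by a multiple of x_0. *)
Lemma quotient_bound (R : realType) (d : nat) (U : set 'rV[R]_d.+1)
    (A B rho K : 'rV[R]_d.+1 -> R) (c : R) (z : 'rV[R]_d.+1) :
  relopen U -> Ck 1 U A -> Ck 2 U B -> Ck 2 U rho ->
  (forall x : 'rV[R]_d.+1, U x -> x 0 ord0 = 0 -> B x = 0) ->
  (forall x, U x -> x 0 ord0 = 0 -> rho x = 0) ->
  (forall x, U x -> 0 < x 0 ord0 -> 0 < rho x) ->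
  (forall x, U x -> 0 < x 0 ord0 -> K x = A x + c * ((rho x)^-1 * B x)) ->
  (forall x, U x -> x 0 ord0 = 0 ->
    (fun h => K (x + h *: delta_mx 0 ord0)) @ increments (halfspace R d) ord0 x --> 0) ->
  U z -> z 0 ord0 = 0 -> 0 < pder (halfspace R d) rho ord0 z ->
  exists2 M, 0 < M & \forall x \near within (halfspace R d) (nbhs z),
    0 < (x : 'rV[R]_d.+1) 0 ord0 -> `|K x| <= M * rho x.
Proof.
set H := halfspace R d; move=> oU CA CB Crho B0 rho0 rhop KE Klim Uz z0 rz.
have [Hz nU] := oU z Uz.
pose g x := A x * pder H rho ord0 x + c * pder H B ord0 x.
have Cg : Ck 1 U g.
  apply: (CkD oU); last by apply: (CkZ oU); exact: Ck_pder.
  by apply: (CkM oU) => //; exact: Ck_pder.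
have C1B : Ck 1 U B by exact: CkS.
have C1rho : Ck 1 U rho by exact: CkS.
have dQ x : U x -> is_pder H (fun y => A y * rho y + c * B y) ord0 x
    (pder H A ord0 x * rho x + g x).
  move=> Ux; rewrite /g addrA; apply: is_pderD.
    by apply: is_pderM; [exact: (Ck_is_pder CA)|exact: (Ck_is_pder C1rho)].
  by apply: is_pderZ; exact: (Ck_is_pder C1B).
have m0 : 0 < pder H rho ord0 z / 2 by rewrite divr_gt0.
set m := _ / 2 in m0.
have low : \forall x \near within H (nbhs z), m <= pder H rho ord0 x.
  apply: (cvgr_ge _ (Ck_continuous oU (Ck_pder ord0 C1rho) Uz)).
  by rewrite /m ltr_pdivrMr// ltr_pMr// ltr1n.
have b1 := Ck_bounded oU (Ck_pder ord0 C1rho) Uz.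
have b2 := Ck_bounded oU (Ck_pder ord0 CA) Uz.
have b3 := Ck_bounded oU (Ck_pder ord0 Cg) Uz.
set M1 := `|_| + 1 in b1; set M2 := `|_| + 1 in b2; set M3 := `|_| + 1 in b3.
have M10 : 0 < M1 by rewrite ltr_wpDl. have M20 : 0 < M2 by rewrite ltr_wpDl.
have M30 : 0 < M3 by rewrite ltr_wpDl.
(* The transverse derivative of the numerator vanishes on the boundary. *)
have g0 x : U x -> x 0 ord0 = 0 -> g x = 0.
  move=> Ux x0; have [Hx _] := oU x Ux; have PF := increments_proper ord0 Hx.
  have dQx := dQ x Ux; rewrite rho0// mulr0 add0r in dQx.
  apply: (cvg_unique _ dQx) => //.
  have l1 := Klim x Ux x0; have l2 := Ck_is_pder (a := ord0) C1rho Ux.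
  apply: (near_cvg _ (cvgM l1 l2)); last by rewrite mul0r.
  apply: filterS2 (increments_pos Hx x0) (increments_rel oU ord0 Ux) => h h0 Uh.
  rewrite /= /diffquot (rho0 x)// (B0 x)// KE//.
  by have rp := rhop _ Uh h0; set k := h^-1; field; rewrite gt_eqF.
pose MQ := M2 * M1 + M3.
have MQ0 : 0 < MQ by rewrite addr_gt0// mulr_gt0.
exists (MQ / m * m^-1); first by rewrite mulr_gt0 ?invr_gt0// divr_gt0.
have good : \forall x \near within H (nbhs z), (U x /\ m <= pder H rho ord0 x) /\
   (`|pder H rho ord0 x| <= M1 /\ (`|pder H A ord0 x| <= M2 /\ `|pder H g ord0 x| <= M3)).
  exact: (filterI (filterI nU low) (filterI b1 (filterI b2 b3))).
apply: filterS (near_at_height z0 good) => x {}good x0.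
set t := x 0 ord0 in good x0; set b := at_height x 0.
have xE : x = at_height x t by rewrite at_heightE.
have Uy s : 0 <= s <= t -> U (at_height x s) by move=> /good[[]].
have Ub : U b by apply: Uy; rewrite lexx ltW.
have b0 : b 0 ord0 = 0 by exact: at_height0.
have sub s u : 0 <= s <= t -> 0 <= u <= s -> 0 <= u <= t.
  by move=> /andP[_ st] /andP[-> us]; rewrite (le_trans us st).
have rhoy s : 0 <= s <= t -> `|rho (at_height x s)| <= M1 * s.
  move=> st; rewrite -[rho _]subr0 -(rho0 b Ub b0).
  apply: (line_bound C1rho) => [|u us|u us]; first by case/andP: st.
    by apply: Uy; exact: sub us.
  by have [_ []] := good u (sub s u st us).
have gy s : 0 <= s <= t -> `|g (at_height x s)| <= M3 * s.
  move=> st; rewrite -[g _]subr0 -(g0 b Ub b0).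
  apply: (line_bound Cg) => [|u us|u us]; first by case/andP: st.
    by apply: Uy; exact: sub us.
  by have [_ [_ []]] := good u (sub s u st us).
have CQ : Ck 1 U (fun y => A y * rho y + c * B y).
  by apply: (CkD oU); [exact: (CkM oU)|exact: (CkZ oU)].
have tt : 0 <= t <= t by rewrite lexx ltW.
have Qx : `|A x * rho x + c * B x| <= MQ * t * t.
  have := line_bound (M := MQ * t) CQ (ltW x0) Uy; rewrite at_heightE -/b.
  rewrite (rho0 b Ub b0) (B0 b Ub b0) !mulr0 addr0 subr0; apply => s st.
  have [Hs _] := oU _ (Uy s st).
  rewrite (is_pder_pder Hs (dQ _ (Uy s st))).
  apply: (le_trans (ler_normD _ _)); rewrite normrM /MQ mulrDl -mulrA.
  have st' : s <= t by case/andP: st.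
  have [_ [_ [A2 _]]] := good s st.
  apply: lerD.
    apply: ler_pM => //; apply: (le_trans (rhoy s st)).
    by rewrite ler_wpM2l// ltW.
  apply: (le_trans (gy s st)); by rewrite ler_wpM2l// ltW.
have rx : m * t <= rho x.
  have := line_lower_bound (m := m) C1rho x0 Uy; rewrite at_heightE -/b (rho0 b Ub b0) subr0.
  by apply => s /good[[]].
have Ux : U x by rewrite xE; exact: Uy.
have r0 := rhop x Ux x0.
have -> : K x = (A x * rho x + c * B x) / rho x.
  by rewrite KE//; field; rewrite gt_eqF.
rewrite normrM normfV (gtr0_norm r0) ler_pdivrMr// (le_trans Qx)//.
have tr : t <= m^-1 * rho x by rewrite ler_pdivlMl.
rewrite -mulrA.
have -> : MQ / m / m * rho x * rho x = MQ * (m^-1 * rho x * (m^-1 * rho x)).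
  by field; rewrite gt_eqF.
by rewrite (ler_wpM2l (ltW MQ0))// ler_pM// ltW.
Qed.

(** * The boundary invariant in a pair of charts *)

Lemma normal_exists (R : realType) (p : nat) (G : 'M[R]_p.+1) (J : 'M[R]_(p, p.+1)) :
  exists2 nu, nu != 0 & normal G J nu.
Proof.
have : kermx (J *m G)^T != 0.
  by rewrite kermx_eq0 /row_free mxrank_tr neq_ltn (leq_ltn_trans (rank_leq_row _)).
move=> /rowV0Pn[nu /sub_kermxP nuK nu0]; exists nu => //.
by rewrite /normal -[LHS]trmxK trmx_mul trmxK nuK trmx0.
Qed.

Section LocalTheorem.
Variables (R : realType) (n : nat).
Local Notation H := (halfspace R n).
Local Notation H' := (halfspace R n.+1).
Variables (U : set 'rV[R]_n.+1) (V : set 'rV[R]_n.+2).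
Hypotheses (oU : relopen U) (oV : relopen V).
Variable F : 'rV[R]_n.+1 -> 'rV[R]_n.+2.
Hypothesis UV : forall x, U x -> V (F x).
Hypothesis CF : forall i, Ck 3 U (fun x => F x 0 i).
Hypothesis fJ : forall x, U x -> row_free (jac H F x).
Hypothesis bF : forall x, U x -> x 0 ord0 = 0 -> F x 0 ord0 = 0.
Hypothesis iF : forall x, U x -> 0 < x 0 ord0 -> 0 < F x 0 ord0.
Hypothesis tF : forall x, U x -> x 0 ord0 = 0 ->
  pder H (fun z => F z 0 ord0) ord0 x != 0.
Variable Gp : 'rV[R]_n.+2 -> 'M[R]_n.+2.
Hypothesis CGp : forall y, V y -> 0 < y 0 ord0 ->
  forall i j k, pderivable H' (fun z => Gp z i j) k y.
Variables (r : 'rV[R]_n.+2 -> R) (G : 'rV[R]_n.+2 -> 'M[R]_n.+2).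
Hypothesis C : local_compactification 1 V Gp r G.
Variables (r0 : 'rV[R]_n.+2 -> R) (G0 : 'rV[R]_n.+2 -> 'M[R]_n.+2).
Hypothesis C0 : local_compactification 3 V Gp r0 G0.
Hypothesis unit_gradient : forall y, V y -> y 0 ord0 = 0 ->
  inner (G y) (gradient H' G r y) (gradient H' G r y) = 1.
Hypothesis tangency : forall x nu, U x -> x 0 ord0 = 0 ->
  normal (G (F x)) (jac H F x) nu -> nu 0 ord0 = 0.

Local Notation mc := (mean_curvature H H').
Local Notation J x := (jac H F x).
Let CF2 i : Ck 2 U (fun x => F x 0 i). Proof. exact: CkS. Qed.
Let CF1 i : Ck 1 U (fun x => F x 0 i). Proof. exact: CkS. Qed.
Let C02 : local_compactification 2 V Gp r0 G0.
Proof. exact: (local_compactification_le (k := 3)). Qed.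
Let C01 : local_compactification 1 V Gp r0 G0.
Proof. exact: (local_compactification_le (k := 3)). Qed.

(** This is B(d_r, d_r): at the boundary v J is the gradient of r, by
    [gradient_tangent]. *)
Definition boundary_B00 x nu :=
  let v := gradient H' G r (F x) *m pinvmx (J x) in
  inner (second_ff H H' G F x nu) v v.

Definition boundary_limit x nu := mc G F x nu - n.+1%:R * boundary_B00 x nu.

Lemma boundary_limitZ x c nu : boundary_limit x (c *: nu) = c * boundary_limit x nu.
Proof.
rewrite /boundary_limit mean_curvatureZ /boundary_B00.
have -> : second_ff H H' G F x (c *: nu) = c *: second_ff H H' G F x nu.
  by apply/matrixP => a b; rewrite !mxE innerZr.
by rewrite innerZm; ring.
Qed.

Lemma boundary_limit_cvg (W : 'rV[R]_n.+1 -> 'rV[R]_n.+2) x :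
  (forall i, Ck 0 U (fun z => W z 0 i)) ->
  (forall z, U z -> normal (G (F z)) (J z) (W z)) -> U x -> x 0 ord0 = 0 ->
  (fun h => mc Gp F (x + h *: delta_mx 0 ord0) (W (x + h *: delta_mx 0 ord0)))
    @ increments H ord0 x --> boundary_limit x (W x).
Proof.
exact: (mean_curvature_limit oU oV UV CF2 fJ bF iF CGp C C02 unit_gradient tangency).
Qed.

Lemma boundary_limit_eta h x nu : U x -> x 0 ord0 = 0 ->
  (forall z, V (bemb z) -> h z = tail_mx (G (bemb z))) ->
  normal (G (F x)) (J x) nu ->
  mean_curvature setT setT h (fun z => btail (F (bemb z))) (btail x) (btail nu)
    - n%:R * boundary_B00 x nu = boundary_limit x nu.
Proof.
move=> Ux x0 hG nnu; have Vy := UV Ux; have y0 := bF Ux x0.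
have [v Xv vc] := gradient_tangent oU oV UV fJ bF C unit_gradient tangency Ux x0.
have vE : gradient H' G r (F x) *m pinvmx (J x) = v.
  by rewrite Xv -mulmxA mulmxVp ?fJ// mulmx1.
rewrite /boundary_limit /boundary_B00 vE.
rewrite (mean_curvature_split oU oV UV fJ bF (lc_posdef C) hG Ux x0
  (tangency Ux x0 nnu) (v := v)).
- by rewrite -natr1; ring.
- by apply: contra_eq_neq vc => ->; rewrite mul0r eq_sym oner_eq0.
- by rewrite -Xv unit_gradient.
- move=> a; rewrite -Xv (inner_gradient C _ Vy) (lc_diff1 oV C)// !mxE.
  by rewrite (@pder_boundary _ _ _ oU (fun z => F z 0 ord0)) ?mul0r.
Qed.

Lemma normal_conformal p (K : 'M[R]_(p, n.+2)) y nu : V y ->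
  normal (G0 y) K nu <-> normal (G y) K nu.
Proof.
move=> Vy; have [u _ uE] := conformal_factor oV C C01.
have [u0 _ ->] := uE y Vy; split; first exact: normalZm.
by apply: normalZmV; rewrite expf_neq0// gt_eqF.
Qed.

(** The limit is that of the curvature K along a normal field; for the unit
    normal of Gp, which is r / |W| times W, the curvature is K r / |W|, and so the
    hypothesis says that K is O(r). *)
Lemma boundary_limit_eq0 B e : 0 < e ->
  (forall x N, U x -> 0 < x 0 ord0 -> r (F x) < e ->
     unit_normal (Gp (F x)) (J x) N -> `|mc Gp F x N| <= B * r (F x) ^+ 2) ->
  forall x nu, U x -> x 0 ord0 = 0 -> normal (G (F x)) (J x) nu ->
    boundary_limit x nu = 0.
Proof.
move=> e0 NB x nu Ux x0 nnu; have [Hx _] := oU Ux; have Vy := UV Ux.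
have PF := increments_proper ord0 Hx.
have [->|nu0] := eqVneq nu 0.
  by rewrite -(scale0r 0) boundary_limitZ mul0r.
have CF0 i : Ck 0 U (fun z => F z 0 i) by exact: (CkS (CF1 i)).
have CG0 : Ckmx 0 V G by move=> i j; exact: CkS (lc_metric C i j).
pose W := normal_field F G nu.
have CW i : Ck 0 U (fun z => W z 0 i).
  exact: (Ck_normal_field oU oV UV fJ (lc_posdef C) CF1 CG0).
have nW z : U z -> normal (G (F z)) (J z) (W z).
  exact: (normal_field_normal UV fJ (lc_posdef C)).
have Wx : W x = nu by exact: (normal_field_id UV (lc_posdef C)).
have lK := boundary_limit_cvg CW nW Ux x0; rewrite Wx in lK.
have Cw : Ck 0 U (fun z => inner (G (F z)) (W z) (W z)).
  exact: (Ck_inner oU oV UV CF0 CG0 CW CW).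
have Crf : Ck 0 U (fun z => r (F z)) by exact: (Ck_comp oU oV UV CF0 (CkS (lc_fun C))).
pose pt h := x + h *: delta_mx 0 ord0 : 'rV[R]_n.+1.
have lw := cvg_increments oU ord0 Cw Ux.
have lr := cvg_increments oU ord0 Crf Ux.
have w0 : 0 < inner (G (F x)) (W x) (W x) by rewrite Wx; apply: (lc_posdef C Vy).2.
have rx : r (F x) = 0 by apply: (lc_zero C) => //; exact: bF.
rewrite rx in lr.
have c3 : \forall h \near increments H ord0 x, 0 < inner (G (F (pt h))) (W (pt h)) (W (pt h)).
  exact: (cvgr_gt _ lw _ w0).
have c4 : \forall h \near increments H ord0 x, r (F (pt h)) < e by exact: (cvgr_lt _ lr _ e0).
have ls := cvg_comp _ _ lw (@sqrt_continuous _ (inner (G (F x)) (W x) (W x))).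
have bnd : \forall h \near increments H ord0 x, `|mc Gp F (pt h) (W (pt h))|
    <= B * r (F (pt h)) * Num.sqrt (inner (G (F (pt h))) (W (pt h)) (W (pt h))).
  have c1 := increments_pos Hx x0; have c2 := increments_rel oU ord0 Ux.
  apply: filterS2 (filterI c1 c2) (filterI c3 c4) => h [h1 Uh] [wh rh].
  have rp := lc_pos C (UV Uh) (iF Uh h1).
  have := unit_normal_bound UV iF C Uh h1 (nW _ Uh) wh (fun N => NB _ N Uh h1 rh).
  have E (b s t : R) : t != 0 -> b * t ^+ 2 * (s / t) = b * t * s by move=> t0; field.
  by rewrite E// gt_eqF.
have : `|boundary_limit x nu| <= B * 0 * Num.sqrt (inner (G (F x)) (W x) (W x)).
  exact: (ler_cvg_to (cvg_norm lK) (cvgM (cvgM (cvg_cst B) lr) ls) bnd).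
by rewrite mulr0 mul0r normr_le0 => /eqP.
Qed.

(** The terms of the decomposition of K given by the special compactification are
    merely continuous, but the one given by (r0, G0) falls under
    [quotient_bound]. It remains to compare r with r0, and the unit normal with W,
    by factors which are bounded near z. *)
Lemma mean_curvature_local_bound z : U z -> z 0 ord0 = 0 ->
  (forall x nu, U x -> x 0 ord0 = 0 -> normal (G (F x)) (J x) nu ->
     boundary_limit x nu = 0) ->
  exists M, \forall x \near within H (nbhs z), 0 < (x : 'rV[R]_n.+1) 0 ord0 ->
    forall N, unit_normal (Gp (F x)) (J x) N -> `|mc Gp F x N| <= M * r (F x) ^+ 2.
Proof.
move=> Uz z0 L0; have [Hz nU] := oU Uz; have Vz := UV Uz; have y0 := bF Uz z0.
have [nu nu0 nnu] := normal_exists (G0 (F z)) (J z).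
pose W := normal_field F G0 nu.
have CW i : Ck 2 U (fun x => W x 0 i).
  apply: (Ck_normal_field oU oV UV fJ (lc_posdef C0) CF) => i' j'.
  exact: (lc_metric C02).
have nW0 x : U x -> normal (G0 (F x)) (J x) (W x).
  exact: (normal_field_normal UV fJ (lc_posdef C0)).
have nW x : U x -> normal (G (F x)) (J x) (W x).
  by move=> Ux; apply/(normal_conformal _ _ (UV Ux)); exact: nW0.
have Wz : W z = nu by exact: (normal_field_id UV (lc_posdef C0)).
pose rho x := r0 (F x).
have Crho : Ck 2 U rho by exact: (Ck_comp oU oV UV CF2 (CkS (lc_fun C0))).
have rhop x : U x -> 0 < x 0 ord0 -> 0 < rho x.
  by move=> Ux x0; apply: (lc_pos C0); [exact: UV|exact: iF].
have rho0 x : U x -> x 0 ord0 = 0 -> rho x = 0.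
  by move=> Ux x0; apply: (lc_zero C0); [exact: UV|exact: bF].
have drho : 0 < pder H rho ord0 z.
  have E : pder H rho ord0 z = J z ord0 ord0 * pder H' r0 ord0 (F z).
    have Lr := defining_function_cvg oU oV UV CF2 bF C01 (k := ord0) Uz z0.
    apply: (is_pder_pder Hz); apply: (near_cvg _ Lr) => //.
    by apply: nearW => h; rewrite /diffquot (rho0 z)// subr0.
  rewrite lt_neqAle eq_sym {1}E mulf_neq0 ?(lc_diff C0)//=; last by rewrite mxE tF.
  have PF := increments_proper ord0 Hz.
  apply: (cvgr_to_ge (Ck_is_pder (a := ord0) Crho Uz)).
  apply: filterS2 (increments_pos Hz z0) (increments_rel oU ord0 Uz) => h h0 Uh.
  have hp : 0 < h by move: h0; rewrite deltaE z0 eqxx mulr1 add0r.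
  rewrite /diffquot (rho0 z)// subr0; apply/ltW/mulr_gt0; first by rewrite invr_gt0.
  exact: rhop.
pose A x := mc G0 F x (W x).
have CA : Ck 1 U A.
  apply: (Ck_mean_curvature_field oU oV UV fJ (lc_posdef C0)) => //.
    exact: (lc_metric C02).
  by move=> i; exact: (CkS (CW i)).
pose B x := diff1 H' r0 (F x) (W x).
have CB : Ck 2 U B.
  apply: (Ck_sum oU) => k; apply: (CkM oU); first exact: CW.
  exact: (Ck_comp oU oV UV CF2 (Ck_pder k (lc_fun C0))).
have B0 x : U x -> x 0 ord0 = 0 -> B x = 0.
  move=> Ux x0; rewrite /B (lc_diff1 oV C01)//; [|exact: UV|exact: bF].
  by rewrite (tangency Ux x0 (nW x Ux)) mul0r.
pose K x := mc Gp F x (W x).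
have KE x : U x -> 0 < x 0 ord0 -> K x = A x + n.+1%:R * ((rho x)^-1 * B x).
  move=> Ux x0; rewrite /A (mean_curvature_interior oV UV fJ iF CGp C01 Ux x0 (nW0 x Ux)).
  by rewrite subrK.
have Klim x : U x -> x 0 ord0 = 0 ->
    (fun h => K (x + h *: delta_mx 0 ord0)) @ increments H ord0 x --> 0.
  move=> Ux x0; rewrite -(L0 x (W x) Ux x0 (nW x Ux)).
  exact: (boundary_limit_cvg (fun i => CkS (CkS (CW i))) nW Ux x0).
have [M M0 KM] := quotient_bound oU CA CB Crho B0 rho0 rhop KE Klim Uz z0 drho.
have [u Cu uE] := conformal_factor oV C C01.
have [uz _ _] := uE _ Vz.
have Cuf : Ck 1 U (fun x => u (F x)) by exact: (Ck_comp oU oV UV CF1 Cu).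
have u_low : \forall x \near within H (nbhs z), u (F z) / 2 <= u (F x).
  apply: (cvgr_ge _ (Ck_continuous oU Cuf Uz)).
  by rewrite ltr_pdivrMr// ltr_pMr// ltr1n.
have Cw : Ck 1 U (fun x => inner (G0 (F x)) (W x) (W x)).
  have CW1 i : Ck 1 U (fun x => W x 0 i) by exact: (CkS (CW i)).
  exact: (Ck_inner oU oV UV CF1 (lc_metric C01) CW1 CW1).
have wz : 0 < inner (G0 (F z)) (W z) (W z) by rewrite Wz; apply: (lc_posdef C0 Vz).2.
set m := inner (G0 (F z)) (W z) (W z) / 2.
have m0 : 0 < m by rewrite divr_gt0.
have w_low : \forall x \near within H (nbhs z), m <= inner (G0 (F x)) (W x) (W x).
  apply: (cvgr_ge _ (Ck_continuous oU Cw Uz)).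
  by rewrite /m ltr_pdivrMr// ltr_pMr// ltr1n.
have s0 : 0 < Num.sqrt m by rewrite sqrtr_gt0.
pose b := u (F z) / 2; have b0 : 0 < b by rewrite divr_gt0.
exists (M / Num.sqrt m / b ^+ 2).
have all_near : \forall x \near within H (nbhs z), (U x /\ (0 < x 0 ord0 -> `|K x| <= M * rho x))
   /\ (b <= u (F x) /\ m <= inner (G0 (F x)) (W x) (W x)).
  exact: (filterI (filterI nU KM) (filterI u_low w_low)).
apply: filterS all_near => x [[Ux Kx] [ux wx]] x0 N /unit_normalE[N1 nN].
have Vy := UV Ux; have yi := iF Ux x0; have rx := rhop x Ux x0.
have nN0 : normal (G0 (F x)) (J x) N by apply/(lc_normal_boundary C01 _ _ Vy yi).
have Wx0 : W x != 0.
  by apply: contraTneq wx => ->; rewrite inner0l -ltNge.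
have [c cE] := normal_line (fJ Ux) (lc_posdef C0 Vy) nN0 (nW0 x Ux) Wx0.
have cw : c ^+ 2 * inner (G0 (F x)) (W x) (W x) = rho x ^+ 2.
  have E : 1 = c ^+ 2 * inner (Gp (F x)) (W x) (W x).
    by rewrite -N1 cE innerZl innerZr expr2 mulrA.
  by rewrite (lc_conformal C0 Vy yi) innerZm mulrCA -E mulr1.
have cb : `|c| <= rho x / Num.sqrt m.
  have rs : 0 <= rho x / Num.sqrt m by rewrite ltW// divr_gt0.
  rewrite -(ler_pXn2r (n := 2))//.
  rewrite real_normK ?num_real// expr_div_n (sqr_sqrtr (ltW m0)) ler_pdivlMr// -cw.
  by rewrite (ler_wpM2l (sqr_ge0 c)).
have [_ rE _] := uE _ Vy.
have rhor : rho x <= r (F x) / b.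
  by rewrite ler_pdivlMr// rE mulrC ler_pM2r.
rewrite cE mean_curvatureZ normrM.
apply: (@le_trans _ _ (rho x / Num.sqrt m * (M * rho x))).
  by apply: ler_pM => //; exact: Kx.
have -> : rho x / Num.sqrt m * (M * rho x) = M / Num.sqrt m * rho x ^+ 2 by ring.
have -> : M / Num.sqrt m / b ^+ 2 * r (F x) ^+ 2 = M / Num.sqrt m * (r (F x) / b) ^+ 2.
  by field; rewrite !gt_eqF.
have Ms : 0 <= M / Num.sqrt m by rewrite ltW// divr_gt0.
rewrite (ler_wpM2l Ms)// ler_pXn2r// nnegrE; first exact: ltW.
exact: (le_trans (ltW rx) rhor).
Qed.

End LocalTheorem.

(** * Charts *)

(** This rules out that a boundary point has positive height in some chart: a
    defining function, or the first coordinate of the hypersurface, would be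
    critical there. *)
Lemma pder_interior_min (R : realType) (d : nat) (U : set 'rV[R]_d.+1) f a x :
  relopen U -> Ck 1 U f -> (forall z, U z -> 0 <= f z) -> U x ->
  0 < x 0 ord0 -> f x = 0 -> pder (halfspace R d) f a x = 0.
Proof.
move=> oU Cf f0 Ux x0 fx; have oI := relopen_interior oU.
have c0 : (fun h : R => x + h *: delta_mx 0 a) @ 0^' --> x.
  rewrite -[X in _ --> X]addr0 -[X in x + X](scale0r (delta_mx 0 a)).
  apply: cvgD; [exact: cvg_cst|apply: cvgZr_tmp].
  by move=> A A0; exact: nbhs_dnbhs A0.
have c1 : (fun h : R => (x + h *: delta_mx 0 a) 0 ord0) @ 0^' --> x 0 ord0.
  exact: (cvg_comp _ _ c0 (@coord_continuous R 1 d.+1 0 ord0 x)).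
have nH : \forall h \near (0 : R)^', halfspace R d (x + h *: delta_mx 0 a).
  by apply: filterS (cvgr_gt _ c1 _ x0) => h; rewrite /halfspace /= => /ltW.
have inc := dnbhs_increments nH.
have nU : \forall h \near (0 : R)^', U (x + h *: delta_mx 0 a).
  have [_ nU] := oU x Ux.
  exact: (inc _ (increments_pt a nU)).
apply: (@cvg_quotient_min _ (fun h => f (x + h *: delta_mx 0 a))).
  have L := cvg_trans (cvg_app (diffquot f a x) inc) (Ck_is_pder (a := a) Cf Ux).
  apply: (near_cvg _ L) => //; apply: nearW => h.
  by rewrite /diffquot fx subr0.
by apply: filterS nU => h; exact: f0.
Qed.

Section Charts.
Variables (R : realType) (T : topologicalType) (d : nat) (A : atlas R T d).
Variable c : regularity R.
Hypothesis hA : compact_manifold c A.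
Local Notation H := (halfspace R d).

Lemma chart_cover p : exists i : chart A, dom i p.
Proof. by case: hA => _ [_ [+ _]]; exact. Qed.

Lemma dom_open (i : chart A) : open (dom i).
Proof. by case: hA => _ [_ [_ [/(_ i)[]]]]. Qed.

Lemma img_open (i : chart A) : exists2 B, open B & img i = B `&` H.
Proof. by case: hA => _ [_ [_ [/(_ i)[_ []]]]]. Qed.

Lemma coordK (i : chart A) p : dom i p -> par i (coord i p) = p.
Proof. by case: hA => _ [_ [_ [/(_ i)[_ [_ [+ _]]]]]] _ => /(_ p). Qed.

Lemma coord_cont (i : chart A) : {within dom i, continuous (coord i)}.
Proof. by case: hA => _ [_ [_ [/(_ i)[_ [_ [_ []]]]]]]. Qed.

Lemma par_cont (i : chart A) : {within img i, continuous (par i)}.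
Proof. by case: hA => _ [_ [_ [/(_ i)[_ [_ [_ []]]]]]]. Qed.

Lemma transition_class : map_class c A A id.
Proof. by case: hA => _ [_ [_ [_ []]]]. Qed.

Lemma img_coord (i : chart A) p : dom i p -> img i (coord i p).
Proof. by move=> ip; exists p. Qed.

Lemma dom_par (i : chart A) x : img i x -> dom i (par i x).
Proof. by move=> [p ip <-]; rewrite coordK. Qed.

Lemma parK (i : chart A) x : img i x -> coord i (par i x) = x.
Proof. by move=> [p ip <-]; rewrite coordK. Qed.

Lemma img_halfspace (i : chart A) x : img i x -> H x.
Proof. by have [B oB ->] := img_open i; case. Qed.

Lemma relopen_chart (i : chart A) (S : set T) : open S ->
  relopen [set x | img i x /\ S (par i x)].
Proof.
move=> oS x [ix Sx]; split; first exact: img_halfspace ix.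
have nI : \forall y \near within H (nbhs x), img i y.
  have [B oB iB] := img_open i; have Bx : B x by move: ix; rewrite iB => -[].
  have nB : nbhs x B by exact: open_nbhs_nbhs.
  suff : nbhs x [set y | H y -> img i y] by [].
  by apply: filterS nB => y By Hy; rewrite iB.
have nS : \forall y \near within (img i) (nbhs x), S (par i y).
  have /subspace_continuousP/(_ x ix) c0 := par_cont (i := i).
  by apply: c0; exact: open_nbhs_nbhs.
have {}nI : nbhs x [set y | H y -> img i y] by exact: nI.
have {}nS : nbhs x [set y | img i y -> S (par i y)] by exact: nS.
suff : nbhs x [set y | H y -> img i y /\ S (par i y)] by [].
by apply: filterS2 nI nS => y HI IS /HI iy; split=> //; exact: IS.
Qed.

Lemma relopen_img (i : chart A) : relopen (img i).
Proof.
have := @relopen_chart i setT openT.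
by rewrite (_ : [set x | img i x /\ setT (par i x)] = img i)//; apply/seteqP; split => x // [].
Qed.

Lemma near_chart (i : chart A) p (P : set 'rV[R]_d.+1) : dom i p ->
  (\forall x \near within H (nbhs (coord i p)), P x) ->
  \forall q \near p, dom i q /\ P (coord i q).
Proof.
move=> ip nP; have nd : nbhs p (dom i) by apply: open_nbhs_nbhs; split=> //; exact: dom_open.
have /subspace_continuousP/(_ p ip) c0 := coord_cont (i := i).
have {}nP : nbhs (coord i p) [set x | H x -> P x] by exact: nP.
have nq : nbhs p [set q | dom i q -> H (coord i q) -> P (coord i q)] by exact: (c0 _ nP).
apply: filterS2 nd nq => q iq qP; split=> //; apply: qP => //.
exact: (img_halfspace (img_coord iq)).
Qed.

Lemma bdry_par (i : chart A) x : img i x -> x 0 ord0 = 0 -> bdry A (par i x).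
Proof. by move=> ix x0; exists i; split; [exact: dom_par|rewrite parK]. Qed.

End Charts.

(** * Compactifications in charts *)

Section Defining.
Variables (R : realType) (T : topologicalType) (d : nat) (A : atlas R T d).
Variable c : regularity R.
Hypothesis hA : compact_manifold c A.
Local Notation H := (halfspace R d).
Variables (cr cg : regularity R) (gp : tensor2 A) (r : T -> R) (g : tensor2 A).
Hypothesis hC : compactification cr cg gp r g.

Definition class_ge (k : nat) (c : regularity R) : bool :=
  match c with Cfin m | CHolder m _ => (k <= m)%N | Cinfty => true end.

Lemma class_geP k (U : set 'rV[R]_d.+1) f c' : class_ge k c' -> of_class c' U f -> Ck k U f.
Proof. by move=> ck fc; apply: (of_class_Ck fc); case: c' ck {fc}. Qed.

Lemma defining_ge0 p : 0 <= r p.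
Proof.
have [[_ [rp [r0 _]]] _] := hC.
have [pb|pb] := pselect (bdry A p); first by rewrite (r0 p).2.
exact/ltW/rp.
Qed.

Hypothesis crP : class_ge 1 cr.

(** The definition of [bdry] asks for height zero in one chart only. In another
    chart, r would have an interior minimum at a point where dr is not zero. *)
Lemma bdry_coord (i : chart A) p : dom i p -> bdry A p -> coord i p 0 ord0 = 0.
Proof.
move=> ip pb; have [[rc [rp [r0 rd]]] _] := hC.
have := img_halfspace hA (img_coord ip); rewrite /halfspace /= le_eqVlt => /predU1P[//|x0].
have [a /eqP[]] := rd i p ip pb.
apply: (pder_interior_min _ (relopen_img hA (i := i)) (class_geP crP (rc i))) => //.
- by move=> z _; exact: defining_ge0.
- exact: img_coord.
- by rewrite /= (coordK hA ip); exact/r0.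
Qed.

Lemma inter_par (i : chart A) x : img i x -> 0 < x 0 ord0 -> inter A (par i x).
Proof.
move=> ix x0 /(bdry_coord (dom_par hA ix)); rewrite (parK hA ix) => E.
by rewrite E ltxx in x0.
Qed.

Lemma inter_coord (i : chart A) p : dom i p -> inter A p -> 0 < coord i p 0 ord0.
Proof.
move=> ip pI; rewrite lt_neqAle (img_halfspace hA (img_coord ip)) andbT.
by apply/eqP => E; apply: pI; exists i.
Qed.

Lemma local_compactificationP k (i : chart A) : class_ge k.+1 cr -> class_ge k.+1 cg ->
  local_compactification k.+1 (img i) (gp i) (r \o par i) (g i).
Proof.
move=> kr kg; have [[rc [rp [r0 rd]]] [[gc [gpos _]] gr]] := hC.
have Cr : Ck k.+1 (img i) (r \o par i) by exact: (class_geP kr (rc i)).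
have z0 y : img i y -> y 0 ord0 = 0 -> (r \o par i) y = 0.
  by move=> iy y0 /=; apply/r0; exact: (bdry_par hA iy).
split=> //.
- move=> a b; have := class_geP kg (gc i a b).
  by apply: Ck_sub => y iy.
- move=> y iy; have [|sg pg] := gpos i (par i y) I; first exact: (dom_par hA).
  by move: sg pg; rewrite (parK hA iy).
- by move=> y iy y0; apply: rp; exact: inter_par.
- move=> y iy y0; have := gr i _ (inter_par iy y0) (dom_par hA iy).
  by rewrite (parK hA iy).
- move=> y iy y0; have [|a] := rd i _ (dom_par hA iy); first exact: (bdry_par hA iy).
  rewrite (parK hA iy); have [->//|a0] := eqVneq a ord0.
  by rewrite (pder_boundary (relopen_img hA (i := i)) z0)// eqxx.
Qed.

Lemma defining_near_gt p e : e < r p -> \forall q \near p, e < r q.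
Proof.
move=> pe; have [i ip] := chart_cover hA p.
have [[rc _] _] := hC.
have Cr := class_geP crP (rc i).
have L := Ck_continuous (relopen_img hA (i := i)) Cr (img_coord ip).
have P : \forall x \near within H (nbhs (coord i p)), e < (r \o par i) x.
  by apply: (cvgr_gt _ L); rewrite /= (coordK hA ip).
apply: filterS (near_chart hA ip P) => q [iq] /=; by rewrite (coordK hA iq).
Qed.

End Defining.

(** * Hypersurfaces in charts *)

Section Hypersurface.
Variables (R : realType) (n m : nat) (alpha : R).
Hypothesis hm : (3 <= m)%N.
Variables (M Y : topologicalType) (AM : atlas R M n.+1) (AY : atlas R Y n).
Variables (gp : tensor2 AM) (f : Y -> M).
Hypothesis hM : compact_manifold Cinfty AM.
Hypothesis hgp : metric_on (CHolder m alpha) (inter AM) gp.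
Variables (r0 : M -> R) (g0 : tensor2 AM).
Hypothesis hC0 : compactification Cinfty (CHolder m alpha) gp r0 g0.
Hypothesis hY : cc_hypersurface AM AY (CHolder m alpha) f.
Local Notation H := (halfspace R n).
Local Notation H' := (halfspace R n.+1).
Implicit Types (i : chart AY) (j : chart AM) (x : 'rV[R]_n.+1) (y : Y).

Let hAY : compact_manifold (CHolder m alpha) AY. Proof. by case: hY. Qed.

Lemma f_continuous : continuous f. Proof. by case: hY => _ [[]]. Qed.

Definition chart_pair (i : chart AY) (j : chart AM) : set 'rV[R]_n.+1 :=
  [set x | img i x /\ dom j (f (par i x))].

Lemma open_preimage_dom j : open (f @^-1` dom j).
Proof. by apply: open_comp; [move=> y _; exact: f_continuous|exact: (dom_open hM)]. Qed.

Lemma relopen_chart_pair i j : relopen (chart_pair i j).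
Proof. exact: (relopen_chart hAY (open_preimage_dom j)). Qed.

Lemma chart_pair_img i j x : chart_pair i j x -> img j (coord_map f i j x).
Proof. by move=> [_]; exact: img_coord. Qed.

Lemma chart_pairP i j y : dom i y -> dom j (f y) -> chart_pair i j (coord i y).
Proof. by move=> iy jy; split; [exact: img_coord|rewrite (coordK hAY iy)]. Qed.

Lemma coord_map_coord i j y : dom i y -> coord_map f i j (coord i y) = coord j (f y).
Proof. by move=> iy; rewrite /coord_map (coordK hAY iy). Qed.

Lemma Ck_coord_map i j k : Ck 3 (chart_pair i j) (fun x => coord_map f i j x 0 k).
Proof.
case: hY => _ [[_ /(_ i j k) Cf] _].
exact: (@class_geP _ _ 3 _ _ (CHolder m alpha)).
Qed.

Lemma jac_row_free i j x : chart_pair i j x -> row_free (jac H (coord_map f i j) x).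
Proof.
move=> [ix jx]; case: hY => _ [_ [/(_ i j (par i x)) fJ _]].
by rewrite -(parK hAY ix); apply: fJ => //; exact: (dom_par hAY).
Qed.

Lemma f_bdry y : bdry AM (f y) <-> bdry AY y.
Proof. by case: hY => _ [_ [_ [+ _]]]. Qed.

(** Transversality, on the component which is normal to the boundary. *)
Lemma normal_component i j y : bdry AY y -> dom i y -> dom j (f y) ->
  exists v : 'rV[R]_n.+1,
    \sum_a v 0 a * pder H (fun x => coord_map f i j x 0 ord0) a (coord i y) = 1.
Proof.
move=> yb iy jy; case: hY => _ [_ [_ [_ /(_ i j y yb iy jy) tr]]].
have [v [z E]] := tr (delta_mx 0 ord0); exists v.
have E1 : (v *m jac H (coord_map f i j) (coord i y)) 0 ord0 = 1.
  have := congr1 (fun u : 'rV[R]_n.+2 => u 0 ord0) E.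
  by rewrite [RHS]mxE bemb0 addr0 => <-; rewrite mxE !eqxx.
by rewrite -[RHS]E1 mxE; apply: eq_bigr => a _; rewrite mxE.
Qed.

(** As for [bdry_coord], with the first coordinate of f instead of r; it is not
    critical by transversality. *)
Lemma bdry_coordY i y : dom i y -> bdry AY y -> coord i y 0 ord0 = 0.
Proof.
move=> iy yb; have [j jy] := chart_cover hM (f y).
have := img_halfspace hAY (img_coord iy); rewrite /halfspace /= le_eqVlt => /predU1P[//|x0].
have Ux := chart_pairP iy jy; have oU := @relopen_chart_pair i j.
have [v] := normal_component yb iy jy.
rewrite big1 => [/eqP|a _]; first by rewrite eq_sym oner_eq0.
rewrite (pder_interior_min a oU (U := chart_pair i j)) ?mulr0//.
- exact: Ck_le (Ck_coord_map i j ord0).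
- by move=> z /chart_pair_img/(img_halfspace hM).
- rewrite coord_map_coord//; apply: (bdry_coord hM hC0) => //; exact/f_bdry.
Qed.

Lemma inter_parY i x : img i x -> 0 < x 0 ord0 -> inter AY (par i x).
Proof.
move=> ix x0 /(bdry_coordY (dom_par hAY ix)); rewrite (parK hAY ix) => E.
by rewrite E ltxx in x0.
Qed.

Lemma inter_coordY i y : dom i y -> inter AY y -> 0 < coord i y 0 ord0.
Proof.
move=> iy yI; rewrite lt_neqAle (img_halfspace hAY (img_coord iy)) andbT.
by apply/eqP => E; apply: yI; exists i.
Qed.

Lemma inter_f y : inter AY y -> inter AM (f y).
Proof. by move=> yI /f_bdry. Qed.

Lemma coord_map_bdry i j x : chart_pair i j x -> x 0 ord0 = 0 ->
  coord_map f i j x 0 ord0 = 0.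
Proof.
move=> [ix jx] x0; apply: (bdry_coord hM hC0) => //.
by apply/f_bdry; exact: (bdry_par hAY ix).
Qed.

Lemma coord_map_inter i j x : chart_pair i j x -> 0 < x 0 ord0 ->
  0 < coord_map f i j x 0 ord0.
Proof.
by move=> [ix jx] x0; apply: (inter_coord hM) => //; exact/inter_f/inter_parY.
Qed.

Lemma coord_map_transverse i j x : chart_pair i j x -> x 0 ord0 = 0 ->
  pder H (fun z => coord_map f i j z 0 ord0) ord0 x != 0.
Proof.
move=> [ix jx] x0; have yb := bdry_par hAY ix x0.
have [v] := normal_component yb (dom_par hAY ix) jx; rewrite (parK hAY ix).
rewrite (bigD1 ord0)//= big1 ?addr0 => [E|a a0].
  by apply: contra_eq_neq E => ->; rewrite mulr0 eq_sym oner_eq0.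
rewrite (@pder_boundary _ _ _ (@relopen_chart_pair i j)
  (fun z => coord_map f i j z 0 ord0)) ?mulr0//.
by move=> z; exact: coord_map_bdry.
Qed.

Lemma Ckmx_gp j : Ckmx 3 [set x | img j x /\ 0 < x 0 ord0] (gp j).
Proof.
move=> a b; case: hgp => /(_ j a b) Cg _.
apply: (Ck_sub _ (@class_geP _ _ 3 _ _ (CHolder m alpha) hm Cg)) => // x [jx x0].
by split=> //; exact: (inter_par hM hC0).
Qed.

Lemma gp_pderivable j (y : 'rV[R]_n.+2) : img j y -> 0 < y 0 ord0 ->
  forall a b k, pderivable H' (fun z => gp j z a b) k y.
Proof.
move=> jy y0 a b k; apply: (Ck_pderivable (@Ckmx_gp j a b)); by split.
Qed.

Lemma gp_posdef j (y : 'rV[R]_n.+2) : img j y -> 0 < y 0 ord0 -> posdef (gp j y).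
Proof.
move=> jy y0; case: hgp => _ [/(_ j (par j y) (inter_par hM hC0 isT jy y0)) + _].
by rewrite (parK hM jy); apply; exact: (dom_par hM).
Qed.

(** This and the next lemma transport a bound from one pair of charts to another.
    They are restricted to the interior, where gp is differentiable. *)
Lemma mean_curvature_chart_target i j j' y N : inter AY y -> dom i y ->
  dom j (f y) -> dom j' (f y) -> hyp_unit_normal f gp i j' y N ->
  exists2 N', hyp_unit_normal f gp i j y N' &
    hyp_mean_curvature f gp i j' y N = hyp_mean_curvature f gp i j y N'.
Proof.
move=> yI iy jy jy' [N1 nN]; set x := coord i y.
have x0 : 0 < x 0 ord0 by exact: inter_coordY.
pose U := [set z | [set z | img i z /\ (f @^-1` (dom j `&` dom j')) (par i z)] z /\ 0 < z 0 ord0].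
pose V := [set z | [set z | img j z /\ dom j' (par j z)] z /\ 0 < z 0 ord0].
pose V' := [set z | img j' z /\ 0 < z 0 ord0].
have oU : relopen U.
  apply/relopen_interior/(relopen_chart hAY); rewrite preimage_setI.
  by apply: openI; exact: open_preimage_dom.
have oV : relopen V by apply/relopen_interior/(relopen_chart hM)/(dom_open hM).
have oV' : relopen V' by apply/relopen_interior/(relopen_img hM).
pose F := coord_map f i j; pose psi : 'rV[R]_n.+2 -> 'rV[R]_n.+2 := coord_map id j j'.
have UV z : U z -> V (F z).
  move=> [[iz [jz jz']] z0]; split; last exact: coord_map_inter.
  by split; [exact: img_coord|rewrite /F /coord_map (coordK hM jz)].
have VV' z : V z -> V' (psi z).
  move=> [[jz jz'] z0]; split; first exact: img_coord.
  by apply: (inter_coord hM) => //; exact: (inter_par hM hC0).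
have CF k : Ck 2 U (fun z => F z 0 k).
  apply: (Ck_sub _ (Ck_le (k := 2) _ (Ck_coord_map i j k))) => // z [[iz [jz _]] _].
  by split.
have Cpsi k : Ck 2 V (fun z => psi z 0 k).
  have [_ /(_ j j' k) T] := transition_class hM.
  by apply: (Ck_sub _ (T 2%N)) => z [].
have GG' z : V z -> gp j z = jac H' psi z *m gp j' (psi z) *m (jac H' psi z)^T.
  move=> [[jz jz'] z0]; have pI := inter_par hM hC0 isT jz z0.
  case: hgp => _ [_ /(_ j j' (par j z) pI (dom_par hM jz) jz')].
  by rewrite (parK hM jz).
have CG' : Ckmx 1 V' (gp j') by move=> a b; exact: (Ck_le (k := 1) _ (@Ckmx_gp j' a b)).
have Ux : U x.
  by split=> //; split; [exact: img_coord|rewrite /x (coordK hAY iy)].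
have Fx : F x = coord j (f y) by exact: coord_map_coord.
have psiF : psi (F x) = coord j' (f y).
  by rewrite Fx /psi /coord_map (coordK hM jy).
have Vy := UV x Ux; have [[jV _] V0] := Vy; have [jV' V0'] := VV' _ Vy.
have pG := gp_posdef jV V0; have pG' := gp_posdef jV' V0'.
set P := jac H' psi (F x); have EG : gp j (F x) = P *m gp j' (psi (F x)) *m P^T := GG' _ Vy.
have uP : P \in unitmx.
  by have := posdef_unit pG; rewrite EG !unitmx_mul => /andP[/andP[]].
have FE z : U z -> psi (F z) = coord_map f i j' z.
  by move=> [[_ [jz _]] _]; rewrite /psi /F /coord_map (coordK hM jz).
have JE : jac H (coord_map f i j') x = jac H F x *m P.
  rewrite -(jac_comp oU oV UV CF Cpsi Ux); apply/matrixP => a k; rewrite !mxE.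
  by apply: (pder_eq_relopen _ oU _ Ux) => z Uz; rewrite FE.
pose N' := N *m invmx P.
have NE : N' *m P = N by rewrite /N' mulmxKV.
exists N'.
  rewrite /hyp_unit_normal -Fx; split.
    by rewrite EG inner_mul NE psiF.
  by move=> v; rewrite EG inner_mul NE psiF -mulmxA -JE; exact: nN.
rewrite /hyp_mean_curvature -/x.
rewrite -(mean_curvature_eq _ _ _ oU FE Ux) -{1}NE.
by rewrite -(mean_curvature_target oU oV oV' UV VV' CF Cpsi CG' GG' N' Ux pG pG').
Qed.

Lemma mean_curvature_chart_source i i' j y N : inter AY y -> dom i y ->
  dom i' y -> dom j (f y) -> hyp_unit_normal f gp i' j y N ->
  hyp_unit_normal f gp i j y N /\
    hyp_mean_curvature f gp i' j y N = hyp_mean_curvature f gp i j y N.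
Proof.
move=> yI iy iy' jy [N1 nN]; set x := coord i' y.
have x0 : 0 < coord i y 0 ord0 by exact: inter_coordY.
pose V := [set z | img i' z /\ (dom i `&` f @^-1` dom j) (par i' z)].
have oV : relopen V.
  apply: (relopen_chart hAY); apply: openI; [exact: (dom_open hAY)|exact: open_preimage_dom].
have oU := @relopen_chart_pair i j.
pose F := coord_map f i j; pose phi : 'rV[R]_n.+1 -> 'rV[R]_n.+1 := coord_map id i' i.
have VU z : V z -> chart_pair i j (phi z).
  move=> [_ [iz jz]]; split; first exact: img_coord.
  by rewrite /phi /coord_map (coordK hAY iz).
have CF k : Ck 2 (chart_pair i j) (fun z => F z 0 k).
  exact: Ck_le (Ck_coord_map i j k).
have Cphi k : Ck 2 V (fun z => phi z 0 k).
  have [_ /(_ i' i k) T] := transition_class hAY.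
  have : Ck 2 [set z | img i' z /\ dom i (par i' z)] (fun z => phi z 0 k).
    apply: (@class_geP _ _ 2 _ _ (CHolder m alpha)) => //=; exact: leq_trans hm.
  by apply: Ck_sub => z [? []].
have Vx : V x by split; [exact: img_coord|rewrite /x (coordK hAY iy')].
have phix : phi x = coord i y by rewrite /phi /x /coord_map (coordK hAY iy').
have FE z : V z -> F (phi z) = coord_map f i' j z.
  by move=> [_ [iz _]]; rewrite /phi /F /coord_map (coordK hAY iz).
have Ux := VU x Vx.
have Fx : F (phi x) = coord j (f y) by rewrite phix; exact: coord_map_coord.
set P := jac H phi x.
have JE : jac H (coord_map f i' j) x = P *m jac H F (phi x).
  rewrite -(jac_comp oV oU VU Cphi CF Vx); apply/matrixP => a k; rewrite !mxE.
  by apply: (pder_eq_relopen _ oV _ Vx) => z Vz; rewrite FE.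
have uP : P \in unitmx.
  have fJ : row_free (P *m jac H F (phi x)).
    rewrite -JE; apply: jac_row_free; exact: chart_pairP.
  rewrite -row_free_unit -kermx_eq0; apply/rowV0P => u /sub_kermxP uP.
  have := mulmx_free_eq0 u fJ; rewrite mulmxA uP mul0mx eqxx => /esym/eqP //.
have nN' v : inner (gp j (coord j (f y))) (v *m jac H F (phi x)) N = 0.
  by rewrite -[v](mulmxKV uP) -(mulmxA (v *m invmx P)) -JE; exact: nN.
have pI : 0 < F (phi x) 0 ord0 by apply: coord_map_inter => //; rewrite phix.
have pG : posdef (gp j (F (phi x))) by apply: gp_posdef => //; exact: chart_pair_img.
split; first by split=> [|v]; [exact: N1|rewrite -phix; exact: nN'].
rewrite /hyp_mean_curvature -/x -(mean_curvature_eq _ _ _ oV FE Vx).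
rewrite (mean_curvature_reparam oU oV VU CF Cphi H' Vx pG (jac_row_free Ux) uP).
  by rewrite phix.
by apply: normal_of_inner => v; rewrite Fx.
Qed.

End Hypersurface.

(** * The boundary invariant and the order of vanishing *)

Lemma tangency_charts (R : realType) (n m : nat) (alpha : R) (hm : (3 <= m)%N)
  (M Y : topologicalType) (AM : atlas R M n.+1) (AY : atlas R Y n)
  (gp : tensor2 AM) (f : Y -> M) (hM : compact_manifold Cinfty AM)
  (hgp : metric_on (CHolder m alpha) (inter AM) gp)
  (r0 : M -> R) (g0 : tensor2 AM)
  (hC0 : compactification Cinfty (CHolder m alpha) gp r0 g0)
  (hY : cc_hypersurface AM AY (CHolder m alpha) f)
  (r : M -> R) (gb : tensor2 AM)
  (hC : compactification (Cfin 1) (Cfin 1) gp r gb)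
  (hO : mean_curvature_bigO AY f gp r 1) (i : chart AY) (j : chart AM)
  (x : 'rV[R]_n.+1) (nu : 'rV[R]_n.+2) :
  chart_pair f i j x -> x 0 ord0 = 0 ->
  normal (gb j (coord_map f i j x)) (jac (halfspace R n) (coord_map f i j) x) nu ->
  nu 0 ord0 = 0.
Proof.
have [B [e [e0 Be]]] := hO.
have hAY : compact_manifold (CHolder m alpha) AY by case: hY.
apply: (tangency_of_bounded_mean_curvature (@relopen_chart_pair _ _ _ _ _ _ _ _ _ hM hY i j)
  (relopen_img hM (i := j)) (@chart_pair_img _ _ _ _ _ _ f i j) _
  (@jac_row_free _ _ _ _ _ _ _ _ _ hY i j) (@coord_map_bdry _ _ _ _ _ _ _ _ _ _ hM _ _ hC0 hY i j)
  (@coord_map_inter _ _ _ _ hm _ _ _ _ _ _ hM _ _ hC0 hY i j)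
  (fun y => @gp_pderivable _ _ _ _ hm _ _ _ hM hgp _ _ hC0 j y)
  (local_compactificationP hM hC isT (k := 0) j isT isT) (B := B) e0).
  by move=> k; exact: Ck_le (Ck_coord_map hm hY i j k).
move=> z N [iz jz] z0 rz uN; rewrite -[leRHS]/(B * r (par j (coord j (f (par i z))))).
have yI := inter_parY hm hM hC0 hY iz z0.
move: rz; rewrite /coord_map /= (coordK hM jz) => rz.
have := Be (par i z) yI rz i j N (dom_par hAY iz) jz.
rewrite /hyp_unit_normal /hyp_mean_curvature (parK hAY iz) expr1; exact.
Qed.

Section Special.
Variables (R : realType) (n m : nat) (alpha : R).
Hypothesis hm : (3 <= m)%N.
Variables (M Y : topologicalType) (AM : atlas R M n.+1) (AY : atlas R Y n).
Variables (gp : tensor2 AM) (f : Y -> M).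
Hypothesis hM : compact_manifold Cinfty AM.
Hypothesis hgp : metric_on (CHolder m alpha) (inter AM) gp.
Variables (r0 : M -> R) (g0 : tensor2 AM).
Hypothesis hC0 : compactification Cinfty (CHolder m alpha) gp r0 g0.
Hypothesis hY : cc_hypersurface AM AY (CHolder m alpha) f.
Local Notation H := (halfspace R n).
Local Notation H' := (halfspace R n.+1).
Implicit Types (i : chart AY) (j : chart AM) (x : 'rV[R]_n.+1) (y : Y).
Let hAY : compact_manifold (CHolder m alpha) AY. Proof. by case: hY. Qed.

Local Notation U i j := (chart_pair f i j).
Local Notation F i j := (coord_map f i j).

Hypothesis tang : forall i j x nu, U i j x -> x 0 ord0 = 0 ->
  normal (g0 j (F i j x)) (jac H (F i j) x) nu -> nu 0 ord0 = 0.

Variables (h : btensor2 AM) (r : M -> R) (gb : tensor2 AM).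
Hypothesis hS : special_defining_function gp h r gb.

Let hC : compactification (Cfin 1) (Cfin 1) gp r gb. Proof. by case: hS. Qed.

Let oU i j : relopen (U i j). Proof. exact: (relopen_chart_pair hM hY). Qed.
Let oV j : relopen (img j). Proof. exact: (relopen_img hM). Qed.
Let UV i j x : U i j x -> img j (F i j x). Proof. exact: chart_pair_img. Qed.
Let CF i j k : Ck 3 (U i j) (fun x => F i j x 0 k).
Proof. exact: (Ck_coord_map hm hY). Qed.
Let fJ i j x : U i j x -> row_free (jac H (F i j) x).
Proof. exact: (jac_row_free hY). Qed.
Let bF i j x : U i j x -> x 0 ord0 = 0 -> F i j x 0 ord0 = 0.
Proof. exact: (coord_map_bdry hM hC0 hY). Qed.
Let iF i j x : U i j x -> 0 < x 0 ord0 -> 0 < F i j x 0 ord0.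
Proof. exact: (coord_map_inter hm hM hC0 hY). Qed.
Let tF i j x : U i j x -> x 0 ord0 = 0 ->
  pder H (fun z => F i j z 0 ord0) ord0 x != 0.
Proof. exact: (coord_map_transverse hM hC0 hY). Qed.
Let CGp j (y : 'rV[R]_n.+2) : img j y -> 0 < y 0 ord0 ->
  forall a b k, pderivable H' (fun z => gp j z a b) k y.
Proof. exact: (gp_pderivable hm hM hgp hC0). Qed.

Lemma special_local j : local_compactification 1 (img j) (gp j) (r \o par j) (gb j).
Proof. exact: (local_compactificationP hM hC isT). Qed.

Lemma smooth_local j : local_compactification 3 (img j) (gp j) (r0 \o par j) (g0 j).
Proof. exact: (local_compactificationP hM hC0 isT). Qed.

Lemma special_unit_gradient j (y : 'rV[R]_n.+2) : img j y -> y 0 ord0 = 0 ->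
  inner (gb j y) (gradient H' (gb j) (r \o par j) y)
    (gradient H' (gb j) (r \o par j) y) = 1.
Proof.
move=> jy y0; case: hS => _ [[V [_ [bV /(_ j (par j y)) V1]]] _].
have := V1 (bV _ (bdry_par hM jy y0)) (dom_par hM jy).
by rewrite (parK hM jy).
Qed.

Lemma special_tangency i j x nu : U i j x -> x 0 ord0 = 0 ->
  normal (gb j (F i j x)) (jac H (F i j) x) nu -> nu 0 ord0 = 0.
Proof.
move=> Ux x0 nnu; apply: (tang Ux x0).
by apply/(normal_conformal (@oV j) (special_local j) (smooth_local j) _ _ (UV Ux)).
Qed.

Definition special_limit i j := boundary_limit (F i j) (r \o par j) (gb j).

Lemma eta_nB00_limit i j y nu : bdry AY y -> dom i y -> dom j (f y) ->
  hyp_unit_normal f gb i j y nu ->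
  eta_nB00 f h r gb i j y nu = special_limit i j (coord i y) nu.
Proof.
move=> yb iy jy [_ nnu]; have Ux := chart_pairP hY iy jy.
have x0 := bdry_coordY hm hM hC0 hY iy yb.
have Fx : F i j (coord i y) = coord j (f y) := coord_map_coord hY j iy.
have hG z : img j (bemb z) -> h j z = tail_mx (gb j (bemb z)).
  by move=> jz; case: hS => _ [_ /(_ j z jz) <-].
have nn : normal (gb j (F i j (coord i y))) (jac H (F i j) (coord i y)) nu.
  by apply: normal_of_inner => v; rewrite Fx; exact: nnu.
rewrite /special_limit -(boundary_limit_eta (@oU i j) (@oV j) (@UV i j) (@fJ i j)
  (@bF i j) (special_local j) (@special_unit_gradient j) (@special_tangency i j) Ux x0 hG nn).
by rewrite /eta_nB00 /eta /B00 /dr_tangent /boundary_B00 -Fx.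
Qed.

Lemma special_limit_cvg i j (W : 'rV[R]_n.+1 -> 'rV[R]_n.+2) x :
  (forall k, Ck 0 (U i j) (fun z => W z 0 k)) ->
  (forall z, U i j z -> normal (gb j (F i j z)) (jac H (F i j) z) (W z)) ->
  U i j x -> x 0 ord0 = 0 ->
  (fun e => mean_curvature H H' (gp j) (F i j) (x + e *: delta_mx 0 ord0)
     (W (x + e *: delta_mx 0 ord0)))
    @ increments H ord0 x --> special_limit i j x (W x).
Proof.
exact: (boundary_limit_cvg (@oU i j) (@oV j) (@UV i j) (@CF i j) (@fJ i j)
  (@bF i j) (@iF i j) (@CGp j) (special_local j) (smooth_local j)
  (@special_unit_gradient j) (@special_tangency i j)).
Qed.

Lemma special_limit_eq0 : mean_curvature_bigO AY f gp r 2 ->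
  forall i j x nu, U i j x -> x 0 ord0 = 0 ->
  normal (gb j (F i j x)) (jac H (F i j) x) nu -> special_limit i j x nu = 0.
Proof.
move=> [B [e [e0 Be]]] i j.
apply: (boundary_limit_eq0 (@oU i j) (@oV j) (@UV i j) (@CF i j) (@fJ i j)
  (@bF i j) (@iF i j) (@CGp j) (special_local j) (smooth_local j)
  (@special_unit_gradient j) (@special_tangency i j) e0 (B := B)).
move=> z N [iz jz] z0; rewrite /coord_map /= (coordK hM jz) => rz uN.
have := Be (par i z) (inter_parY hm hM hC0 hY iz z0) rz i j N (dom_par hAY iz) jz.
rewrite /hyp_unit_normal /hyp_mean_curvature (parK hAY iz); exact.
Qed.

(** The single parameter A, at once the bound and the inverse of the width of the
    collar, is what allows a covering argument; near an interior point the collar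
    is empty for A large. *)
Lemma mean_curvature_near_bound y0 :
  (forall i j x nu, U i j x -> x 0 ord0 = 0 ->
     normal (gb j (F i j x)) (jac H (F i j) x) nu -> special_limit i j x nu = 0) ->
  \forall y \near y0 & A \near +oo, inter AY y -> r (f y) < A^-1 ->
    forall i j N, dom i y -> dom j (f y) -> hyp_unit_normal f gp i j y N ->
    `|hyp_mean_curvature f gp i j y N| <= A * r (f y) ^+ 2.
Proof.
move=> L0; have [yb|yI] := pselect (bdry AY y0); last first.
  have p0 : 0 < r (f y0).
    by have [[_ [rp _]] _] := hC; apply: rp; exact: (inter_f hY).
  have p2 : r (f y0) / 2 < r (f y0) by rewrite ltr_pdivrMr// ltr_pMr// ltr1n.
  have nr := f_continuous hY (defining_near_gt hM hC isT p2).
  exists ([set y | r (f y0) / 2 < r (f y)], [set A | (r (f y0) / 2)^-1 < A]) => /=.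
    by split; [exact: nr|exact: (nbhs_pinfty_gt (num_real _))].
  move=> [y A] /= [ry Ay] yI' rA; exfalso.
  have := lt_trans ry rA; rewrite ltNge => /negP; apply.
  have q0 : 0 < r (f y0) / 2 by rewrite divr_gt0.
  by rewrite -[leRHS]invrK lef_pV2 ?posrE ?invr_gt0// ?ltW// (lt_trans _ Ay)// invr_gt0.
have [i iy] := chart_cover hAY y0; have [j jy] := chart_cover hM (f y0).
have Uz := chart_pairP hY iy jy; have z0 := bdry_coordY hm hM hC0 hY iy yb.
have [B NB] := mean_curvature_local_bound (@oU i j) (@oV j) (@UV i j) (@CF i j) (@fJ i j)
  (@bF i j) (@iF i j) (@tF i j) (@CGp j) (special_local j) (smooth_local j)
  (@special_unit_gradient j) (@special_tangency i j) Uz z0 (L0 i j).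
have nU : \forall x \near within H (nbhs (coord i y0)), U i j x by have [] := oU Uz.
have nUB : \forall x \near within H (nbhs (coord i y0)), U i j x /\
   (0 < x 0 ord0 -> forall N, unit_normal (gp j (F i j x)) (jac H (F i j) x) N ->
   `|mean_curvature H H' (gp j) (F i j) x N| <= B * (r \o par j) (F i j x) ^+ 2).
  exact: filterI nU NB.
exists ([set y | dom i y /\ (U i j (coord i y) /\ (0 < coord i y 0 ord0 -> forall N,
   unit_normal (gp j (F i j (coord i y))) (jac H (F i j) (coord i y)) N ->
   `|mean_curvature H H' (gp j) (F i j) (coord i y) N|
      <= B * (r \o par j) (F i j (coord i y)) ^+ 2))], [set A | B < A]) => /=.
  by split; [exact: (near_chart hAY iy nUB)|exact: (nbhs_pinfty_gt (num_real _))].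
move=> [y A] /= [[iy' [[_ jy'] Bb]] BA] yI _ i' j' N' iy'' jy'' uN.
rewrite (coordK hAY iy') in jy'.
have [uN1 ->] := mean_curvature_chart_source hm hM hgp hC0 hY yI iy' iy'' jy'' uN.
have [N2 uN2 ->] := mean_curvature_chart_target hm hM hgp hC0 hY yI iy' jy' jy'' uN1.
have := Bb (inter_coordY hY iy' yI) N2.
rewrite (coord_map_coord hY j iy') (coordK hM jy') => /(_ uN2) le.
by apply: (le_trans le); rewrite ler_wpM2r ?sqr_ge0// ltW.
Qed.

Lemma mean_curvature_bigO2 :
  (forall i j x nu, U i j x -> x 0 ord0 = 0 ->
     normal (gb j (F i j x)) (jac H (F i j) x) nu -> special_limit i j x nu = 0) ->
  mean_curvature_bigO AY f gp r 2.
Proof.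
move=> L0; have cY : compact [set: Y] by case: hAY => _ [].
have /compact_near_coveringP/(_ R (pinfty_nbhs R) (fun A y => inter AY y -> r (f y) < A^-1 ->
    forall i j N, dom i y -> dom j (f y) -> hyp_unit_normal f gp i j y N ->
    `|hyp_mean_curvature f gp i j y N| <= A * r (f y) ^+ 2)) cov := cY.
have near_A := cov _ (fun y _ => @mean_curvature_near_bound y L0).
have [A [A0 AY']] := filter_ex (filterI (nbhs_pinfty_gt (num_real 0)) (near_A _)).
exists A, A^-1; split; first by rewrite invr_gt0.
by move=> y yI ry i j N iy jy uN; exact: AY'.
Qed.

End Special.

Theorem proposition1p10 (R : realType) (n m : nat) (alpha : R)
  (hm : (3 <= m)%N) (halpha : 0 < alpha < 1)
  (M Y : topologicalType) (AM : atlas R M n.+1) (AY : atlas R Y n)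
  (gp : tensor2 AM) (f : Y -> M)
  (hM : compact_manifold Cinfty AM)
  (hgp : poincare_einstein (CHolder m alpha) gp)
  (ghat gtil : btensor2 AM) (w : M -> R)
  (hghat : in_conformal_infinity (CHolder m alpha) gp ghat)
  (hgtil : in_conformal_infinity (CHolder m alpha) gp gtil)
  (hw : bconformal w ghat gtil)
  (r rho : M -> R) (gbar gbart : tensor2 AM)
  (hr : special_defining_function gp ghat r gbar)
  (hrho : special_defining_function gp gtil rho gbart)
  (hY : asymptotically_minimal AY (CHolder m alpha) f gp r) :
  (forall (i : chart AY) (j : chart AM) (y : Y) (nu nut : 'rV[R]_n.+2),
     bdry AY y -> dom i y -> dom j (f y) ->
     hyp_unit_normal f gbar i j y nu -> hyp_unit_normal f gbart i j y nut ->
     (exists2 c : R, 0 < c & nut = c *: nu) ->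
     eta_nB00 f ghat r gbar i j y nu
     = expR (w (f y)) * eta_nB00 f gtil rho gbart i j y nut)
  /\
  ((forall (i : chart AY) (j : chart AM) (y : Y) (nu : 'rV[R]_n.+2),
      bdry AY y -> dom i y -> dom j (f y) ->
      hyp_unit_normal f gbar i j y nu ->
      eta_nB00 f ghat r gbar i j y nu = 0)
   <-> mean_curvature_bigO AY f gp r 2).
Proof.
have [[hgm [_ [r0 [g0 hC0]]]] _] := hgp; have [hcc hO] := hY.
have hC : compactification (Cfin 1) (Cfin 1) gp r gbar by case: hr.
have hAY : compact_manifold (CHolder m alpha) AY by case: hcc.
have lr := special_local hM hr; have lrho := special_local hM hrho.
have oV j := relopen_img hM (i := j).
have tang (i : chart AY) (j : chart AM) (x : 'rV[R]_n.+1) (nu : 'rV[R]_n.+2) :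
    chart_pair f i j x -> x 0 ord0 = 0 ->
    normal (g0 j (coord_map f i j x)) (jac (halfspace R n) (coord_map f i j) x) nu ->
    nu 0 ord0 = 0.
  move=> Ux x0 nnu; apply: (tangency_charts hm hM hgm hC0 hcc hC hO Ux x0).
  exact: (normal_conformal (oV j) (lr j) (smooth_local hm hM hC0 j) _ _ (chart_pair_img Ux)).1.
split.
  move=> i j y nu nut yb iy jy unu unut [c c0 nutE].
  have Ux := chart_pairP hcc iy jy; set x := coord i y in Ux.
  have x0 : x 0 ord0 = 0 := bdry_coordY hm hM hC0 hcc iy yb.
  have Fx : coord_map f i j x = coord j (f y) := coord_map_coord hcc j iy.
  rewrite (eta_nB00_limit hm hM hC0 hcc tang hr yb iy jy unu).
  rewrite (eta_nB00_limit hm hM hC0 hcc tang hrho yb iy jy unut) -/x.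
  have Vy := chart_pair_img Ux; have y0 := coord_map_bdry hM hC0 hcc Ux x0.
  rewrite nutE /special_limit boundary_limitZ.
  have [s _ sE] := conformal_factor (oV j) (lrho j) (lr j).
  have [s0 _ Gs] := sE _ Vy.
  (* With gbart = s^2 gbar, the lengths of the normals give c = 1 / s, and the
     boundary metrics give s = expR w. *)
  have cs : c * s (coord_map f i j x) = 1.
    have [n1 _] := unu; have [n2 _] := unut.
    move: n2; rewrite nutE -Fx innerZl innerZr Gs innerZm Fx n1 mulr1 -Fx => E.
    apply/eqP; rewrite -(@pexpr_eq1 _ _ 2)// ?mulr_ge0 ?ltW//.
    by rewrite exprMn -[X in _ == X]E; apply/eqP; ring.
  have sw : s (coord_map f i j x) = expR (w (f y)).
    have E := bemb_btail y0; set z := btail (coord_map f i j x) in E.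
    have jz : img j (bemb z) by rewrite E.
    have [_ [_ /(_ j z jz) h1]] := hr; have [_ [_ /(_ j z jz) h2]] := hrho.
    have := hw j z jz; rewrite -h1 -h2 E Fx (coordK hM jy).
    move=> /matrixP/(_ ord0 ord0); rewrite !mxE E Gs !mxE.
    have d0 := posdef_diag (lift ord0 ord0) (lc_posdef (lr j) Vy).
    move/(mulIf (lt0r_neq0 d0)) => /eqP.
    rewrite expRM_natl.
    by rewrite -[in X in _ -> X]Fx (eqrXn2 _ (ltW s0) (expR_ge0 _))// => /eqP.
  rewrite -sw mulrA [_ * c]mulrC cs mul1r.
  (* Both limits are those of the curvature for g_+ along the same W. *)
  pose W := normal_field (coord_map f i j) (gbar j) nu.
  have CF1 k : Ck 1 (chart_pair f i j) (fun z => coord_map f i j z 0 k).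
    exact: Ck_le (Ck_coord_map hm hcc i j k).
  have oU : relopen (chart_pair f i j) by exact: (relopen_chart_pair hM hcc).
  have UV := @chart_pair_img _ _ _ _ _ _ f i j.
  have fJ := @jac_row_free _ _ _ _ _ _ _ _ _ hcc i j.
  have CG0 : Ckmx 0 (img j) (gbar j) by move=> a b; exact: CkS (lc_metric (lr j) a b).
  have CW k : Ck 0 (chart_pair f i j) (fun z => W z 0 k).
    exact: (Ck_normal_field oU (oV j) UV fJ (lc_posdef (lr j)) CF1 CG0).
  have nW z : chart_pair f i j z ->
      normal (gbar j (coord_map f i j z)) (jac (halfspace R n) (coord_map f i j) z) (W z).
    exact: (normal_field_normal UV fJ (lc_posdef (lr j))).
  have nWt z : chart_pair f i j z ->
      normal (gbart j (coord_map f i j z)) (jac (halfspace R n) (coord_map f i j) z) (W z).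
    by move=> Uz; have [_ _ ->] := sE _ (UV _ Uz); apply: normalZm; exact: nW.
  have Wx : W x = nu.
    apply: (normal_field_id UV (lc_posdef (lr j))) => //.
    by apply: normal_of_inner => v; rewrite Fx; case: unu => _; exact.
  have L1 := special_limit_cvg hm hM hgm hC0 hcc tang hr CW nW Ux x0.
  have L2 := special_limit_cvg hm hM hgm hC0 hcc tang hrho CW nWt Ux x0.
  have [Hx _] := oU x Ux; have PF := increments_proper ord0 Hx.
  rewrite Wx in L1 L2.
  by apply: (cvg_unique _ L1 L2).
split.
  move=> E0; apply: (mean_curvature_bigO2 hm hM hgm hC0 hcc tang hr) => i j x nu [ix jx] x0 nnu.
  have Ux : chart_pair f i j x by split.
  have [->|nu0] := eqVneq nu 0.
    by rewrite /special_limit -(scale0r 0) boundary_limitZ mul0r.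
  have Vy := chart_pair_img Ux; have pG := lc_posdef (lr j) Vy.
  set q := inner (gbar j (coord_map f i j x)) nu nu.
  have q0 : 0 < q by apply: pG.2.
  have s0 : 0 < Num.sqrt q by rewrite sqrtr_gt0.
  have iy := dom_par hAY ix; have yb := bdry_par hAY ix x0.
  have un : hyp_unit_normal f gbar i j (par i x) ((Num.sqrt q)^-1 *: nu).
    rewrite /hyp_unit_normal (parK hAY ix); apply/unit_normalE; split; last exact: normalZ.
    rewrite innerZl innerZr -/(coord_map f i j x) -/q -{3}(sqr_sqrtr (ltW q0)).
    by field; rewrite gt_eqF.
  have := E0 i j _ _ yb iy jx un.
  rewrite (eta_nB00_limit hm hM hC0 hcc tang hr yb iy jx un) (parK hAY ix).
  rewrite /special_limit boundary_limitZ => /eqP.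
  by rewrite mulf_eq0 invr_eq0 gt_eqF// => /eqP.
move=> O2 i j y nu yb iy jy unu.
rewrite (eta_nB00_limit hm hM hC0 hcc tang hr yb iy jy unu).
have Ux := chart_pairP hcc iy jy.
have x0 := bdry_coordY hm hM hC0 hcc iy yb.
apply: (special_limit_eq0 hm hM hgm hC0 hcc tang hr O2 Ux x0).
apply: normal_of_inner => v; rewrite (coord_map_coord hcc j iy).
by case: unu => _; exact.
Qed.
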